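(* One has $$\mathcal{W}(\mathcal{Q}_2,C^*(u))=\left\langle[\sigma],\,[\operatorname{Ad}(U_\xi)]:\xi\in\mathbb{Z}(2^\infty)\right\rangle\cong\mathbb{Z}(2^\infty)\rtimes\mathbb{Z}/2\mathbb{Z},$$ where the non-trivial element of $\mathbb{Z}/2\mathbb{Z}$ acts on $\mathbb{Z}(2^\infty)$ by inversion, and $$\mathcal{W}_\pi(\mathcal{Q}_2,C^*(u))=\{[\mathrm{id}],[\sigma]\}\cong\mathbb{Z}/2\mathbb{Z}.$$
   Context: The 2-adic ring $C^*$-algebra $\mathcal{Q}_2$ is the universal unital $C^*$-algebra generated by a unitary $u$ and an isometry $s_2$ with $s_2u=u^2s_2$ and $s_2s_2^*+us_2s_2^*u^*=1$. Put $s_1:=us_2$. The canonical representation of $\mathcal{Q}_2$ is the faithful representation on $\ell^2(\mathbb{Z})$ (orthonormal basis $(e_k)_{k\in\mathbb{Z}}$) with $ue_k=e_{k+1}$, $s_2e_k=e_{2k}$. $\mathbb{Z}(2^\infty)=\{z\in\mathbb{T}: z^{2^n}=1\text{ for some integer }n\ge0\}$ is the Prüfer 2-group. For $\xi\in\mathbb{Z}(2^\infty)$, the unitary $U_\xi e_k=\xi^ke_k$ belongs to $\mathcal{Q}_2$ in its canonical representation; $\operatorname{Ad}(w)(x)=wxw^*$. The flip-flop $\sigma\in\operatorname{Aut}(\mathcal{Q}_2)$ is given by $\sigma(s_1)=s_2$, $\sigma(s_2)=s_1$, $\sigma(u)=u^*$. $\operatorname{Aut}(\mathcal{Q}_2,C^*(u))$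 is the group of automorphisms $\phi$ of $\mathcal{Q}_2$ with $\phi(C^*(u))=C^*(u)$, and $\operatorname{Aut}_{C^*(u)}(\mathcal{Q}_2)$ is its (normal) subgroup of automorphisms fixing $C^*(u)$ pointwise. $\operatorname{Out}(\mathcal{Q}_2,C^*(u))$ and $\operatorname{Out}_{C^*(u)}(\mathcal{Q}_2)$ are the images of these two groups in $\operatorname{Out}(\mathcal{Q}_2)$, the quotient of $\operatorname{Aut}(\mathcal{Q}_2)$ by the inner automorphisms. The Weyl group and its outer counterpart are $\mathcal{W}(\mathcal{Q}_2,C^*(u))=\operatorname{Aut}(\mathcal{Q}_2,C^*(u))/\operatorname{Aut}_{C^*(u)}(\mathcal{Q}_2)$ and $\mathcal{W}_\pi(\mathcal{Q}_2,C^*(u))=\operatorname{Out}(\mathcal{Q}_2,C^*(u))/\operatorname{Out}_{C^*(u)}(\mathcal{Q}_2)$. Brackets denote classes in the respective quotient and $\langle\cdot\rangle$ the group generated. *)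

(* Defs.v *)
From HB Require Import structures.
From mathcomp Require Import all_boot all_order all_algebra.
From mathcomp Require Import all_classical all_reals all_analysis.
From mathcomp Require Import complex.

Set Implicit Arguments.
Unset Strict Implicit.
Unset Printing Implicit Defensive.

Import Order.TTheory GRing.Theory Num.Theory.
Import numFieldNormedType.Exports.

Local Open Scope classical_set_scope.
Local Open Scope ring_scope.

Section Subgroups.
Variable G : groupType.
Local Open Scope group_scope.

Record subgroup := Subgroup {
  subgroup_set :> set G;
  subgroup1 : subgroup_set 1;
  subgroupM : forall x y, subgroup_set x -> subgroup_set y ->
                subgroup_set (x * y);
  subgroupV : forall x, subgroup_set x -> subgroup_set x^-1 }.

Definition gen (S : set G) : set G :=
  [set x | forall H : subgroup, S `<=` H -> subgroup_set H x].

Definition is_normal (K H : subgroup) : Prop :=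
  K `<=` H /\ forall h k,
    subgroup_set H h -> subgroup_set K k -> subgroup_set K (h * k * h^-1).

Record normal_subgroup := NormalSubgroup {
  normal_set :> subgroup;
  normalJ : forall g n,
    subgroup_set normal_set n -> subgroup_set normal_set (g * n * g^-1) }.

End Subgroups.

Record subgroup_type (G : groupType) (H : subgroup G) :=
  SubgroupType { sgval : G; sgvalP : subgroup_set H sgval }.

Section SubgroupType.
Variables (G : groupType) (H : subgroup G).
Local Open Scope group_scope.

HB.instance Definition _ := gen_eqMixin (subgroup_type H).
HB.instance Definition _ := gen_choiceMixin (subgroup_type H).

Lemma sgval_inj : injective (@sgval G H).
Proof.
by move=> [x Hx] [y Hy] /= xy; subst y; congr SubgroupType; exact: Prop_irrelevance.
Qed.

Definition sg_one : subgroup_type H := SubgroupType (subgroup1 H).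
Definition sg_mul (x y : subgroup_type H) : subgroup_type H :=
  SubgroupType (subgroupM (sgvalP x) (sgvalP y)).
Definition sg_inv (x : subgroup_type H) : subgroup_type H :=
  SubgroupType (subgroupV (sgvalP x)).

Fact sg_mulA : associative sg_mul.
Proof. by move=> x y z; apply: sgval_inj; rewrite /= mulgA. Qed.
Fact sg_mul1 : left_id sg_one sg_mul.
Proof. by move=> x; apply: sgval_inj; rewrite /= mul1g. Qed.
Fact sg_1mul : right_id sg_one sg_mul.
Proof. by move=> x; apply: sgval_inj; rewrite /= mulg1. Qed.
Fact sg_mulV : left_inverse sg_one sg_inv sg_mul.
Proof. by move=> x; apply: sgval_inj; rewrite /= mulVg. Qed.
Fact sg_Vmul : right_inverse sg_one sg_inv sg_mul.
Proof. by move=> x; apply: sgval_inj; rewrite /= mulgV. Qed.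

HB.instance Definition _ := isGroup.Build (subgroup_type H)
  sg_mulA sg_mul1 sg_1mul sg_mulV sg_Vmul.

End SubgroupType.

Section Quotient.
Variables (G : groupType) (N : normal_subgroup G).
Local Open Scope group_scope.
Local Open Scope quotient_scope.

Definition coset_rel : rel G := fun x y => `[< subgroup_set N (x^-1 * y) >].

Fact coset_rel_refl : reflexive coset_rel.
Proof. by move=> x; apply/asboolP; rewrite mulVg; exact: subgroup1. Qed.

Fact coset_rel_sym : symmetric coset_rel.
Proof.
move=> x y; apply: asbool_equiv_eq.
by split=> /subgroupV; rewrite invgM invgK.
Qed.

Fact coset_rel_trans : transitive coset_rel.
Proof.
move=> y x z /asboolP Nxy /asboolP Nyz; apply/asboolP.
by have := subgroupM Nxy Nyz; rewrite mulgA mulgK.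
Qed.

Definition coset_equiv : equiv_rel G :=
  EquivRel coset_rel coset_rel_refl coset_rel_sym coset_rel_trans.

Definition quotient_group := {eq_quot coset_equiv}.
HB.instance Definition _ := Choice.on quotient_group.
HB.instance Definition _ := EqQuotient.on quotient_group.

Definition class (x : G) : quotient_group := \pi_quotient_group x.

Lemma classP x y : class x = class y <-> subgroup_set N (x^-1 * y).
Proof.
split; first by move/eqquotP/asboolP.
by move=> Nxy; apply/eqquotP/asboolP.
Qed.

Lemma class_repr (a : quotient_group) : class (repr a) = a.
Proof. exact: reprK. Qed.

Definition quo_one : quotient_group := class 1.
Definition quo_mul (a b : quotient_group) : quotient_group :=
  class (repr a * repr b).
Definition quo_inv (a : quotient_group) : quotient_group := class (repr a)^-1.

Lemma classM x y : class (x * y) = quo_mul (class x) (class y).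
Proof.
apply/classP; rewrite invgM.
have /classP Nx : class x = class (repr (class x)) by rewrite class_repr.
have /classP Ny : class y = class (repr (class y)) by rewrite class_repr.
have := subgroupM (normalJ y^-1 Nx) Ny; rewrite invgK.
by rewrite !mulgA mulgK.
Qed.

Lemma classV x : class x^-1 = quo_inv (class x).
Proof.
apply/classP; rewrite invgK.
have /classP Nx : class (repr (class x)) = class x by rewrite class_repr.
by have := normalJ (repr (class x)) Nx; rewrite !mulgA mulgV mul1g.
Qed.

Fact quo_mulA : associative quo_mul.
Proof.
move=> a b c; rewrite -[a]class_repr -[b]class_repr -[c]class_repr.
by rewrite -!classM mulgA.
Qed.
Fact quo_mul1 : left_id quo_one quo_mul.
Proof. by move=> a; rewrite -[a]class_repr -classM mul1g. Qed.
Fact quo_1mul : right_id quo_one quo_mul.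
Proof. by move=> a; rewrite -[a]class_repr -classM mulg1. Qed.
Fact quo_mulV : left_inverse quo_one quo_inv quo_mul.
Proof. by move=> a; rewrite -[a]class_repr -classV -classM mulVg. Qed.
Fact quo_Vmul : right_inverse quo_one quo_inv quo_mul.
Proof. by move=> a; rewrite -[a]class_repr -classV -classM mulgV. Qed.

HB.instance Definition _ := isGroup.Build quotient_group
  quo_mulA quo_mul1 quo_1mul quo_mulV quo_Vmul.

Section Image.
Variable H : subgroup G.
Definition image_set : set quotient_group := class @` H.
Fact image_set1 : image_set 1.
Proof. by exists 1 => //; exact: subgroup1. Qed.
Fact image_setM a b : image_set a -> image_set b -> image_set (a * b).
Proof.
move=> [x Hx <-] [y Hy <-]; exists (x * y); last exact: classM.
exact: subgroupM.
Qed.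
Fact image_setV a : image_set a -> image_set a^-1.
Proof.
by move=> [x Hx <-]; exists x^-1; [exact: subgroupV | exact: classV].
Qed.
Definition image_subgroup : subgroup quotient_group :=
  Subgroup image_set1 image_setM image_setV.
End Image.

Lemma image_normal (K H : subgroup G) :
  is_normal K H -> is_normal (image_subgroup K) (image_subgroup H).
Proof.
move=> [KH nKH]; split; first exact: image_subset.
move=> _ _ [h Hh <-] [k Kk <-]; exists (h * k * h^-1); first exact: nKH.
by rewrite !classM classV.
Qed.

End Quotient.

(** The quotient [H / K] of two subgroups of [G], with [K] normal in [H] (but
    not necessarily in [G]). *)
Section Subquotient.
Variables (G : groupType) (K H : subgroup G) (nKH : is_normal K H).
Local Open Scope group_scope.

Definition sub_set : set (subgroup_type H) := [set x | subgroup_set K (sgval x)].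
Fact sub_set1 : sub_set 1. Proof. exact: subgroup1. Qed.
Fact sub_setM x y : sub_set x -> sub_set y -> sub_set (x * y).
Proof. exact: subgroupM. Qed.
Fact sub_setV x : sub_set x -> sub_set x^-1.
Proof. exact: subgroupV. Qed.
Fact sub_setJ g n : sub_set n -> sub_set (g * n * g^-1).
Proof. by move=> Kn; apply: (nKH.2) => //; exact: sgvalP. Qed.

Definition sub_normal : normal_subgroup (subgroup_type H) :=
  @NormalSubgroup _ (Subgroup sub_set1 sub_setM sub_setV) sub_setJ.

Definition subquotient : groupType := quotient_group sub_normal.

Definition subclass (x : subgroup_type H) : subquotient := class sub_normal x.

End Subquotient.

Definition isomorphic (G H : groupType) : Prop :=
  exists f : {multiplicative G -> H}, bijective f.

Record group_action (K N : groupType) := GroupAction {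
  act_fun :> K -> N -> N;
  act_fun1 : forall x, act_fun 1%g x = x;
  act_funM : forall k l x, act_fun (k * l)%g x = act_fun k (act_fun l x);
  act_fun_morph : forall k x y,
    act_fun k (x * y)%g = (act_fun k x * act_fun k y)%g }.

Record semidirect (K N : groupType) (a : group_action K N) :=
  Semidirect { sd_fst : N; sd_snd : K }.

Section Semidirect.
Variables (K N : groupType) (a : group_action K N).
Local Open Scope group_scope.
Local Notation T := (semidirect a).

HB.instance Definition _ := gen_eqMixin T.
HB.instance Definition _ := gen_choiceMixin T.

Definition sd_one : T := Semidirect a 1 1.
Definition sd_mul (p q : T) : T :=
  Semidirect a (sd_fst p * a (sd_snd p) (sd_fst q)) (sd_snd p * sd_snd q).
Definition sd_inv (p : T) : T :=
  Semidirect a (a (sd_snd p)^-1 (sd_fst p)^-1) (sd_snd p)^-1.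

Lemma act1 k : a k 1 = 1.
Proof.
by apply: (mulgI (a k 1)); rewrite -act_fun_morph !mulg1.
Qed.

Fact sd_mulA : associative sd_mul.
Proof.
move=> [x k] [y l] [z m]; rewrite /sd_mul /=.
by rewrite act_fun_morph act_funM !mulgA.
Qed.
Fact sd_mul1 : left_id sd_one sd_mul.
Proof. by move=> [x k]; rewrite /sd_mul /= act_fun1 !mul1g. Qed.
Fact sd_1mul : right_id sd_one sd_mul.
Proof. by move=> [x k]; rewrite /sd_mul /= act1 !mulg1. Qed.
Fact sd_mulV : left_inverse sd_one sd_inv sd_mul.
Proof.
move=> [x k]; rewrite /sd_mul /sd_inv /sd_one /=.
by rewrite -act_fun_morph !mulVg act1.
Qed.
Fact sd_Vmul : right_inverse sd_one sd_inv sd_mul.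
Proof.
move=> [x k]; rewrite /sd_mul /sd_inv /sd_one /=.
by rewrite -act_funM !mulgV act_fun1 mulgV.
Qed.

HB.instance Definition _ := isGroup.Build T
  sd_mulA sd_mul1 sd_1mul sd_mulV sd_Vmul.

End Semidirect.

Section Prufer.
Variable R : realType.

Definition prufer_set : set R[i] :=
  [set z | `|z| = 1 /\ exists n : nat, z ^+ (2 ^ n)%N = 1].

Record prufer := Prufer { prufer_val :> R[i]; pruferP : prufer_set prufer_val }.

HB.instance Definition _ := gen_eqMixin prufer.
HB.instance Definition _ := gen_choiceMixin prufer.

Lemma prufer_val_inj : injective prufer_val.
Proof.
by move=> [x Hx] [y Hy] /= xy; subst y; congr Prufer; exact: Prop_irrelevance.
Qed.

Fact prufer_set1 : prufer_set 1.
Proof. by split; [exact: normr1 | exists 0%N; rewrite expr1n]. Qed.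

Fact prufer_setM x y : prufer_set x -> prufer_set y -> prufer_set (x * y).
Proof.
move=> [nx [m xm]] [ny [n yn]]; split; first by rewrite normrM nx ny mulr1.
by exists (m + n)%N; rewrite exprMn expnD exprM xm expr1n mul1r mulnC exprM yn expr1n.
Qed.

Fact prufer_setV x : prufer_set x -> prufer_set x^-1.
Proof.
move=> [nx [m xm]]; split; first by rewrite normfV nx invr1.
by exists m; rewrite exprVn xm invr1.
Qed.

Definition prufer_one : prufer := Prufer prufer_set1.
Definition prufer_mul (x y : prufer) : prufer :=
  Prufer (prufer_setM (pruferP x) (pruferP y)).
Definition prufer_inv (x : prufer) : prufer := Prufer (prufer_setV (pruferP x)).

Fact prufer_neq0 (x : prufer) : (x : R[i]) != 0.
Proof. by rewrite -normr_eq0; case: x => z [/= -> _]; exact: oner_neq0. Qed.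

Fact prufer_mulA : associative prufer_mul.
Proof. by move=> x y z; apply: prufer_val_inj; rewrite /= mulrA. Qed.
Fact prufer_mul1 : left_id prufer_one prufer_mul.
Proof. by move=> x; apply: prufer_val_inj; rewrite /= mul1r. Qed.
Fact prufer_1mul : right_id prufer_one prufer_mul.
Proof. by move=> x; apply: prufer_val_inj; rewrite /= mulr1. Qed.
Fact prufer_mulV : left_inverse prufer_one prufer_inv prufer_mul.
Proof.
by move=> x; apply: prufer_val_inj; rewrite /= mulVf// prufer_neq0.
Qed.
Fact prufer_Vmul : right_inverse prufer_one prufer_inv prufer_mul.
Proof.
by move=> x; apply: prufer_val_inj; rewrite /= divff// prufer_neq0.
Qed.

HB.instance Definition _ := isGroup.Build prufer
  prufer_mulA prufer_mul1 prufer_1mul prufer_mulV prufer_Vmul.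

Fact prufer_mulC : commutative prufer_mul.
Proof. by move=> x y; apply: prufer_val_inj; rewrite /= mulrC. Qed.

(** The group law of ['Z_2] is the addition mod 2, hence [1%g : 'Z_2] is the
    residue class of 0. *)
Definition inversion_fun (k : 'Z_2) (x : prufer) : prufer :=
  if k == 1%g then x else (x^-1)%g.

Fact inversion1 x : inversion_fun 1%g x = x.
Proof. by rewrite /inversion_fun eqxx. Qed.

Fact inversionM (k l : 'Z_2) x :
  inversion_fun (k * l)%g x = inversion_fun k (inversion_fun l x).
Proof.
rewrite /inversion_fun.
by case: k l => [[|[|k]] ?] // [[|[|l]] ?] //=; rewrite ?invgK.
Qed.

Fact inversion_morph k x y :
  inversion_fun k (x * y)%g = (inversion_fun k x * inversion_fun k y)%g.
Proof.
by rewrite /inversion_fun; case: ifP => // _; rewrite invgM; exact: prufer_mulC.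
Qed.

Definition inversion : group_action 'Z_2 prufer :=
  GroupAction inversion1 inversionM inversion_morph.

End Prufer.

(** A Banach algebra cannot be declared as the join of [GRing.Algebra] and
    [CompleteNormedModule] (the hierarchy of MathComp lacks the intermediate
    joins), so the multiplicative structure is given by explicit fields, from
    which the [algType] structure is then recovered. *)
Record cstarAlgType (R : realType) := CStarAlg {
  cstar_base : completeNormedModType R[i];
  cstar_one : cstar_base;
  cstar_mul : cstar_base -> cstar_base -> cstar_base;
  cstar_star : cstar_base -> cstar_base;
  cstar_mulA : associative cstar_mul;
  cstar_mul1 : left_id cstar_one cstar_mul;
  cstar_1mul : right_id cstar_one cstar_mul;
  cstar_mulDl : left_distributive cstar_mul +%R;
  cstar_mulDr : right_distributive cstar_mul +%R;
  cstar_one_neq0 : cstar_one != 0;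
  cstar_scaleAl : forall (c : R[i]) x y,
    c *: cstar_mul x y = cstar_mul (c *: x) y;
  cstar_scaleAr : forall (c : R[i]) x y,
    c *: cstar_mul x y = cstar_mul x (c *: y);
  cstar_starK : involutive cstar_star;
  cstar_starD : {morph cstar_star : x y / x + y};
  cstar_starZ : forall (c : R[i]) x, cstar_star (c *: x) = c^* *: cstar_star x;
  cstar_starM : forall x y,
    cstar_star (cstar_mul x y) = cstar_mul (cstar_star y) (cstar_star x);
  cstar_norm_mul : forall x y, `|cstar_mul x y| <= `|x| * `|y|;
  cstar_norm_star : forall x, `|cstar_mul (cstar_star x) x| = `|x| ^+ 2 }.

Definition cstar_carrier (R : realType) (A : cstarAlgType R) : Type :=
  cstar_base A.
Coercion cstar_carrier : cstarAlgType >-> Sortclass.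

Section CStarAlgebraTheory.
Variables (R : realType) (A : cstarAlgType R).

HB.instance Definition _ := CompleteNormedModule.on (cstar_carrier A).
HB.instance Definition _ := GRing.Zmodule_isNzRing.Build (cstar_carrier A)
  (@cstar_mulA R A) (@cstar_mul1 R A) (@cstar_1mul R A)
  (@cstar_mulDl R A) (@cstar_mulDr R A) (@cstar_one_neq0 R A).
HB.instance Definition _ :=
  GRing.Lmodule_isLalgebra.Build R[i] (cstar_carrier A) (@cstar_scaleAl R A).
HB.instance Definition _ :=
  GRing.Lalgebra_isAlgebra.Build R[i] (cstar_carrier A) (@cstar_scaleAr R A).

Definition star : A -> A := @cstar_star R A.

Lemma starK : involutive star. Proof. exact: cstar_starK. Qed.
Lemma starD : {morph star : x y / x + y}. Proof. exact: cstar_starD. Qed.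
Lemma starZ (c : R[i]) (x : A) : star (c *: x) = c^* *: star x.
Proof. exact: cstar_starZ. Qed.
Lemma starM (x y : A) : star (x * y) = star y * star x.
Proof. exact: cstar_starM. Qed.
Lemma normM_le (x y : A) : `|x * y| <= `|x| * `|y|.
Proof. exact: cstar_norm_mul. Qed.
Lemma norm_starM (x : A) : `|star x * x| = `|x| ^+ 2.
Proof. exact: cstar_norm_star. Qed.

End CStarAlgebraTheory.

Definition star_morphism (R : realType) (A B : cstarAlgType R) (f : A -> B) :=
  [/\ (forall (c : R[i]) (x y : A), f (c *: x + y) = c *: f x + f y),
      f 1 = 1,
      (forall x y, f (x * y) = f x * f y)
    & (forall x, f (star x) = star (f x))].

Record cstar_aut (R : realType) (A : cstarAlgType R) := CStarAut {
  aut_fun :> A -> A;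
  aut_inv : A -> A;
  aut_morph : star_morphism aut_fun;
  aut_funK : cancel aut_fun aut_inv;
  aut_invK : cancel aut_inv aut_fun }.

Section AutomorphismGroup.
Variables (R : realType) (A : cstarAlgType R).
Local Notation Aut := (cstar_aut A).

Lemma aut_eq (f g : Aut) : aut_fun f =1 aut_fun g -> f = g.
Proof.
case: f g => [f f' fm fK f'K] [g g' gm gK g'K] /= fg.
have {}fg : f = g by exact/funext.
subst g.
have ff : f' = g' by apply/funext => x; rewrite -[x in LHS]g'K fK.
by subst g'; congr CStarAut; exact: Prop_irrelevance.
Qed.

HB.instance Definition _ := gen_eqMixin Aut.
HB.instance Definition _ := gen_choiceMixin Aut.

Definition aut_one : Aut.
Proof. by exists id id. Defined.

Definition aut_mul (f g : Aut) : Aut.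
Proof.
exists (f \o g) (aut_inv g \o aut_inv f).
- have [fl f1 fM fs] := aut_morph f; have [gl g1 gM gs] := aut_morph g.
  by split=> [c x y||x y|x] /=; rewrite ?gl ?g1 ?gM ?gs.
- exact: can_comp (aut_funK f) (aut_funK g).
- exact: can_comp (aut_invK g) (aut_invK f).
Defined.

Definition aut_invg (f : Aut) : Aut.
Proof.
exists (aut_inv f) f; [|exact: aut_invK|exact: aut_funK].
have [fl f1 fM fs] := aut_morph f; have fI := can_inj (aut_funK f).
by split=> [c x y||x y|x]; apply: fI; rewrite ?fl ?fM ?fs !aut_invK.
Defined.

Fact aut_mulA : associative aut_mul.
Proof. by move=> f g h; exact: aut_eq. Qed.
Fact aut_mul1 : left_id aut_one aut_mul.
Proof. by move=> f; exact: aut_eq. Qed.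
Fact aut_1mul : right_id aut_one aut_mul.
Proof. by move=> f; exact: aut_eq. Qed.
Fact aut_mulV : left_inverse aut_one aut_invg aut_mul.
Proof. by move=> f; apply: aut_eq => x /=; rewrite aut_funK. Qed.
Fact aut_Vmul : right_inverse aut_one aut_invg aut_mul.
Proof. by move=> f; apply: aut_eq => x /=; rewrite aut_invK. Qed.

HB.instance Definition _ := isGroup.Build Aut
  aut_mulA aut_mul1 aut_1mul aut_mulV aut_Vmul.

Definition unitary (w : A) : Prop := w * star w = 1 /\ star w * w = 1.

Lemma star1 : star (1 : A) = 1.
Proof. by rewrite -[LHS]mul1r -[X in X * _]starK -starM mul1r starK. Qed.

Lemma unitary1 : unitary 1.
Proof. by split; rewrite star1 mulr1. Qed.

Lemma unitaryM v w : unitary v -> unitary w -> unitary (v * w).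
Proof.
move=> [v1 v2] [w1 w2]; split; rewrite starM.
  by rewrite mulrA -(mulrA v) w1 mulr1.
by rewrite mulrA -(mulrA _ _ v) v2 mulr1.
Qed.

Lemma unitary_star w : unitary w -> unitary (star w).
Proof. by move=> [w1 w2]; split; rewrite starK. Qed.

Definition Ad (w : A) (hw : unitary w) : Aut.
Proof.
exists (fun x => w * x * star w) (fun x => star w * x * w).
- case: hw => w1 w2; split=> [c x y||x y|x].
  + by rewrite mulrDr mulrDl -scalerAr -scalerAl.
  + by rewrite mulr1.
  + by rewrite !mulrA -(mulrA _ (star w) w) w2 mulr1.
  + by rewrite !starM starK mulrA.
- by case: hw => w1 w2 x; rewrite !mulrA w2 mul1r -mulrA w2 mulr1.
- by case: hw => w1 w2 x; rewrite !mulrA w1 mul1r -mulrA w1 mulr1.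
Defined.

Definition inner_set : set Aut :=
  [set f | exists w (hw : unitary w), f = Ad hw].

Fact inner_set1 : inner_set 1%g.
Proof.
by exists 1, unitary1; apply: aut_eq => x /=; rewrite star1 mul1r mulr1.
Qed.

Fact inner_setM f g : inner_set f -> inner_set g -> inner_set (f * g)%g.
Proof.
move=> [v [hv ->]] [w [hw ->]]; exists (v * w), (unitaryM hv hw).
by apply: aut_eq => x /=; rewrite starM !mulrA.
Qed.

Fact inner_setV f : inner_set f -> inner_set (f^-1)%g.
Proof.
move=> [w [hw ->]]; exists (star w), (unitary_star hw).
by apply: aut_eq => x /=; rewrite starK.
Qed.

Lemma aut_unitary (f : Aut) w : unitary w -> unitary (f w).
Proof.
have [_ f1 fM fs] := aut_morph f.
by move=> [w1 w2]; split; rewrite -fs -fM ?w1 ?w2 f1.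
Qed.

Fact inner_setJ g n : inner_set n -> inner_set (g * n * g^-1)%g.
Proof.
move=> [w [hw ->]]; exists (g w), (aut_unitary g hw).
have [_ g1 gM gs] := aut_morph g.
by apply: aut_eq => x /=; rewrite !gM gs aut_invK.
Qed.

Definition Inn : normal_subgroup Aut :=
  @NormalSubgroup _ (Subgroup inner_set1 inner_setM inner_setV) inner_setJ.

Definition Out : groupType := quotient_group Inn.

(** [AutPair] is Aut(A, D) and [AutFix] is Aut_D(A); [OutPair] and [OutFix] are
    their images in Out(A). *)
Section Relative.
Variable D : set A.

Definition stab_set : set Aut := [set f | aut_fun f @` D = D].
Definition fix_set : set Aut := [set f | forall x, D x -> f x = x].

Fact stab_set1 : stab_set 1%g. Proof. exact: image_id. Qed.
Fact stab_setM f g : stab_set f -> stab_set g -> stab_set (f * g)%g.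
Proof. by rewrite /stab_set /= => fD gD; rewrite -image_comp gD fD. Qed.
Fact stab_setV f : stab_set f -> stab_set (f^-1)%g.
Proof.
rewrite /stab_set /= => fD; apply/seteqP; split=> x.
  by rewrite -[in X in X -> _]fD => -[_ [y Dy <-] <-] /=; rewrite aut_funK.
by move=> Dx; exists (f x); rewrite ?aut_funK// -fD; exists x.
Qed.

Fact fix_set1 : fix_set 1%g. Proof. by []. Qed.
Fact fix_setM f g : fix_set f -> fix_set g -> fix_set (f * g)%g.
Proof. by move=> fD gD x Dx /=; rewrite gD// fD. Qed.
Fact fix_setV f : fix_set f -> fix_set (f^-1)%g.
Proof. by move=> fD x Dx /=; rewrite -[x in LHS]fD// aut_funK. Qed.

Definition AutPair : subgroup Aut := Subgroup stab_set1 stab_setM stab_setV.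
Definition AutFix : subgroup Aut := Subgroup fix_set1 fix_setM fix_setV.

Lemma AutFix_normal : is_normal AutFix AutPair.
Proof.
split=> [f fD|h k hD kD x Dx] /=.
  rewrite /= /stab_set /=; apply/seteqP; split=> [_ [x Dx <-]|x Dx].
    by rewrite fD.
  by exists x => //; exact: fD.
have : D (aut_inv h x).
  by have := stab_setV hD; rewrite /stab_set /= => <-; exists x.
by move=> Dy; rewrite kD// aut_invK.
Qed.

Definition OutPair : subgroup Out := image_subgroup Inn AutPair.
Definition OutFix : subgroup Out := image_subgroup Inn AutFix.

Definition OutFix_normal : is_normal OutFix OutPair :=
  image_normal Inn AutFix_normal.

Definition weyl : groupType := subquotient AutFix_normal.
Definition outer_weyl : groupType := subquotient OutFix_normal.

Definition weyl_class (f : subgroup_type AutPair) : weyl :=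
  subclass AutFix_normal f.

Definition out_class (f : subgroup_type AutPair) : subgroup_type OutPair :=
  @SubgroupType _ OutPair (class Inn (sgval f))
    (imageP (class Inn) (sgvalP f)).

Definition outer_weyl_class (f : subgroup_type AutPair) : outer_weyl :=
  subclass OutFix_normal (out_class f).

End Relative.

(** C*-subalgebras, not required to contain the unit of [A] *)
Definition cstar_subalgebra (D : set A) : Prop :=
  [/\ closed D,
      (D 0 /\ forall (c : R[i]) x y, D x -> D y -> D (c *: x + y)),
      (forall x y, D x -> D y -> D (x * y))
    & (forall x, D x -> D (star x))].

Definition cstar_gen (S : set A) : set A := smallest cstar_subalgebra S.

End AutomorphismGroup.

Section Q2.
Variable R : realType.

Definition Q2_relations (A : cstarAlgType R) (u s2 : A) : Prop :=
  [/\ unitary u,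
      star s2 * s2 = 1,
      s2 * u = u ^+ 2 * s2
    & s2 * star s2 + u * s2 * star s2 * star u = 1].

(** The universal property determines [(A, u, s2)] up to isomorphism. As every
    [algType] has [1 != 0], the target [B] ranges over the nonzero unital
    C*-algebras; the zero algebra would impose no condition. *)
Definition is_Q2 (A : cstarAlgType R) (u s2 : A) : Prop :=
  Q2_relations u s2 /\
  forall (B : cstarAlgType R) (v t : B), Q2_relations v t ->
    exists! f : A -> B, [/\ star_morphism f, f u = v & f s2 = t].

Definition is_flip_flop (A : cstarAlgType R) (u s2 : A) (f : A -> A) : Prop :=
  [/\ f (u * s2) = s2, f s2 = u * s2 & f u = star u].

(** Hilbert spaces: complete normed spaces over [R[i]] whose norm comes from
    an inner product. *)
Definition is_inner_product (H : completeNormedModType R[i])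
    (ip : H -> H -> R[i]) : Prop :=
  [/\ (forall (c : R[i]) x y z, ip (c *: x + y) z = c * ip x z + ip y z),
      (forall x y, ip y x = (ip x y)^*)
    & (forall x, ip x x = `|x| ^+ 2)].

Definition orthonormal_basis (H : completeNormedModType R[i])
    (ip : H -> H -> R[i]) (I : eqType) (e : I -> H) : Prop :=
  (forall j k, ip (e j) (e k) = (j == k)%:R) /\
  closure [set x | exists (r : seq I) (c : I -> R[i]),
                     x = \sum_(k <- r) c k *: e k] = setT.

Definition is_representation (A : cstarAlgType R)
    (H : completeNormedModType R[i]) (ip : H -> H -> R[i])
    (rho : A -> {linear H -> H}) : Prop :=
  [/\ (forall a, continuous (rho a)),
      (forall (c : R[i]) a b x, rho (c *: a + b) x = c *: rho a x + rho b x),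
      (forall x, rho 1 x = x),
      (forall a b x, rho (a * b) x = rho a (rho b x))
    & (forall a x y, ip (rho a x) y = ip x (rho (star a) y))].

Definition faithful (A : cstarAlgType R) (H : completeNormedModType R[i])
    (rho : A -> {linear H -> H}) : Prop :=
  forall a, (forall x, rho a x = 0) -> a = 0.

(** [ℓ²(Z)] is given as a Hilbert space [H] with an orthonormal basis
    [(e k)], [k : int]; this determines it up to unitary equivalence. *)
Definition canonical_representation (A : cstarAlgType R) (u s2 : A)
    (H : completeNormedModType R[i]) (ip : H -> H -> R[i]) (e : int -> H)
    (rho : A -> {linear H -> H}) : Prop :=
  [/\ is_representation ip rho,
      faithful rho,
      (forall k : int, rho u (e k) = e (k + 1))
    & (forall k : int, rho s2 (e k) = e (2 * k))].

End Q2.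

(* Main.v *)
Require Import Defs.
From HB Require Import structures.
From mathcomp Require Import all_boot all_order all_algebra.
From mathcomp Require Import all_classical all_reals all_analysis.
From mathcomp Require Import complex.
From mathcomp Require Import ring lra zify.

Set Implicit Arguments.
Unset Strict Implicit.
Unset Printing Implicit Defensive.

Import Order.TTheory GRing.Theory Num.Theory.
Import numFieldNormedType.Exports.

Local Open Scope classical_set_scope.
Local Open Scope ring_scope.

(** For z on the unit circle let E_z be the state of Q_2 obtained as the limit
    of vector states of the canonical representation along waves
    sum_k z^-k e_k over windows far away from 0. It is multiplicative over
    C*(u) on both sides, E_z(u) = z, it depends continuously on z, and
    E_z(u^i s_2^m s_2^*n u^j) = 0 if m <> n: thus E_z is evaluation at z after
    the conditional expectation onto C*(u) = C(T).

    If t u = X t with X in C*(u) and E_z(t t^* ) <> 0 for all z, density of the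
    monomials yields near each z some m, n and a monomial a of this type with
    E_z(t a) <> 0, and the intertwining relation forces
    E_y(X)^(2^m) = y^(2^n) for y near z. By connectedness the exponents can be
    chosen globally. Hence u and u^* are not unitarily equivalent in Q_2.

    An automorphism phi preserving C*(u) acts there by a homeomorphism f of
    the circle. Applied to t = phi(s_2), the above shows that
    F = f^-1 o (z |-> z^2) o f satisfies F(z)^(2^N) = z^(2^k), and since F is
    two-to-one, F(z) = zeta z^2 with zeta in the Pruefer group. So f is, up to
    a rotation by zeta, a homeomorphism commuting with z |-> z^2, that is,
    z or z^-1; therefore phi(u) is xi u or xi u^* with xi in the Pruefer
    group. *)

(** The identification of C*(u) with C(T) is never constructed; the states E_z stand in for it. They
    separate the points of C*(u), and on C*(u) the composite of E_z with a homomorphism f such that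
    f(u) lies in C*(u) is E_w with w = E_z(f(u)). Hence the circle maps are simply defined as values
    of states: f(z) = E_z(phi(u)) and F(z) = E_z(phi(Y(phi^-1(u)))), where Y is the canonical
    endomorphism x |-> s_2 x s_2^* + u s_2 x s_2^* u^*.

    Existence and continuity of E_z, and the choice of exponents, are checked on monomials and
    carried over by density. This requires bounds uniform in z but no sharp constants, so
    boundedness with the constant 2 suffices throughout.

    The intertwining relation controls only powers of E_z(X) with exponent 2^m. What it leaves open
    is a factor that is a root of unity of 2-power order; it varies continuously with z, so it is
    constant, and this constant is the source of the Pruefer group.

    In the outer quotient the rotations disappear because they are inner, and the class of sigma is
    trivial only if an inner automorphism carries u to u^*. *)

Section ClosedSets.
Variables (R : realType) (V : normedModType R[i]).

Lemma closed_approxP (D : set V) : closed D <->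
  forall x, (forall e : R[i], 0 < e -> exists2 y, D y & `|x - y| < e) -> D x.
Proof.
split=> [cD x xD|H].
  apply: cD => B /nbhs_ballP[e /= e0 xB].
  have [y Dy xy] := xD e e0.
  by exists y; split=> //; apply: xB; rewrite -ball_normE.
move=> x xD; apply: H => e e0.
have [y [Dy]] := xD _ (nbhsx_ballx x e e0).
by rewrite -ball_normE /= => xy; exists y.
Qed.

End ClosedSets.

Lemma cauchy_seq_cvg (R : realType) (V : completeNormedModType R[i])
    (x : nat -> V) :
  (forall e : R[i], 0 < e -> exists N, forall m n, (N <= m)%N -> (N <= n)%N ->
     `|x m - x n| < e) ->
  exists l, forall e : R[i], 0 < e -> exists N, forall n, (N <= n)%N ->
     `|x n - l| < e.
Proof.
move=> xC.
have xc : cvg (x @ \oo).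
  apply: cauchy_cvg; apply/cauchy_ballP => e e0; near_simpl.
  have [N HN] := xC e e0.
  exists ([set n | (N <= n)%N], [set n | (N <= n)%N]).
    by split; exists N.
  move=> [m n] [/= Nm Nn]; rewrite -ball_normE /=; exact: HN.
exists (lim (x @ \oo)) => e e0.
have /cvgrPdist_lt/(_ e e0)[N _ HN] := xc.
by exists N => n Nn; rewrite distrC; apply: HN.
Qed.

(** * Boundedness of *-homomorphisms *)

Lemma small_eq0 (R : realType) (V : normedModType R[i]) (x : V) :
  (forall e : R[i], 0 < e -> `|x| < e) -> x = 0.
Proof.
move=> H; apply/eqP/negPn/negP => x0; have := H `|x|.
by rewrite normr_gt0 x0 ltxx => /(_ isT).
Qed.

Lemma closed_preimage (R : realType) (V W : normedModType R[i]) (f : V -> W)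
    (C : R[i]) (D : set W) : 0 < C -> (forall x y, `|f x - f y| <= C * `|x -
      y|) ->
  closed D -> closed (f @^-1` D).
Proof.
move=> C0 fC /closed_approxP cD; apply/closed_approxP => x xD /=.
apply: cD => e e0; have [y Dy xy] := xD (e / C) (divr_gt0 e0 C0).
exists (f y) => //; apply: le_lt_trans (fC _ _) _.
by rewrite mulrC -ltr_pdivlMr.
Qed.

Lemma closed_equalizer (R : realType) (V W : normedModType R[i]) (f g : V -> W)
    (C : R[i]) : 0 < C -> (forall x y, `|f x - f y| <= C * `|x - y|) ->
  (forall x y, `|g x - g y| <= C * `|x - y|) ->
  closed [set x | f x = g x].
Proof.
move=> C0 fC gC; apply/closed_approxP => x xD /=.
apply/eqP; rewrite -subr_eq0; apply/eqP/small_eq0 => e e0.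
have [y /= fgy xy] := xD (e / (C + C)) (divr_gt0 e0 (addr_gt0 C0 C0)).
rewrite -(subrKA (f y)) {2}fgy; apply: le_lt_trans (ler_normD _ _) _.
apply: le_lt_trans (lerD (fC _ _) (gC _ _)) _.
by rewrite (distrC y) -mulrDl mulrC -ltr_pdivlMr// addr_gt0.
Qed.

Lemma exp2V_lt (R : realType) (e : R[i]) :
  0 < e -> exists N, forall n, (N <= n)%N -> (2%:R ^- n : R[i]) < e.
Proof.
(* In the order of [R[i]], a positive element is real. *)
move=> e0; have er : (complex.Re e)%:C%C = e by rewrite RRe_real// realE ltW.
have re0 : 0 < complex.Re e by rewrite -ltcR er.
exists (Num.trunc (complex.Re e)^-1).+1 => n Nn.
have -> : (2%:R ^- n : R[i]) = (2%:R ^- n)%:C%C.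
  by rewrite fmorphV/= rmorphXn/= rmorph_nat.
rewrite -er ltcR -ltf_pV2 ?posrE ?invr_gt0 ?exprn_gt0// invrK.
have := Num.Theory.truncnS_gt (complex.Re e)^-1; move/lt_le_trans; apply.
rewrite -natrX ler_nat; apply: leq_trans Nn _; apply: ltnW; exact: ltn_expl.
Qed.

Section CStarBasics.
Variables (R : realType) (A : cstarAlgType R).
Implicit Types x y a b c w : A.

Lemma norm_star x : `|star x| = `|x|.
Proof.
suff H y : `|y| <= `|star y| by apply/eqP; rewrite eq_le -{2}(starK x) !H.
have [->|y0] := eqVneq y 0; first by rewrite normr0.
by rewrite -(ler_pM2r (_ : 0 < `|y|)) ?normr_gt0// -expr2 -norm_starM normM_le.
Qed.

Lemma star0 : star (0 : A) = 0.
Proof. by apply: (addrI (star (0 : A))); rewrite -starD !addr0. Qed.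

Lemma starN x : star (- x) = - star x.
Proof. by apply: (addrI (star x)); rewrite -starD !subrr star0. Qed.

Lemma starB x y : star (x - y) = star x - star y.
Proof. by rewrite starD starN. Qed.

Lemma norm_cstar1 : `|1 : A| = 1.
Proof.
have n0 : `|1 : A| != 0 by rewrite normr_eq0 oner_neq0.
by apply: (mulIf n0); rewrite mul1r -expr2 -norm_starM star1 mulr1.
Qed.

Lemma norm_unitary w : unitary w -> `|w| = 1.
Proof.
by move=> [_ w1]; apply/eqP; rewrite -sqrp_eq1// -norm_starM w1 norm_cstar1.
Qed.

Section SquareRoot.
Variable b : A.
Hypotheses (sb : star b = b) (nb : `|b| <= 2^-1).

(** If l is the fixed point of T then (1 - l)^2 = 1 - b^2. *)
Let T y : A := 2^-1 *: (b * b + y * y).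
Let s n := iter n T 0.

Let half_ge0 : (0 : R[i]) <= 2^-1. Proof. by rewrite invr_ge0. Qed.

Let s_norm n : `|s n| <= 2^-1.
Proof.
elim: n => [|n IH] /=; first by rewrite normr0.
rewrite normrZ ger0_norm// ger_pMr ?invr_gt0//.
apply: le_trans (ler_normD _ _) _; rewrite (splitr 1) mul1r.
apply: lerD; apply: le_trans (normM_le _ _) _; rewrite -[leRHS]mulr1;
  apply: ler_pM => //.
  by apply: le_trans nb _; rewrite invf_le1// ler1n.
by apply: le_trans IH _; rewrite invf_le1// ler1n.
Qed.

(** The identity x x - y y = x (x - y) + (x - y) y holds without commutativity; on the ball of
    radius 1/2 it makes [T] a contraction of ratio 1/2. *)
Let T_lip x y : `|x| <= 2^-1 -> `|y| <= 2^-1 -> `|T x - T y| <= 2^-1 * `|x - y|.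
Proof.
move=> x2 y2; rewrite /T -scalerBr normrZ ger0_norm//.
apply: ler_wpM2l => //.
have -> : b * b + x * x - (b * b + y * y) = x * (x - y) + (x - y) * y.
  rewrite mulrBr mulrBl opprD addrACA subrr add0r.
  by rewrite addrA subrK.
apply: le_trans (ler_normD _ _) _; rewrite [leRHS](splitr `|x - y|).
apply: lerD; apply: le_trans (normM_le _ _) _.
  by rewrite [leRHS]mulrC; apply: ler_pM.
by apply: ler_pM.
Qed.

Let s_step n : `|s n.+1 - s n| <= 2 ^- n.
Proof.
elim: n => [|n IH].
  rewrite expr0 invr1 /s subr0; apply: le_trans (s_norm 1) _.
  by rewrite invf_le1// ler1n.
apply: le_trans (@T_lip (s n.+1) (s n) (s_norm _) (s_norm _)) _.
by rewrite exprS invfM; apply: ler_pM.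
Qed.

(** The bound is the exact sum of the geometric series of step bounds, which lets the induction on k
    close. *)
Let s_cauchy n k : `|s (n + k)%N - s n| <= 2 * 2 ^- n - 2 * 2 ^- (n + k).
Proof.
elim: k => [|k IH]; first by rewrite addn0 !subrr normr0.
rewrite addnS -(subrKA (s (n + k)%N)).
apply: le_trans (ler_normD _ _) _; apply: le_trans (lerD (s_step _) IH) _.
rewrite addrC -addrA lerD2l exprS invfM mulrA divff// mul1r.
by rewrite mulr2n mulrDl mul1r opprD -addrA addNr addr0.
Qed.

(** Self-adjointness and commutation with b hold for every iterate, because [T] preserves them, and
    they are closed conditions, so they pass to the limit l; the root is c = 1 - l. *)
Lemma square_root :
  exists c, [/\ star c = c, b * c = c * b & c * c = 1 - b * b].
Proof.
have [e e0|l sl] := @cauchy_seq_cvg _ A s.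
  have [N HN] : exists N, forall n, (N <= n)%N -> (2%:R ^- n : R[i]) < e / 4.
    by apply: exp2V_lt; rewrite divr_gt0.
  have H n : (N <= n)%N -> `|s n - s N| < e / 2.
    move=> Nn; rewrite -(subnKC Nn); apply: le_lt_trans (s_cauchy _ _) _.
    have -> : e / 2 = 2 * (e / 4) by field.
    apply: le_lt_trans (_ : 2 * 2 ^- N < _); last by rewrite ltr_pM2l// HN.
    by rewrite gerBl mulr_ge0// invr_ge0 exprn_ge0.
  exists N => m n Nm Nn; rewrite -(subrKA (s N)) (splitr e).
  by apply: le_lt_trans (ler_normD _ _) _; rewrite (distrC _ (s n)) ltrD ?H.
have l_in (D : set A) : closed D -> (forall n, D (s n)) -> D l.
  move=> /closed_approxP cD Ds; apply: cD => e e0.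
  have [N HN] := sl e e0; exists (s N) => //.
  by rewrite distrC; exact: HN.
have lf : l = T l.
  have l2 : `|l| <= 2^-1.
    apply: (l_in [set y | `|y| <= 2^-1]); last exact: s_norm.
    apply/closed_approxP => y yD /=.
    rewrite real_leNgt ?realE ?normr_ge0 ?half_ge0//; apply/negP => y0.
    have /yD[z /= z2 yz] : 0 < `|y| - 2^-1 by rewrite subr_gt0.
    have := le_lt_trans (lerB_dist _ _) yz.
    by rewrite ltrD2l ltrN2 => /lt_le_trans/(_ z2); rewrite ltxx.
  apply/eqP; rewrite -subr_eq0; apply/eqP/small_eq0 => e e0.
  have [N HN] := sl (e / 2) (divr_gt0 e0 (ltr0n _ 2)).
  rewrite -(subrKA (s N.+1)) (splitr e).
  apply: le_lt_trans (ler_normD _ _) _; apply: ltrD.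
    by rewrite distrC; apply: HN.
  apply: le_lt_trans (@T_lip (s N) l (s_norm _) l2) _.
  apply: le_lt_trans (HN N (leqnn _)).
  by rewrite ler_piMl ?invf_le1 ?ler1n.
exists (1 - l); split.
- rewrite starB star1; congr (_ - _).
  apply: (l_in [set y | star y = y]).
    apply: (@closed_equalizer _ _ _ _ _ 1) => // x y; rewrite mul1r//.
    by rewrite -starB norm_star.
  elim=> [|n IH]; first exact: star0.
  rewrite /= /T starZ starD !starM sb IH; congr (_ *: _).
  by apply/CrealP; rewrite realE half_ge0.
- rewrite mulrBr mulrBl mulr1 mul1r; congr (_ - _).
  apply: (l_in [set y | b * y = y * b]).
    apply: (@closed_equalizer _ _ _ _ _ 1) => // x y; rewrite mul1r//.
      rewrite -mulrBr; apply: le_trans (normM_le _ _) _.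
      rewrite ler_piMl//; apply: le_trans nb _; rewrite invf_le1// ler1n//.
    rewrite -mulrBl; apply: le_trans (normM_le _ _) _.
    rewrite ler_piMr//; apply: le_trans nb _; rewrite invf_le1// ler1n//.
  elim=> [|n IH]; first by rewrite /s /= mulr0 mul0r.
  rewrite /= /T -scalerAr -scalerAl mulrDr mulrDl !mulrA.
  rewrite /= in IH; congr (_ *: (_ + _)).
  by rewrite IH -[in LHS]mulrA IH mulrA.
have : 2 *: l = b * b + l * l by rewrite {1}lf scalerA divff ?scale1r.
rewrite mulrBr mulr1 mulrBl mul1r scaler_nat mulr2n => H.
have -> : b * b = l + l - l * l by rewrite H addrK.
by rewrite !opprB opprD -!addrA; congr (_ + _); rewrite addrCA.
Qed.
End SquareRoot.
End CStarBasics.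

Section Bounded.
Variables (R : realType) (A : cstarAlgType R).

(** b is the real part of the unitary b + i (1 - b^2)^(1/2). *)
Lemma half_unitary (b : A) : star b = b -> `|b| <= 2^-1 ->
  exists2 w : A, unitary w & b = 2^-1 *: (w + star w).
Proof.
move=> sb nb; have [c [sc bc c2]] := square_root sb nb.
have sw : star (b + 'i *: c) = b - 'i *: c.
  by rewrite starD starZ sb sc conjCi scaleNr.
exists (b + 'i *: c); last first.
  rewrite sw addrACA subrr addr0 -mulr2n -[b *+ 2]scaler_nat.
  by rewrite scalerA mulVf ?scale1r// pnatr_eq0.
have ww : b * b + c * c = 1 by rewrite c2 addrC subrK.
have ii : ('i *: c) * ('i *: c) = - (c * c).
  by rewrite -scalerAl -scalerAr scalerA -expr2 sqrCi scaleN1r.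
have bi : b * ('i *: c) = ('i *: c) * b by rewrite -scalerAr -scalerAl bc.
by split; rewrite sw; [rewrite mulrDl !mulrBr|rewrite mulrBl !mulrDr];
  rewrite ii bi ?opprD opprK; [rewrite addrA subrK|rewrite addrA addrK].
Qed.

(** By homogeneity it is enough to look at b / (2 |b|), which has norm 1/2. The function [g] is the
    norm of f(b) for a homomorphism f, and |rho(b) x| / |x| for a representation. *)
Lemma le_double_normalized (g : A -> R[i]) (b : A) :
  (forall (c : R[i]) x, g (c *: x) = `|c| * g x) -> star b = b ->
  (forall d : A, star d = d -> `|d| <= 2^-1 -> g d <= 1) -> g b <= 2 * `|b|.
Proof.
move=> gZ sb H; have [->|b0] := eqVneq b 0.
  by rewrite -(scale0r 0) gZ !normr0 mul0r scale0r normr0 mulr0.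
have nb0 : 0 < `|b| by rewrite normr_gt0.
have r0 : 0 <= (2 * `|b|)^-1 by rewrite invr_ge0 mulr_ge0.
rewrite -[leRHS]mulr1 -ler_pdivrMl ?mulr_gt0//.
rewrite -{1}(ger0_norm r0) -gZ; apply: H.
  by rewrite starZ sb conj_Creal// realE r0.
by rewrite normrZ (ger0_norm r0) invfM -mulrA mulVf ?mulr1// gt_eqF.
Qed.

(** The optimal constant is 1; a bound on the elements of norm at most 1/2
    gives 2, which is enough for continuity. *)
Lemma star_morphism_bounded (B : cstarAlgType R) (f : A -> B) :
  star_morphism f -> forall a, `|f a| <= 2 * `|a|.
Proof.
move=> [fl f1 fM fs] a.
have fZ c x : f (c *: x) = c *: f x.
  have f0 : f 0 = 0 by have := fl (-1) 0 0; rewrite !scaleN1r !addNr.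
  by rewrite -[c *: x]addr0 fl f0 addr0.
have H b : star b = b -> `|f b| <= 2 * `|b|.
  move=> sb; apply: (@le_double_normalized (fun b => `|f b|)) => //.
    by move=> c x; rewrite fZ normrZ.
  move=> d sd nd; have [w [w1 w2] ->] := half_unitary sd nd.
  have uw : unitary (f w) by split; rewrite -fs -fM ?w1 ?w2 f1.
  have fD x y : f (x + y) = f x + f y by rewrite -{1}(scale1r x) fl scale1r.
  rewrite fZ fD normrZ ger0_norm ?invr_ge0// ler_pdivrMl// mulr1.
  by apply: le_trans (ler_normD _ _) _; rewrite fs norm_star norm_unitary.
(* The C*-identity reduces a general a to the self-adjoint [star a * a]: |f a|^2 <= 2 |a|^2 <= (2
   |a|)^2. *)
have := H (star a * a); rewrite starM starK => /(_ erefl).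
rewrite fM fs !norm_starM => H2.
have a2 : 0 <= 2 * `|a| by rewrite mulr_ge0.
rewrite -(@ler_pXn2r _ 2)// ?nnegrE// exprMn.
by apply: le_trans H2 _; rewrite ler_wpM2r ?exprn_ge0// expr2 ler_pMl// ler1n.
Qed.

(** * Hilbert space estimates *)

Section InnerProduct.
Variables (H : completeNormedModType R[i]) (ip : H -> H -> R[i]).
Hypothesis hip : is_inner_product ip.
Implicit Types x y z : H.

Lemma ipC x y : ip y x = (ip x y)^*. Proof. by case: hip. Qed.
Lemma ipxx x : ip x x = `|x| ^+ 2. Proof. by case: hip. Qed.
Lemma ipDl x y z : ip (x + y) z = ip x z + ip y z.
Proof. by case: hip => ipl _ _; rewrite -{1}(scale1r x) ipl mul1r. Qed.
Lemma ip0l z : ip 0 z = 0.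
Proof. by apply: (addrI (ip 0 z)); rewrite -ipDl !addr0. Qed.
Lemma ipZl c x z : ip (c *: x) z = c * ip x z.
Proof. by case: hip => ipl _ _; rewrite -[c *: x]addr0 ipl ip0l addr0. Qed.
Lemma ipNl x z : ip (- x) z = - ip x z.
Proof. by rewrite -scaleN1r ipZl mulN1r. Qed.
Lemma ipBl x y z : ip (x - y) z = ip x z - ip y z.
Proof. by rewrite ipDl ipNl. Qed.
Lemma ipDr x y z : ip z (x + y) = ip z x + ip z y.
Proof. by rewrite ipC ipDl rmorphD /= -!ipC. Qed.
Lemma ip0r z : ip z 0 = 0. Proof. by rewrite ipC ip0l rmorph0. Qed.
Lemma ipZr c x z : ip z (c *: x) = c^* * ip z x.
Proof. by rewrite ipC ipZl rmorphM /= -ipC. Qed.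
Lemma ipBr x y z : ip z (x - y) = ip z x - ip z y.
Proof. by rewrite ipC ipBl rmorphB /= -!ipC. Qed.
Lemma ip_suml (I : Type) (r : seq I) (F : I -> H) z :
  ip (\sum_(i <- r) F i) z = \sum_(i <- r) ip (F i) z.
Proof. by apply: (big_morph (fun x => ip x z)) => [x y|]; rewrite ?ipDl ?ip0l.
  Qed.
Lemma ip_sumr (I : Type) (r : seq I) (F : I -> H) z :
  ip z (\sum_(i <- r) F i) = \sum_(i <- r) ip z (F i).
Proof. by apply: (big_morph (ip z)) => [x y|]; rewrite ?ipDr ?ip0r. Qed.

Lemma cauchy_schwarz x y : `|ip x y| <= `|x| * `|y|.
Proof.
have [->|y0] := eqVneq y 0; first by rewrite ip0r !normr0 mulr0.
have ny0 : `|y| != 0 by rewrite normr_eq0.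
pose p := ip x y; pose c := p / `|y| ^+ 2.
have cc : c^* = p^* / `|y| ^+ 2.
  by rewrite rmorphM /= fmorphV /= [X in _ / X]conj_Creal ?ger0_real ?exprn_ge0.
have : 0 <= `|x - c *: y| ^+ 2 by rewrite exprn_ge0.
rewrite -ipxx ipBl !ipBr !ipZl !ipZr !ipxx (ipC x y) -/p.
have -> : `|x| ^+ 2 - c^* * p - (c * p^* - c * (c^* * `|y| ^+ 2)) =
    `|x| ^+ 2 - `|p| ^+ 2 / `|y| ^+ 2.
  by rewrite cc /c normCK; field.
rewrite subr_ge0 ler_pdivrMr ?exprn_gt0 ?normr_gt0// -exprMn.
by rewrite ler_pXn2r ?nnegrE ?mulr_ge0.
Qed.

(** The operators [rho a] are bare linear maps without an operator norm, so the argument of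
    [star_morphism_bounded] is repeated at each fixed vector x, with the inner product in place of
    the C*-identity. *)
Lemma representation_bounded (rho : A -> {linear H -> H}) :
  is_representation ip rho -> forall a x, `|rho a x| <= 2 * `|a| * `|x|.
Proof.
move=> [_ rl r1 rM rs] a x.
have rZ c b : rho (c *: b) x = c *: rho b x.
  have r0 : rho 0 x = 0.
    by have := rl (-1) 0 0 x; rewrite !scaleN1r !addNr.
  by rewrite -[c *: b]addr0 rl r0 addr0.
have K b : star b = b -> `|rho b x| <= 2 * `|b| * `|x|.
  move=> sb; have [->|x0] := eqVneq x 0; first by rewrite linear0 !normr0 mulr0.
  have nx : 0 < `|x| by rewrite normr_gt0.
  rewrite -ler_pdivrMr//.
  apply: (@le_double_normalized (fun b => `|rho b x| / `|x|)) => //.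
    by move=> c d; rewrite rZ normrZ mulrA.
  move=> d sd nd; rewrite ler_pdivrMr// mul1r.
  have [w [w1 w2] ->] := half_unitary sd nd.
  have uw v : star v * v = 1 -> `|rho v x| = `|x|.
    move=> vv; apply/eqP; rewrite -(@eqrXn2 _ 2)//.
    by rewrite -!ipxx rs -rM vv r1.
  rewrite rZ -[w]scale1r rl !scale1r normrZ ger0_norm ?invr_ge0// ler_pdivrMl//.
  apply: le_trans (ler_normD _ _) _; rewrite !uw ?starK//.
  by rewrite mulr_natl mulr2n.
have := K (star a * a); rewrite starM starK norm_starM => /(_ erefl) H2.
rewrite -(@ler_pXn2r _ 2)// ?nnegrE ?mulr_ge0//.
have -> : `|rho a x| ^+ 2 = `|ip (rho (star a * a) x) x|.
  by rewrite rM rs starK ipxx ger0_norm// exprn_ge0.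
apply: le_trans (cauchy_schwarz _ _) _.
apply: le_trans (ler_wpM2r _ H2) _ => //.
rewrite -[leLHS]mulrA -expr2 !exprMn; rewrite !ler_wpM2r ?exprn_ge0//.
by rewrite expr2 ler_pMl// ler1n.
Qed.

End InnerProduct.
End Bounded.

(** * Subalgebras and density of monomials *)

(** A unital C*-subalgebra as a C*-algebra of its own, so that it can be the target of the universal
    property in [Q2_generated]. *)
Record subalg (R : realType) (A : cstarAlgType R) (D : set A)
    (hD : cstar_subalgebra D) (D1 : D 1) :=
  Subalg { subalg_val : A; subalg_valP : D subalg_val }.

Section Subalgebra.
Variables (R : realType) (A : cstarAlgType R) (D : set A).
Hypotheses (hD : cstar_subalgebra D) (D1 : D 1).
Local Notation T := (subalg hD D1).
Local Notation val := (@subalg_val _ _ _ hD D1).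

HB.instance Definition _ := gen_eqMixin T.
HB.instance Definition _ := gen_choiceMixin T.

Lemma subalg_val_inj : injective val.
Proof.
by move=> [x Hx] [y Hy] /= xy; subst y; congr Subalg; exact: Prop_irrelevance.
Qed.

Lemma subalgebra0 : D 0. Proof. by case: hD => _ []. Qed.
Lemma subalgebraD x y : D x -> D y -> D (x + y).
Proof. by case: hD => _ [_ Dl] _ _ Dx Dy; rewrite -(scale1r x); exact: Dl. Qed.
Lemma subalgebraZ c x : D x -> D (c *: x).
Proof.
by case: hD => _ [D0 Dl] _ _ Dx; rewrite -[c *: x]addr0; exact: Dl.
Qed.
Lemma subalgebraN x : D x -> D (- x).
Proof. by rewrite -scaleN1r; exact: subalgebraZ. Qed.
Lemma subalgebraM x y : D x -> D y -> D (x * y).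
Proof. by case: hD => _ _ DM _; exact: DM. Qed.
Lemma subalgebraS x : D x -> D (star x).
Proof. by case: hD => _ _ _; exact. Qed.

Definition subalg_zero : T := Subalg hD D1 subalgebra0.
Definition subalg_one : T := Subalg hD D1 D1.
Definition subalg_add (x y : T) : T :=
  Subalg hD D1 (subalgebraD (subalg_valP x) (subalg_valP y)).
Definition subalg_opp (x : T) : T := Subalg hD D1 (subalgebraN (subalg_valP x)).
Definition subalg_scale c (x : T) : T :=
  Subalg hD D1 (subalgebraZ c (subalg_valP x)).
Definition subalg_mul (x y : T) : T :=
  Subalg hD D1 (subalgebraM (subalg_valP x) (subalg_valP y)).
Definition subalg_star (x : T) : T := Subalg hD D1 (subalgebraS (subalg_valP x)).

Fact subalg_addA : associative subalg_add.
Proof. by move=> x y z; apply: subalg_val_inj; exact: addrA. Qed.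
Fact subalg_addC : commutative subalg_add.
Proof. by move=> x y; apply: subalg_val_inj; exact: addrC. Qed.
Fact subalg_add0 : left_id subalg_zero subalg_add.
Proof. by move=> x; apply: subalg_val_inj; exact: add0r. Qed.
Fact subalg_addN : left_inverse subalg_zero subalg_opp subalg_add.
Proof. by move=> x; apply: subalg_val_inj; exact: addNr. Qed.

HB.instance Definition _ := GRing.isZmodule.Build T
  subalg_addA subalg_addC subalg_add0 subalg_addN.

Fact subalg_scaleA c d (x : T) :
  subalg_scale c (subalg_scale d x) = subalg_scale (c * d) x.
Proof. by apply: subalg_val_inj; exact: scalerA. Qed.
Fact subalg_scale1 : left_id 1 subalg_scale.
Proof. by move=> x; apply: subalg_val_inj; exact: scale1r. Qed.
Fact subalg_scaleDr : right_distributive subalg_scale +%R.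
Proof. by move=> c x y; apply: subalg_val_inj; exact: scalerDr. Qed.
Fact subalg_scaleDl x : {morph subalg_scale^~ x : c d / c + d}.
Proof. by move=> c d; apply: subalg_val_inj; exact: scalerDl. Qed.

HB.instance Definition _ := GRing.Zmodule_isLmodule.Build R[i] T
  subalg_scaleA subalg_scale1 subalg_scaleDr subalg_scaleDl.

Definition subalg_norm (x : T) : R[i] := `|val x|.

Fact subalg_normD (x y : T) : subalg_norm (x + y) <= subalg_norm x +
  subalg_norm y.
Proof. exact: ler_normD. Qed.
Fact subalg_normZ (c : R[i]) (x : T) : subalg_norm (c *: x) = `|c| *
  subalg_norm x.
Proof. exact: normrZ. Qed.
Fact subalg_norm_eq0 (x : T) : subalg_norm x = 0 -> x = 0.
Proof. by move=> x0; apply: subalg_val_inj; exact: normr0_eq0. Qed.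

HB.instance Definition _ := Lmodule_isNormed.Build R[i] T
  subalg_normD subalg_normZ subalg_norm_eq0.

Lemma subalg_complete (F : set_system T) : ProperFilter F -> cauchy F -> cvg F.
Proof.
move=> FF /cauchyP FC.
have cF : cauchy (val @ F).
  apply/cauchyP => e e0; have [x Fx] := FC e e0.
  exists (val x); rewrite /= /nbhs /=.
  by apply: filterS Fx => y; rewrite -!ball_normE.
have /cvg_ex[l Fl] : cvg (val @ F) by apply: cauchy_cvg.
have Dl : D l.
  case: hD => /closed_approxP cD _ _ _; apply: cD => e e0.
  have /filter_ex[y] : F (val @^-1` ball l e).
    exact: Fl (nbhsx_ballx l e e0).
  by rewrite /= -ball_normE => ly; exists (val y) => //; exact: subalg_valP.
apply/cvg_ex; exists (Subalg hD D1 Dl); apply/fcvg_ballP => e e0.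
have := Fl _ (nbhsx_ballx l e e0); rewrite /= /nbhs /=.
by apply: filterS => y; rewrite /= -!ball_normE.
Qed.

HB.instance Definition _ := Uniform_isComplete.Build T subalg_complete.

Definition subalg_base : completeNormedModType R[i] := T.

Definition subalg_cstar : cstarAlgType R.
Proof.
apply: (@CStarAlg R subalg_base subalg_one subalg_mul subalg_star).
- by move=> x y z; apply: subalg_val_inj; exact: mulrA.
- by move=> x; apply: subalg_val_inj; exact: mul1r.
- by move=> x; apply: subalg_val_inj; exact: mulr1.
- by move=> x y z; apply: subalg_val_inj; exact: mulrDl.
- by move=> x y z; apply: subalg_val_inj; exact: mulrDr.
- by apply/eqP => /(congr1 val) /eqP; rewrite /= oner_eq0.
- by move=> c x y; apply: subalg_val_inj; exact: scalerAl.
- by move=> c x y; apply: subalg_val_inj; exact: scalerAr.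
- by move=> x; apply: subalg_val_inj; exact: starK.
- by move=> x y; apply: subalg_val_inj; exact: starD.
- by move=> c x; apply: subalg_val_inj; exact: starZ.
- by move=> x y; apply: subalg_val_inj; exact: starM.
- by move=> x y; exact: normM_le.
- by move=> x; exact: norm_starM.
Defined.

End Subalgebra.

Section Generated.
Variables (R : realType) (A : cstarAlgType R).
Implicit Types (S D : set A) (x y a b : A).

Lemma cstar_gen_subalgebra S : cstar_subalgebra (cstar_gen S).
Proof.
split.
- by apply: closed_bigI => D [[]].
- split=> [D [[_ [D0 _] _ _] _]//|c x y Sx Sy D [hD SD]].
  by case: (hD) => _ [_ Dl] _ _; apply: Dl; [exact: Sx|exact: Sy].
- move=> x y Sx Sy D [hD SD].
  by case: (hD) => _ _ DM _; apply: DM; [exact: Sx|exact: Sy].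
- move=> x Sx D [hD SD].
  by case: (hD) => _ _ _ DS; apply: DS; exact: Sx.
Qed.

Lemma cstar_gen_sub S : S `<=` cstar_gen S.
Proof. exact: sub_smallest. Qed.

Lemma cstar_gen_min S D : cstar_subalgebra D -> S `<=` D -> cstar_gen S `<=` D.
Proof. by move=> hD SD; apply: smallest_sub. Qed.

Definition closed_subspace D :=
  closed D /\ (D 0 /\ forall (c : R[i]) x y, D x -> D y -> D (c *: x + y)).

(** With this definition [cspan_min] is an induction principle: a property stable under linear
    combinations and limits need only be checked on S. The density arguments below take this
    form. *)
Definition cspan S : set A := smallest closed_subspace S.

Lemma cspan_subspace S : closed_subspace (cspan S).
Proof.
split; first by apply: closed_bigI => D [[]].
split=> [D [[_ [D0 _]] _]//|c x y Sx Sy D [hD SD]].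
by case: (hD) => _ [_ Dl]; apply: Dl; [exact: Sx|exact: Sy].
Qed.

Lemma cspan_min S D : closed_subspace D -> S `<=` D -> cspan S `<=` D.
Proof. by move=> hD SD; apply: smallest_sub. Qed.

Lemma cspan_sub S : S `<=` cspan S.
Proof. exact: sub_smallest. Qed.

(** The scalar d is left free in order to cover the conjugate-linear map [star], for which d is the
    conjugate of c, together with the multiplications. *)
Lemma closed_subspace_preimage (f : A -> A) (C : R[i]) (D : set A) : 0 < C ->
  (forall x y, `|f x - f y| <= C * `|x - y|) ->
  (forall (c : R[i]) x y, exists d : R[i], f (c *: x + y) = d *: f x + f y) ->
  f 0 = 0 -> closed_subspace D -> closed_subspace (f @^-1` D).
Proof.
move=> C0 fC fl f0 [cD [D0 Dl]]; split; first exact: closed_preimage fC cD.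
split=> [|c x y Dx Dy] /=; first by rewrite f0.
by have [d ->] := fl c x y; exact: Dl.
Qed.

Lemma lipschitz_mull a : exists2 C : R[i], 0 < C &
  forall x y, `|a * x - a * y| <= C * `|x - y|.
Proof.
exists (1 + `|a|); first by rewrite ltr_pwDl.
move=> x y; rewrite -mulrBr; apply: le_trans (normM_le _ _) _.
by rewrite ler_wpM2r// lerDr.
Qed.

Lemma lipschitz_mulr a : exists2 C : R[i], 0 < C &
  forall x y, `|x * a - y * a| <= C * `|x - y|.
Proof.
exists (1 + `|a|); first by rewrite ltr_pwDl.
move=> x y; rewrite -mulrBl; apply: le_trans (normM_le _ _) _.
by rewrite mulrC ler_wpM2r// lerDr.
Qed.

(** Stability under products is extended from S to its closed span one factor at a time, as
    multiplication by a fixed element is linear and Lipschitz. *)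
Lemma cspan_subalgebra S :
  (forall x y, S x -> S y -> S (x * y)) -> (forall x, S x -> S (star x)) ->
  cstar_subalgebra (cspan S).
Proof.
move=> SM Ss; have [cl sub] := cspan_subspace S; split=> //.
  have H x : S x -> forall y, cspan S y -> cspan S (x * y).
    move=> Sx; have [C C0 fC] := lipschitz_mull x.
    apply: cspan_min (_ : closed_subspace ( *%R x @^-1` cspan S)) _.
      apply: closed_subspace_preimage C0 fC _ (mulr0 _) (cspan_subspace S).
      by move=> c y z; exists c; rewrite mulrDr scalerAr.
    by move=> y Sy; apply: cspan_sub; exact: SM.
  move=> x y Sx Sy; move: x Sx; have [C C0 fC] := lipschitz_mulr y.
  apply: cspan_min (_ : closed_subspace (( *%R^~ y) @^-1` cspan S)) _.
    apply: closed_subspace_preimage C0 fC _ (mul0r _) (cspan_subspace S).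
    by move=> c x z; exists c; rewrite mulrDl scalerAl.
  by move=> x Sx; exact: H.
apply: cspan_min (_ : closed_subspace (@star R A @^-1` cspan S)) _.
  apply: (@closed_subspace_preimage _ 1) => //.
  - by move=> x y; rewrite -starB norm_star mul1r.
  - by move=> c x y; exists c^*; rewrite starD starZ.
  - exact: star0.
by move=> x Sx; apply: cspan_sub; exact: Ss.
Qed.

Inductive words (G : set A) : A -> Prop :=
  | words1 : words G 1
  | wordsM g x : G g -> words G x -> words G (g * x).

Lemma words_mul G x y : words G x -> words G y -> words G (x * y).
Proof.
move=> Gx Gy; elim: Gx => [|g z Gg _ IH]; first by rewrite mul1r.
by rewrite -mulrA; apply: wordsM.
Qed.

Lemma words_star G x : (forall g, G g -> G (star g)) ->
  words G x -> words G (star x).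
Proof.
move=> Gs; elim=> [|g z Gg _ IH]; first by rewrite star1; exact: words1.
rewrite starM; apply: words_mul => //; rewrite -[star g]mulr1.
by apply: wordsM; [exact: Gs|exact: words1].
Qed.

Lemma cstar_gen_words S :
  cstar_gen S `<=` cspan (words (S `|` [set star x | x in S])).
Proof.
apply: cstar_gen_min.
  apply: cspan_subalgebra => [x y|x]; first exact: words_mul.
  apply: words_star => g [Sg|[h Sh <-]]; first by right; exists g.
  by left; rewrite starK.
move=> x Sx; apply: cspan_sub; rewrite -[x]mulr1.
by apply: wordsM; [left|exact: words1].
Qed.

(** The universal property maps A to its subalgebra D generated by u and s2;
    by uniqueness the composite A -> D -> A is the identity. *)
Lemma Q2_generated (u s2 : A) : is_Q2 u s2 -> cstar_gen [set u; s2] = setT.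
Proof.
move=> [rel univ]; set D := cstar_gen _.
have hD : cstar_subalgebra D by exact: cstar_gen_subalgebra.
have Du : D u by apply: cstar_gen_sub; left.
have Ds : D s2 by apply: cstar_gen_sub; right.
have [[uu1 uu2] ss su sum] := rel.
have D1 : D 1 by rewrite -uu2; exact: (subalgebraM hD (subalgebraS hD Du) Du).
pose B := subalg_cstar hD D1.
pose v : B := Subalg hD D1 Du; pose t : B := Subalg hD D1 Ds.
have relB : Q2_relations v t.
  have inj (x y : B) : subalg_val x = subalg_val y -> x = y.
    exact: subalg_val_inj.
  split; first by split; apply: inj; [exact: uu1|exact: uu2].
  - by apply: inj; exact: ss.
  - by apply: inj; exact: su.
  - by apply: inj; exact: sum.
have [f [[[fl f1 fM fs] fu ft] _]] := univ B v t relB.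
have [g [_ gU]] := univ A u s2 rel.
apply/seteqP; split=> // x _.
have -> : x = subalg_val (f x).
  rewrite -[LHS]/(id x) -[RHS]/(((@subalg_val _ _ _ hD D1) \o f) x).
  congr (_ x); rewrite -(gU id); last by split.
  apply: gU; split; last by rewrite /= ft.
    split=> [c y z||y z|y] /=.
    - by rewrite fl.
    - by rewrite f1.
    - by rewrite fM.
    - by rewrite fs.
  by rewrite /= fu.
exact: subalg_valP.
Qed.

End Generated.

Lemma int_parity (k : int) : exists l, k = 2 * l \/ k = 2 * l + 1.
Proof.
exists (k %/ 2)%Z; have := divz_eq k 2; have := modz_ge0 k (isT : 2 != 0 :> int).
have := ltz_mod k (isT : 2 != 0 :> int); lia.
Qed.

(** * Normal form of words in u and s_2 *)

Section UnitaryPowers.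
Variables (R : realType) (A : cstarAlgType R) (u : A).
Hypothesis uu : unitary u.

(** Integer powers of a unitary, with [star u] as the inverse; [Negz n] stands for -(n + 1). *)
Definition upow (i : int) : A :=
  match i with Posz n => u ^+ n | Negz n => star u ^+ n.+1 end.

Lemma upow0 : upow 0 = 1. Proof. exact: expr0. Qed.
Lemma upow1 : upow 1 = u. Proof. exact: expr1. Qed.
Lemma upowN1 : upow (-1) = star u. Proof. exact: expr1. Qed.

Lemma upowS i : upow (1 + i) = u * upow i.
Proof.
case: i => [n|[|n]]; first by rewrite -PoszD /= exprS.
  have -> : 1 + Negz 0 = 0 by [].
  by rewrite /= expr0 expr1; case: uu => ->.
have -> : 1 + Negz n.+1 = Negz n by lia.
by rewrite /= (exprS _ n.+1) mulrA; case: uu => -> _; rewrite mul1r.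
Qed.

Lemma upowP i : upow (-1 + i) = star u * upow i.
Proof.
have {2}-> : i = 1 + (-1 + i) by lia.
by rewrite upowS mulrA; case: uu => _ ->; rewrite mul1r.
Qed.

Lemma upowD i j : upow (i + j) = upow i * upow j.
Proof.
elim/int_rect: i => [|n IH|n IH]; first by rewrite add0r upow0 mul1r.
  have -> : n.+1%:Z + j = 1 + (n%:Z + j) by lia.
  have -> : n.+1%:Z = 1 + n%:Z by lia.
  by rewrite !upowS IH mulrA.
have -> : - n.+1%:Z + j = -1 + (- n%:Z + j) by lia.
have -> : - n.+1%:Z = -1 + - n%:Z by lia.
by rewrite !upowP IH mulrA.
Qed.

Lemma upow_star i : star (upow i) = upow (- i).
Proof.
suff H (n : nat) : star (upow n) = upow (- n%:Z).
  case: i => n; first exact: H.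
  by rewrite NegzE opprK -H starK.
elim: n => [|n IH]; first by rewrite oppr0 upow0 star1.
have -> : - n.+1%:Z = - n%:Z + -1 by lia.
have -> : n.+1%:Z = 1 + n%:Z by lia.
by rewrite upowS starM upowD IH upowN1.
Qed.

Lemma upow_unitary i : unitary (upow i).
Proof. by split; rewrite upow_star -upowD ?subrr ?addNr upow0. Qed.

End UnitaryPowers.

Section Q2Algebra.
Variables (R : realType) (A : cstarAlgType R) (u s2 : A).
Hypothesis rel : Q2_relations u s2.
Local Notation up := (upow u).

Let uu : unitary u. Proof. by case: rel. Qed.
Let ss : star s2 * s2 = 1. Proof. by case: rel. Qed.
Let su : s2 * u = u * u * s2. Proof. by case: rel. Qed.
Let sum : s2 * star s2 + u * s2 * star s2 * star u = 1. Proof. by case: rel. Qed.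

Lemma s2_upow i : s2 * up i = up (2 * i) * s2.
Proof.
have su' : s2 * star u = star u * star u * s2.
  have [u1 u2] := uu.
  have -> : s2 * star u = star u * star u * (u * u * s2) * star u.
    by rewrite !mulrA -(mulrA (star u) (star u) u) u2 mulr1 u2 mul1r.
  by rewrite -su -!mulrA u1 mulr1.
elim/int_rect: i => [|n IH|n IH]; first by rewrite mulr0 upow0 mul1r mulr1.
  have -> : 2 * n.+1%:Z = 1 + (1 + 2 * n%:Z) by lia.
  have -> : n.+1%:Z = 1 + n%:Z by lia.
  by rewrite !upowS// !mulrA su -mulrA IH !mulrA.
have -> : 2 * - n.+1%:Z = -1 + (-1 + 2 * - n%:Z) by lia.
have -> : - n.+1%:Z = -1 + - n%:Z by lia.
by rewrite !upowP// !mulrA su' -mulrA IH !mulrA.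
Qed.

Lemma s2X_upow m i : s2 ^+ m * up i = up (2 ^+ m * i) * s2 ^+ m.
Proof.
elim: m => [|m IH]; first by rewrite !expr0 !mul1r mulr1.
by rewrite !exprS -mulrA IH mulrA s2_upow mulrA -!mulrA.
Qed.

Lemma upow_s2sX m i : up i * star s2 ^+ m = star s2 ^+ m * up (2 ^+ m * i).
Proof.
elim: m i => [|m IH] i; first by rewrite !expr0 mulr1 !mul1r.
have H : up i * star s2 = star s2 * up (2 * i).
  apply: (can_inj (@starK _ A)); rewrite !starM starK !upow_star// s2_upow.
  by rewrite mulrN.
rewrite [star s2 ^+ m.+1]exprS mulrA H -mulrA IH mulrA.
by rewrite [2 ^+ m * (2 * i)]mulrA -exprSr.
Qed.

(** The ranges of s_2 and u s_2 are orthogonal: multiplying the sum relation by [star s2] on the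
    left and by [u * s2] on the right gives x + x = x for the element x in question. *)
Lemma s2s_u_s2 : star s2 * u * s2 = 0.
Proof.
have /(congr1 (fun x => star s2 * x * (u * s2))) := sum.
rewrite mulrDr mulrDl !mulrA ss mul1r mulr1 -!mulrA.
have [_ u2] := uu; rewrite (mulrA (star u)) u2 mul1r ss mulr1.
by rewrite -[RHS]addr0 => /addrI.
Qed.

Definition monomial i m n j := up i * s2 ^+ m * star s2 ^+ n * up j.

(** A generator is multiplied on the left of a monomial. Powers of u absorb u and its adjoint, and
    s_2 passes u^i by doubling i. The adjoint of s_2 passes an even power and cancels a factor s_2,
    while an odd power gives 0 by [s2s_u_s2]; when m = 0 it is u^i that moves to the right
    instead. *)
Lemma words_monomial x :
  words ([set u; s2] `|` [set star y | y in [set u; s2]]) x ->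
  x = 0 \/ exists i m n j, x = monomial i m n j.
Proof.
elim=> [|g y Gg _ [->|[i [m [n [j ->]]]]]].
- by right; exists 0, 0%N, 0%N, 0; rewrite /monomial !expr0 upow0 !mulr1.
- by left; rewrite mulr0.
move: Gg => [[->|->]|[_ [->|->] <-]].
- right; exists (1 + i), m, n, j.
  by rewrite /monomial upowS// !mulrA.
- right; exists (2 * i), m.+1, n, j.
  by rewrite /monomial !mulrA s2_upow exprS !mulrA.
- right; exists (-1 + i), m, n, j.
  by rewrite /monomial upowP// !mulrA.
case: m => [|m].
  right; exists 0, 0%N, n.+1, (2 ^+ n * i + j).
  rewrite /monomial !expr0 upow0 !mulr1 mul1r upow_s2sX upowD// exprS.
  by rewrite !mulrA.
have [k [ik|ik]] := int_parity i.
  right; exists k, m, n, j.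
  by rewrite /monomial ik exprS !mulrA -(mulrA _ _ s2) -s2_upow !mulrA ss mul1r.
left; rewrite /monomial ik addrC upowD// upow1 exprS !mulrA.
rewrite -(mulrA _ _ s2) -s2_upow !mulrA.
by rewrite s2s_u_s2 !mul0r.
Qed.

Lemma Q2_dense : is_Q2 u s2 ->
  cspan [set x | exists i m n j, x = monomial i m n j] = setT.
Proof.
move=> /Q2_generated gen; apply/seteqP; split=> // x _.
have : cstar_gen [set u; s2] x by rewrite gen.
move/cstar_gen_words; apply: cspan_min; first exact: cspan_subspace.
move=> y /words_monomial[->|H]; last exact: cspan_sub.
by have [_ []] := cspan_subspace [set x | exists i m n j, x = monomial i m n j].
Qed.

(** On C*(u) = C(T) this endomorphism is composition with z |-> z^2. *)
Definition canonical_endo (x : A) : A := s2 * x * star s2 + u * s2 * x * star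
  s2 * star u.

Lemma canonical_endo_morphism : star_morphism canonical_endo.
Proof.
have zs : star s2 * star u * s2 = 0.
  by apply: (can_inj (@starK _ A)); rewrite !starM !starK mulrA s2s_u_s2 star0.
have [u1 u2] := uu.
rewrite /canonical_endo; split=> [c x y||x y|x].
- by rewrite !(mulrDr, mulrDl) -!(scalerAr, scalerAl) scalerDr [in LHS]addrACA.
- by rewrite !mulr1.
- rewrite mulrDl !mulrDr.
  have -> : s2 * x * star s2 * (u * s2 * y * star s2 * star u) = 0.
    rewrite !mulrA -(mulrA _ _ u) -(mulrA _ _ s2).
    by rewrite s2s_u_s2 mulr0 !mul0r.
  have -> : u * s2 * x * star s2 * star u * (s2 * y * star s2) = 0.
    rewrite !mulrA -(mulrA _ (star s2)) -(mulrA _ (_ * _) s2).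
    by rewrite zs mulr0 !mul0r.
  rewrite addr0 add0r !mulrA; congr (_ + _).
    by rewrite -(mulrA _ _ s2) ss mulr1.
  by rewrite -(mulrA _ _ u) u2 mulr1 -(mulrA _ _ s2) ss mulr1.
by rewrite starD !starM !starK !mulrA.
Qed.

(** For x the preimage of u under an automorphism phi, applying phi yields phi(s_2) u = X phi(s_2),
    the relation fed to [intertwiner_power]. *)
Lemma canonical_endo_s2 x : canonical_endo x * s2 = s2 * x.
Proof.
have zs : star s2 * star u * s2 = 0.
  by apply: (can_inj (@starK _ A)); rewrite !starM !starK mulrA s2s_u_s2 star0.
rewrite /canonical_endo mulrDl -!mulrA ss mulr1 (mulrA (star s2)) zs.
by rewrite !mulr0 addr0.
Qed.

Lemma canonical_endo_u : canonical_endo u = u * u.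
Proof.
rewrite /canonical_endo -[u * s2 * u]mulrA su !mulrA -!mulrA -!mulrDr !mulrA.
by rewrite sum mulr1.
Qed.

(** These are the prescribed images of u and s_2 under the flip-flop, which therefore exists by the
    universal property. *)
Lemma Q2_relations_flip : Q2_relations (star u) (u * s2).
Proof.
have [u1 u2] := uu; split.
- exact: unitary_star.
- by rewrite starM mulrA -(mulrA _ (star u)) u2 mulr1 ss.
- transitivity (up (-1) * s2).
    by rewrite -mulrA -(upowN1 u) s2_upow mulrA -{1}(upow1 u) -upowD.
  by rewrite expr2 mulrA -(mulrA _ _ u) u2 mulr1 upowN1.
- rewrite starK starM !mulrA u2 mul1r -(mulrA _ (star u)) u2 mulr1.
  by rewrite addrC -[in RHS]sum ?mulrA.
Qed.

End Q2Algebra.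

(** * The canonical representation *)

Section Canonical.
Variables (R : realType) (A : cstarAlgType R) (u s2 : A).
Hypothesis hQ2 : is_Q2 u s2.
Variables (H : completeNormedModType R[i]) (ip : H -> H -> R[i]) (e : int -> H).
Hypotheses (hip : is_inner_product ip) (he : orthonormal_basis ip e).
Variable rho : A -> {linear H -> H}.
Hypothesis hrho : canonical_representation u s2 ip e rho.
Local Notation up := (upow u).

Let rel : Q2_relations u s2. Proof. by case: hQ2. Qed.
Let uu : unitary u. Proof. by case: rel. Qed.
Let hrep : is_representation ip rho. Proof. by case: hrho. Qed.

Lemma rhoM a b x : rho (a * b) x = rho a (rho b x).
Proof. by case: hrep. Qed.
Lemma rho1 x : rho 1 x = x. Proof. by case: hrep. Qed.
Lemma rho_linear c a b x : rho (c *: a + b) x = c *: rho a x + rho b x.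
Proof. by case: hrep. Qed.
Lemma rhoD a b x : rho (a + b) x = rho a x + rho b x.
Proof. by rewrite -{1}(scale1r a) rho_linear scale1r. Qed.
Lemma rho0 x : rho 0 x = 0.
Proof. by apply: (addrI (rho 0 x)); rewrite -rhoD !addr0. Qed.
Lemma rhoZ c a x : rho (c *: a) x = c *: rho a x.
Proof. by rewrite -[c *: a]addr0 rho_linear rho0 addr0. Qed.
Lemma rhoB a b x : rho (a - b) x = rho a x - rho b x.
Proof. by rewrite rhoD -scaleN1r rhoZ scaleN1r. Qed.
Lemma rho_star a x y : ip (rho (star a) x) y = ip x (rho a y).
Proof. by case: hrep => _ _ _ _ rs; rewrite rs starK. Qed.
Lemma rho_le a x : `|rho a x| <= 2 * `|a| * `|x|.
Proof. exact: (representation_bounded hip hrep). Qed.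

Lemma ipee j k : ip (e j) (e k) = (j == k)%:R. Proof. by case: he. Qed.

Lemma basis_dense (P : set H) : closed P -> P 0 ->
  (forall (c : R[i]) x y, P x -> P y -> P (c *: x + y)) -> (forall k, P (e k)) ->
  forall x, P x.
Proof.
move=> cP P0 Pl Pe x; have [_ /seteqP[_ /(_ x)/(_ I) cl]] := he.
apply: cP; apply: closure_subset cl => _ [r [c ->]].
elim: r => [|k r IH]; first by rewrite big_nil.
by rewrite big_cons; apply: Pl.
Qed.

Lemma ip_lipschitz x : exists2 C : R[i], 0 < C &
  forall y z, `|ip x y - ip x z| <= C * `|y - z|.
Proof.
exists (1 + `|x|) => [|y z]; first by rewrite ltr_pwDl.
rewrite -(ipBr hip); apply: le_trans (cauchy_schwarz hip _ _) _.
by rewrite ler_wpM2r// lerDr.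
Qed.

Lemma vector_eq0 x : (forall k, ip x (e k) = 0) -> x = 0.
Proof.
move=> xe; suff x0 y : ip x y = 0.
  by have /eqP := ipxx hip x; rewrite x0 eq_sym sqrf_eq0 normr_eq0 => /eqP.
have [C C0 HC] := ip_lipschitz x.
apply: (@basis_dense [set y | ip x y = 0]) => //=.
- apply: (@closed_equalizer _ H R[i]^o _ (fun=> 0) C C0 HC).
  by move=> y' z; rewrite subrr normr0 mulr_ge0 ?(ltW C0).
- exact: ip0r.
- by move=> c y' z y0 z0; rewrite (ipDr hip) (ipZr hip) y0 z0 mulr0 addr0.
Qed.

Lemma vector_eq x y : (forall k, ip x (e k) = ip y (e k)) -> x = y.
Proof.
move=> xy; apply/eqP; rewrite -subr_eq0; apply/eqP/vector_eq0 => k.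
by rewrite (ipBl hip) xy subrr.
Qed.

Lemma rho_inj a b : (forall k, rho a (e k) = rho b (e k)) -> a = b.
Proof.
move=> ab; apply/eqP; rewrite -subr_eq0; apply/eqP.
have [_ ff _ _] := hrho; apply: ff.
apply: (@basis_dense [set x | rho (a - b) x = 0]) => /=.
- apply: (@closed_equalizer _ H H _ (fun=> 0) (1 + 2 * `|a - b|)).
  + by rewrite ltr_pwDl// mulr_ge0.
  + move=> x y; rewrite -linearB; apply: le_trans (rho_le _ _) _.
    by rewrite ler_wpM2r// lerDr.
  + by move=> x y; rewrite subrr normr0 mulr_ge0// addr_ge0// mulr_ge0.
- exact: linear0.
- by move=> c x y x0 y0; rewrite linearD linearZ /= x0 y0 scaler0 addr0.
- by move=> k; rewrite rhoB ab subrr.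
Qed.

Lemma rho_u k : rho u (e k) = e (k + 1). Proof. by case: hrho. Qed.
Lemma rho_s2 k : rho s2 (e k) = e (2 * k). Proof. by case: hrho. Qed.

Lemma rho_us k : rho (star u) (e k) = e (k - 1).
Proof.
have -> : e k = rho u (e (k - 1)) by rewrite rho_u subrK.
by rewrite -rhoM; case: uu => _ ->; rewrite rho1.
Qed.

Lemma rho_upow i k : rho (up i) (e k) = e (k + i).
Proof.
elim/int_rect: i => [|n IH|n IH]; first by rewrite upow0 rho1 addr0.
  have -> : n.+1%:Z = 1 + n%:Z by lia.
  by rewrite upowS// rhoM IH rho_u addrAC addrA.
have -> : - n.+1%:Z = -1 + - n%:Z by lia.
by rewrite upowP// rhoM IH rho_us; congr e; lia.
Qed.

Lemma rho_s2X n k : rho (s2 ^+ n) (e k) = e (2 ^+ n * k).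
Proof.
elim: n => [|n IH]; first by rewrite expr0 rho1 mul1r.
by rewrite exprS rhoM IH rho_s2 mulrA -exprS.
Qed.

Lemma starX (a : A) n : star (a ^+ n) = star a ^+ n.
Proof.
elim: n => [|n IH]; first by rewrite !expr0 star1.
by rewrite exprS starM IH -exprSr.
Qed.

Lemma s2X_isometry n : star s2 ^+ n * s2 ^+ n = 1.
Proof.
have ss : star s2 * s2 = 1 by case: rel.
elim: n => [|n IH]; first by rewrite !expr0 mulr1.
by rewrite exprSr exprS -mulrA (mulrA _ s2) ss mul1r.
Qed.

Lemma rho_s2sX n k : rho (star s2 ^+ n) (e (2 ^+ n * k)) = e k.
Proof. by rewrite -rho_s2X -rhoM s2X_isometry rho1. Qed.

Lemma rho_s2sX_eq0 n k : (forall l, k != 2 ^+ n * l) ->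
  rho (star s2 ^+ n) (e k) = 0.
Proof.
move=> kl; apply: vector_eq0 => l.
by rewrite -starX rho_star rho_s2X ipee (negbTE (kl l)).
Qed.

Lemma norm_exprz1 (z : R[i]) (k : int) : `|z| = 1 -> `|z ^ k| = 1.
Proof.
move=> nz; case: k => n; rewrite /exprz ?normfV normrX nz expr1n ?invr1//.
Qed.

Lemma diagonal_unitary (xi : R[i]) (w : A) : `|xi| = 1 ->
  (forall k, rho w (e k) = xi ^ k *: e k) -> unitary w.
Proof.
move=> nxi hw; have xi0 : xi != 0 by rewrite -normr_eq0 nxi oner_eq0.
have hs k : rho (star w) (e k) = xi ^ (- k) *: e k.
  apply: vector_eq => l; rewrite rho_star hw (ipZr hip) (ipZl hip) ipee.
  have [->|] := eqVneq k l; last by rewrite !mulr0.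
  rewrite !mulr1 -invr_expz -[RHS]mul1r.
  have n1 : `|xi ^ l| = 1 by rewrite norm_exprz1.
  apply: (mulIf (expfz_neq0 l xi0)).
  by rewrite mulrC -normCK n1 expr1n -mulrA mulVf ?mulr1// expfz_neq0.
split; apply: rho_inj => k; rewrite rhoM rho1.
  by rewrite hs linearZ /= hw scalerA -expfzDr// addNr expr0z scale1r.
by rewrite hw linearZ /= hs scalerA -expfzDr// subrr expr0z scale1r.
Qed.

(** U_xi = s2 U_(xi^2) s2^* + xi u s2 U_(xi^2) s2^* u^*. *)
Lemma diagonal_exists n (xi : R[i]) : `|xi| = 1 -> xi ^+ (2 ^ n) = 1 ->
  exists w : A, forall k, rho w (e k) = xi ^ k *: e k.
Proof.
elim: n xi => [|n IH] xi nxi xin.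
  rewrite expr1 in xin; exists 1 => k.
  by rewrite rho1 xin exp1rz scale1r.
have xi0 : xi != 0 by rewrite -normr_eq0 nxi oner_eq0.
have [||w hw] := IH (xi ^+ 2).
- by rewrite normrX nxi expr1n.
- by rewrite -exprM -expnS.
exists (s2 * w * star s2 + xi *: (u * s2 * w * star s2 * star u)) => k.
have even l : rho (star s2) (e (2 * l)) = e l.
  by have := rho_s2sX 1 l; rewrite !expr1.
have odd l : rho (star s2) (e (2 * l + 1)) = 0.
  by have := @rho_s2sX_eq0 1 (2 * l + 1); rewrite !expr1; apply=> m; lia.
have xi2 l : (xi ^+ 2) ^ l = xi ^ (2 * l) by rewrite (exprnP xi 2) exprz_exp.
rewrite rhoD rhoZ !rhoM; have [l [->|->]] := int_parity k.
  rewrite even hw linearZ /= rho_s2 rho_us.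
  have -> : 2 * l - 1 = 2 * (l - 1) + 1 by lia.
  by rewrite odd !linear0 ?scaler0 addr0 xi2.
rewrite odd !linear0 add0r rho_us addrK even hw !linearZ /= rho_s2 rho_u.
by rewrite scalerA xi2 -[X in _ * X]expr1z -expfzDr.
Qed.

Lemma diagonal_commute (xi : R[i]) (w : A) : xi != 0 ->
  (forall k, rho w (e k) = xi ^ k *: e k) -> w * u = xi *: (u * w).
Proof.
move=> xi0 hw; apply: rho_inj => k; rewrite rhoZ !rhoM rho_u !hw linearZ /= rho_u.
by rewrite scalerA -[X in X * _]expr1z -expfzDr// addrC.
Qed.

End Canonical.

(** * Limits of complex sequences *)

Section ComplexSequences.
Variable R : realType.
Implicit Types (f g : nat -> R[i]) (l : R[i]).

Definition tends_to f l := forall e : R[i], 0 < e ->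
  exists N, forall n, (N <= n)%N -> `|f n - l| < e.

Lemma tends_unique f l l' : tends_to f l -> tends_to f l' -> l = l'.
Proof.
move=> fl fl'; apply/eqP/negPn/negP => ll'.
have d0 : 0 < `|l - l'| / 2 by rewrite divr_gt0// normr_gt0 subr_eq0.
have [N HN] := fl _ d0; have [N' HN'] := fl' _ d0.
have := ltrD (HN _ (leq_maxl N N')) (HN' _ (leq_maxr N N')).
rewrite -splitr distrC => /(le_lt_trans (ler_normD _ _)).
by rewrite addrA subrK ltxx.
Qed.

Lemma tends_cst l : tends_to (fun=> l) l.
Proof. by move=> e e0; exists 0%N => n _; rewrite subrr normr0. Qed.

Lemma tends_lin c f g l l' : tends_to f l -> tends_to g l' ->
  tends_to (fun n => c * f n + g n) (c * l + l').
Proof.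
move=> fl gl e e0; have c0 : 0 < 1 + `|c| by rewrite ltr_pwDl.
have [N HN] := fl (e / 2 / (1 + `|c|)) (divr_gt0 (divr_gt0 e0 (ltr0n _ 2)) c0).
have [N' HN'] := gl (e / 2) (divr_gt0 e0 (ltr0n _ 2)).
exists (maxn N N') => n; rewrite geq_max => /andP[Nn N'n].
have -> : c * f n + g n - (c * l + l') = c * (f n - l) + (g n - l') by ring.
apply: le_lt_trans (ler_normD _ _) _; rewrite (splitr e).
apply: ler_ltD (HN' _ N'n); rewrite normrM.
have := ltW (HN _ Nn); rewrite ler_pdivlMr// mulrC => /(le_trans _); apply.
by rewrite ler_wpM2r// lerDr.
Qed.

Lemma tends_conj f l : tends_to f l -> tends_to (fun n => (f n)^*) l^*.
Proof.
move=> fl e e0; have [N HN] := fl e e0; exists N => n Nn.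
by rewrite -rmorphB norm_conjC; exact: HN.
Qed.

Lemma tends_dist f g l (C : R[i]) : 0 <= C -> tends_to f l ->
  (forall n, `|g n - f n| <= C * 2 ^- n) -> tends_to g l.
Proof.
move=> C0 fl fg e e0; have C1 : 0 < 1 + C by rewrite ltr_pwDl.
have [N HN] := fl (e / 2) (divr_gt0 e0 (ltr0n _ 2)).
have [N' HN'] := exp2V_lt (divr_gt0 (divr_gt0 e0 (ltr0n _ 2)) C1).
exists (maxn N N') => n; rewrite geq_max => /andP[Nn N'n].
rewrite -(subrKA (f n)); apply: le_lt_trans (ler_normD _ _) _.
rewrite (splitr e); apply: ler_ltD (HN _ Nn); apply: le_trans (fg _) _.
have := ltW (HN' _ N'n); rewrite ler_pdivlMr// mulrC => /(le_trans _); apply.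
by rewrite ler_wpM2r ?invr_ge0 ?exprn_ge0// lerDr.
Qed.

Lemma tends_le f l (C : R[i]) : 0 <= C -> tends_to f l -> (forall n, `|f n| <=
  C) -> `|l| <= C.
Proof.
move=> C0 fl fC; rewrite real_leNgt ?ger0_real//; apply/negP => Cl.
have d0 : 0 < `|l| - C by rewrite subr_gt0.
have [N HN] := fl _ d0.
have := HN N (leqnn _); rewrite distrC => /(le_lt_trans (lerB_dist _ _)).
by rewrite ltrD2l ltrN2 => /lt_le_trans/(_ (fC N)); rewrite ltxx.
Qed.

Lemma complex_cauchy f :
  (forall e : R[i], 0 < e -> exists N, forall m n, (N <= m)%N -> (N <= n)%N ->
     `|f m - f n| < e) -> exists l, tends_to f l.
Proof.
move=> fC.
have real_cauchy (p : R[i] -> R) : (forall x y, `|p x - p y|%:C%C <= `|x - y|) ->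
    exists l : R, forall e : R, 0 < e -> exists N, forall n, (N <= n)%N ->
      `|p (f n) - l| < e.
  move=> pC; have : cvg ((p \o f) @ \oo).
    apply: cauchy_cvg; apply/cauchy_ballP => e e0; near_simpl.
    have [|N HN] := fC e%:C%C; first by rewrite ltcR.
    exists ([set n | (N <= n)%N], [set n | (N <= n)%N]); first by split; exists N.
    move=> [m n] [/= Nm Nn]; rewrite /ball /= -ltcR.
    by apply: le_lt_trans (pC _ _) _; exact: HN.
  move=> pc; exists (lim ((p \o f) @ \oo)) => e e0.
  have /cvgrPdist_lt/(_ e e0)[N _ HN] := pc.
  by exists N => n Nn; rewrite distrC; apply: HN.
have [|a Ha] := real_cauchy (@complex.Re R).
  by move=> x y; rewrite -raddfB; exact: normc_ge_Re.
have [|b Hb] := real_cauchy (@complex.Im R).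
  move=> x y; rewrite -raddfB; set z := x - y.
  (* Im z = - Re (z i), so the bound for real parts also serves imaginary parts. *)
  have := normc_ge_Re (z * 'i%C); rewrite ReiNIm normrN normrM.
  by rewrite complexiE normCi mulr1.
exists (a +i* b)%C => e e0.
have er : (complex.Re e)%:C%C = e by rewrite RRe_real// realE ltW.
have e2 : 0 < complex.Re e / 2 by rewrite divr_gt0// -ltcR er.
have [N HN] := Ha _ e2; have [N' HN'] := Hb _ e2.
exists (maxn N N') => n; rewrite geq_max => /andP[Nn N'n].
rewrite [f n - _]complexE.
have -> : complex.Re (f n - (a +i* b)%C) = complex.Re (f n) - a.
  by rewrite raddfB.
have -> : complex.Im (f n - (a +i* b)%C) = complex.Im (f n) - b.
  by rewrite raddfB.
apply: le_lt_trans (ler_normD _ _) _.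
rewrite normrM complexiE normCi mul1r -er [ltRHS](_ : _ = (complex.Re e /
  2)%:C%C + (complex.Re e / 2)%:C%C); last by rewrite -rmorphD /= -splitr.
have nC (x : R) : `|x%:C%C| = `|x|%:C%C.
  by rewrite normc_def /= expr0n addr0 sqrtr_sqr.
by rewrite !nC; apply: ltrD; rewrite ltcR; [exact: HN|exact: HN'].
Qed.

End ComplexSequences.

(** * States concentrated at points of the circle *)

Section Expectation.
Variables (R : realType) (A : cstarAlgType R) (u s2 : A).
Hypothesis hQ2 : is_Q2 u s2.
Variables (H : completeNormedModType R[i]) (ip : H -> H -> R[i]) (e : int -> H).
Hypotheses (hip : is_inner_product ip) (he : orthonormal_basis ip e).
Variable rho : A -> {linear H -> H}.
Hypothesis hrho : canonical_representation u s2 ip e rho.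
Local Notation up := (upow u).
Implicit Types (z : R[i]) (a b x : A).

Let rel : Q2_relations u s2. Proof. by case: hQ2. Qed.
Let uu : unitary u. Proof. by case: rel. Qed.

(** The window [16^M, 16^M + 4^M[ is short compared to its distance from 0, so
    that s2^m s2^*n moves it off itself for m <> n. A window starting at 0 would
    give nonzero limits on these monomials at the roots of unity. *)
Definition wave (M : nat) z : H :=
  \sum_(0 <= k < 4 ^ M) z^-1 ^+ k *: e (16 ^ M + k)%N.

Lemma wave_norm M z : `|z| = 1 -> `|wave M z| = 2 ^+ M.
Proof.
move=> nz; suff : `|wave M z| ^+ 2 = (2 ^+ M) ^+ 2.
  by move/eqP; rewrite eqrXn2// ?exprn_ge0// => /eqP.
rewrite -(ipxx hip) /wave (ip_suml hip).
transitivity (\sum_(0 <= k < 4 ^ M) (1 : R[i])); last first.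
  by rewrite sumr_const_nat subn0 natrX -exprM mulnC exprM -[2 ^+ 2]natrX.
apply: eq_big_nat => k /andP[_ kM]; rewrite (ip_sumr hip).
rewrite (bigD1_seq k) ?iota_uniq ?mem_index_iota//=.
rewrite big1 => [|l lk]; last first.
  rewrite (ipZl hip) (ipZr hip) (ipee he) eqz_nat eqn_add2l.
  by rewrite (negbTE (_ : k != l)) ?mulr0// eq_sym.
rewrite addr0 (ipZl hip) (ipZr hip) (ipee he) eqxx mulr1 -normCK normrX.
by rewrite normfV nz invr1 !expr1n.
Qed.

Lemma e_norm k : `|e k| = 1.
Proof. by apply/eqP; rewrite -(@eqrXn2 _ 2)// -(ipxx hip) (ipee he) eqxx
  expr1n. Qed.

(** The wave is an eigenvector of [star u] up to the two ends of the window. They contribute norm at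
    most 2, which is negligible against the norm 2^M of the wave. *)
Lemma wave_shift M z : `|z| = 1 ->
  `|rho (star u) (wave M z) - z^-1 *: wave M z| <= 2.
Proof.
move=> nz; pose t (k : nat) := z^-1 ^+ k *: e ((16 ^ M + k)%:Z - 1).
have -> : rho (star u) (wave M z) - z^-1 *: wave M z = - (t (4 ^ M)%N - t 0%N).
  rewrite -telescope_sumr// /wave linear_sum /= scaler_sumr -sumrB -sumrN.
  apply: eq_bigr => k _; rewrite linearZ /= (rho_us hQ2 hrho) scalerA -exprS
    opprB.
  by congr (_ - _ *: e _); lia.
rewrite normrN; apply: le_trans (ler_normB _ _) _.
by rewrite /t !normrZ !e_norm !normrX normfV nz invr1 !expr1n !mulr1.
Qed.

Definition wave_state M z a : R[i] :=
  4 ^- M * ip (rho a (wave M z)) (wave M z).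

Let e4 M : (4 : R[i]) ^+ M = 2 ^+ M * 2 ^+ M.
Proof. by rewrite -exprMn -natrM. Qed.

Lemma wave_state_lin M z c a b :
  wave_state M z (c *: a + b) = c * wave_state M z a + wave_state M z b.
Proof. by rewrite /wave_state (rho_linear hrho) (ipDl hip) (ipZl hip); ring. Qed.

Lemma wave_state_le M z a : `|z| = 1 -> `|wave_state M z a| <= 2 * `|a|.
Proof.
move=> nz; rewrite /wave_state normrM ger0_norm ?invr_ge0 ?exprn_ge0//.
rewrite ler_pdivrMl ?exprn_gt0//; apply: le_trans (cauchy_schwarz hip _ _) _.
rewrite wave_norm// e4 [leRHS]mulrC mulrA ler_pM2r ?exprn_gt0//.
by have := rho_le hip hrho a (wave M z); rewrite wave_norm.
Qed.

Lemma wave_state1 M z : `|z| = 1 -> wave_state M z 1 = 1.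
Proof.
move=> nz; rewrite /wave_state (rho1 hrho) (ipxx hip) wave_norm// expr2 -e4.
by rewrite mulVf// expf_neq0// pnatr_eq0.
Qed.

Lemma wave_state_star M z a : wave_state M z (star a) = (wave_state M z a)^*.
Proof.
rewrite /wave_state (rho_star hrho) rmorphM /= -(ipC hip); congr (_ * _).
by rewrite [RHS]conj_Creal// ger0_real// invr_ge0 exprn_ge0.
Qed.

(** Move u to the other argument of the inner product. The error vector there has norm at most 2 by
    [wave_shift], the vector rho(a) wave has norm at most 2 |a| 2^M, and the normalization divides
    by 4^M. *)
Lemma wave_state_u M z a : `|z| = 1 ->
  `|wave_state M z (u * a) - z * wave_state M z a| <= 4 * `|a| * 2 ^- M.
Proof.
move=> nz; have zc : z = z^-1^*.
  by rewrite fmorphV /= invC_norm norm_conjC nz expr1n invr1 mul1r conjCK.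
rewrite /wave_state (rhoM hrho).
rewrite -{1}[u]starK (rho_star hrho).
have -> : z * (4 ^- M * ip (rho a (wave M z)) (wave M z)) =
    4 ^- M * ip (rho a (wave M z)) (z^-1 *: wave M z).
  by rewrite (ipZr hip) -zc mulrCA.
rewrite -mulrBr -(ipBr hip).
rewrite normrM ger0_norm ?invr_ge0 ?exprn_ge0//.
rewrite ler_pdivrMl ?exprn_gt0//; apply: le_trans (cauchy_schwarz hip _ _) _.
have -> : 4 ^+ M * (4 * `|a| * 2 ^- M) = 2 * `|a| * 2 ^+ M * 2.
  by rewrite e4; field; rewrite expf_neq0.
apply: ler_pM => //; last exact: wave_shift.
by have := rho_le hip hrho a (wave M z); rewrite wave_norm.
Qed.

(** The operator sends e_(2^n q) to e_(2^m q) and kills the other basis vectors. For m <> n and q >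
    0 these two indices differ by a factor of at least 2, but two indices in the window have a ratio
    below 2 since 4^M <= 16^M. *)
Lemma wave_state_s2 M z (m n : nat) : m != n ->
  wave_state M z (s2 ^+ m * star s2 ^+ n) = 0.
Proof.
move=> mn; rewrite /wave_state /wave linear_sum /= (ip_suml hip).
rewrite big1_seq ?mulr0// => k /=; rewrite mem_index_iota => /andP[_ kM].
rewrite (ip_sumr hip) big1_seq// => l /=; rewrite mem_index_iota => /andP[_ lM].
rewrite linearZ /= (ipZl hip) (ipZr hip) (rhoM hrho).
have [[q kq]|nq] := pselect (exists q, (16 ^ M + k)%N%:Z = 2 ^+ n * q); last
  first.
  rewrite (rho_s2sX_eq0 hip he hrho) ?linear0 ?(ip0l hip) ?mulr0// => q.
  by apply/eqP => kq; apply: nq; exists q.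
rewrite kq (rho_s2sX hQ2 hrho) (rho_s2X hrho) (ipee he).
suff /negbTE -> : 2 ^+ m * q != (16 ^ M + l)%N by rewrite !mulr0.
apply/eqP => lq.
have q0 : 0 < q.
  have : 0 < 2 ^+ n * q :> int by rewrite -kq ltz_nat addn_gt0 expn_gt0.
  by rewrite pmulr_rgt0// exprn_gt0.
have le416 : (4 ^ M <= 16 ^ M)%N by case: (M) => // M'; rewrite leq_exp2r.
have [mltn|] := ltnP m n.
  have : 2 * (2 ^+ m * q) <= 2 ^+ n * q :> int.
    by rewrite mulrA -exprS ler_pM2r// ler_eXn2l.
  rewrite lq -kq; lia.
rewrite leq_eqVlt eq_sym (negbTE mn) /= => nltm.
have : 2 * (2 ^+ n * q) <= 2 ^+ m * q :> int.
  by rewrite mulrA -exprS ler_pM2r// ler_eXn2l.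
rewrite lq -kq; lia.
Qed.

End Expectation.

(** The bound uniform in i makes the set closed. It is used with the product filter on pairs of
    indices for the Cauchy property of wave states, with neighbourhoods of a point for the
    continuity of z |-> E_z, and at infinity for averages over roots of unity. *)
Lemma vanishing_closed_subspace (R : realType) (A : cstarAlgType R) (I : Type)
    (F : set_system I) (FF : Filter F) (L : I -> A -> R[i]) (C : R[i]) :
  0 < C -> (forall i a, `|L i a| <= C * `|a|) ->
  (forall i c a b, L i (c *: a + b) = c * L i a + L i b) ->
  closed_subspace [set a | forall e : R[i], 0 < e -> F [set i | `|L i a| < e]].
Proof.
move=> C0 LC Ll; have L0 i : L i 0 = 0.
  by have := Ll i (-1) 0 0; rewrite scaleN1r addNr mulN1r addNr.
split.
  apply/closed_approxP => a aD e e0.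
  have [b bD ab] := aD (e / 2 / C) (divr_gt0 (divr_gt0 e0 (ltr0n _ 2)) C0).
  apply: filterS (bD (e / 2) (divr_gt0 e0 (ltr0n _ 2))) => i /= Lb.
  have -> : L i a = L i (a - b) + L i b.
    by rewrite -[L i (a - b)]mul1r -Ll scale1r subrK.
  apply: le_lt_trans (ler_normD _ _) _; rewrite (splitr e).
  apply: ler_ltD Lb; apply: le_trans (LC _ _) _.
  by move: (ltW ab); rewrite ler_pdivlMr// mulrC.
split=> [e e0|c a b aD bD e e0].
  by apply: filterS filterT => i _ /=; rewrite L0 normr0.
have c0 : 0 < 1 + `|c| by rewrite ltr_pwDl.
have := aD (e / 2 / (1 + `|c|)) (divr_gt0 (divr_gt0 e0 (ltr0n _ 2)) c0).
have := bD (e / 2) (divr_gt0 e0 (ltr0n _ 2)).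
apply: filterS2 => i /= Lb La; rewrite Ll.
apply: le_lt_trans (ler_normD _ _) _; rewrite (splitr e).
apply: ler_ltD Lb; rewrite normrM.
have := ltW La; rewrite ler_pdivlMr// mulrC => /(le_trans _); apply.
by rewrite ler_wpM2r// lerDr.
Qed.

Section State.
Variables (R : realType) (A : cstarAlgType R) (u s2 : A).
Hypothesis hQ2 : is_Q2 u s2.
Variables (H : completeNormedModType R[i]) (ip : H -> H -> R[i]) (e : int -> H).
Hypotheses (hip : is_inner_product ip) (he : orthonormal_basis ip e).
Variable rho : A -> {linear H -> H}.
Hypothesis hrho : canonical_representation u s2 ip e rho.
Local Notation up := (upow u).
Implicit Types (z : R[i]) (a b x : A).

Let rel : Q2_relations u s2. Proof. by case: hQ2. Qed.
Let uu : unitary u. Proof. by case: rel. Qed.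
Local Notation ws M z a := (wave_state ip e rho M z a).

Lemma tends_eq (f g : nat -> R[i]) l l' : tends_to f l -> f =1 g -> l = l' ->
  tends_to g l'.
Proof. by move=> fl /funext <- <-. Qed.

Lemma wave_state_upow z i a : `|z| = 1 ->
  tends_to (fun M => ws M z (up i * a) - z ^ i * ws M z a) 0.
Proof.
move=> nz; have z0 : z != 0 by rewrite -normr_eq0 nz oner_eq0.
have step b : tends_to (fun M => ws M z (u * b) - z * ws M z b) 0.
  apply: (@tends_dist _ (fun=> 0) _ _ (4 * `|b|)) => [||M].
  - by rewrite mulr_ge0.
  - exact: tends_cst.
  - by rewrite subr0; exact: (wave_state_u hQ2 hip he hrho).
elim/int_rect: i => [|n IH|n IH].
- by apply: tends_eq (tends_cst 0) _ _ => // M; rewrite upow0 mul1r expr0z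
  mul1r subrr.
- have -> : n.+1%:Z = 1 + n%:Z by lia.
  apply: tends_eq (tends_lin z IH (step (up n * a))) _ _; last by rewrite mulr0
    addr0.
  by move=> M; rewrite upowS// -mulrA expfzDr// expr1z; ring.
- have -> : - n.+1%:Z = -1 + - n%:Z by lia.
  (* The estimate for u is applied to u^(-n-1) a, for which u u^(-n-1) a = u^(-n) a, and then
     divided by -z. *)
  apply: tends_eq (tends_lin 1 (tends_lin (- z^-1) (step (up (-1 + - n%:Z) *
    a)) (tends_cst 0)) (tends_lin z^-1 IH (tends_cst 0))) _ _; last by rewrite
    !(mulr0, addr0).
  move=> M; rewrite mulrA -upowS// addNKr expfzDr// -[z ^ (-1)]invr_expz expr1z.
  by field.
Qed.

Lemma wave_state_upowr z i a : `|z| = 1 ->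
  tends_to (fun M => ws M z (a * up i) - z ^ i * ws M z a) 0.
Proof.
move=> nz; have z0 : z != 0 by rewrite -normr_eq0 nz oner_eq0.
apply: tends_eq (tends_conj (wave_state_upow (- i) (star a) nz)) _ _; last by
  rewrite rmorph0.
move=> M; rewrite rmorphB /= [X in _ - X]rmorphM /= -!(wave_state_star hip
  hrho) starM starK upow_star// opprK.
congr (_ - _ * _); rewrite -invr_expz fmorphV /= invC_norm norm_conjC conjCK.
by rewrite norm_exprz1// expr1n invr1 mul1r.
Qed.

(** With P_n = s2^n s2^*n, the relation s2 s2^* + u s2 s2^* u^* = 1 gives
    P_n = P_(n+1) + u^(2^n) P_(n+1) u^(-2^n), and both summands have
    asymptotically the same value. *)
Lemma wave_state_P z n : `|z| = 1 ->
  tends_to (fun M => ws M z (s2 ^+ n * star s2 ^+ n)) (2 ^- n).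
Proof.
move=> nz; have z0 : z != 0 by rewrite -normr_eq0 nz oner_eq0.
elim: n => [|n IH].
  rewrite !expr0 mulr1 invr1; apply: tends_eq (tends_cst 1) _ _ => // M.
  by rewrite (wave_state1 hip he hrho).
pose K : int := 2 ^+ n; pose P := s2 ^+ n.+1 * star s2 ^+ n.+1.
have PK : s2 ^+ n * star s2 ^+ n = 1 *: P + up K * P * up (- K).
  rewrite scale1r.
  have sum : s2 * star s2 + u * s2 * star s2 * star u = 1 by case: rel.
  rewrite -[s2 ^+ n in LHS]mulr1 -sum mulrDr mulrDl /P exprSr exprS !mulrA.
  congr (_ + _).
  have -> : up K * s2 ^+ n = s2 ^+ n * u.
    by rewrite -[u in RHS]upow1 (s2X_upow rel) mulr1.
  rewrite -!mulrA; do 4! congr (_ * _).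
  apply: (can_inj (@starK _ A)).
  rewrite !starM !starX !starK upow_star// opprK.
  by rewrite -[u in LHS]upow1 (s2X_upow rel) mulr1.
have T1 := wave_state_upowr (- K) (up K * P) nz.
have T2 := wave_state_upow K P nz.
apply: tends_eq (tends_lin (2^-1) IH (tends_lin (- 2^-1) T1 (tends_lin (- 2^-1
  * z ^ (- K)) T2 (tends_cst 0)))) _ _; last first.
  by rewrite !(mulr0, addr0) exprS invfM.
move=> M; rewrite PK (wave_state_lin hip hrho).
rewrite -!invr_expz -/P.
have : z ^ K != 0 by rewrite expfz_neq0.
by move: (z ^ K) => y y0; field.
Qed.

Lemma wave_state_monomial z i m n j : `|z| = 1 ->
  tends_to (fun M => ws M z (monomial u s2 i m n j))
    (if m == n then z ^ (i + j) * 2 ^- n else 0).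
Proof.
move=> nz; have z0 : z != 0 by rewrite -normr_eq0 nz oner_eq0.
have Pmn : tends_to (fun M => ws M z (s2 ^+ m * star s2 ^+ n))
    (if m == n then 2 ^- n else 0).
  have [->|mn] := eqVneq m n; first exact: wave_state_P.
  apply: tends_eq (tends_cst 0) _ _ => // M.
  by rewrite (wave_state_s2 hQ2 hip he hrho).
have T1 := wave_state_upow i (s2 ^+ m * star s2 ^+ n) nz.
have T2 := wave_state_upowr j (up i * (s2 ^+ m * star s2 ^+ n)) nz.
apply: tends_eq (tends_lin 1 T2 (tends_lin (z ^ j) T1 (tends_lin (z ^ (i + j))
  Pmn (tends_cst 0)))) _ _; last first.
  by rewrite !mulr0 !add0r addr0; case: eqP; rewrite ?mulr0.
have -> : monomial u s2 i m n j = up i * (s2 ^+ m * star s2 ^+ n) * up j.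
  by rewrite /monomial !mulrA.
by move=> M; rewrite expfzDr//; ring.
Qed.

(** The limit exists for |z| = 1; otherwise [state] may take the junk value 0. *)
Definition state z a : R[i] := xget 0 [set l | tends_to (fun M => ws M z a) l].

(** Being Cauchy is preserved by linear combinations and, thanks to the uniform bound on wave
    states, by norm limits; on monomials the limits are explicit. *)
Lemma state_tends z a : `|z| = 1 -> tends_to (fun M => ws M z a) (state z a).
Proof.
move=> nz; suff [l Hl] : exists l, tends_to (fun M => ws M z a) l.
  by rewrite /state; case: xgetP => [_ -> //|/(_ l)].
apply: complex_cauchy.
pose L (p : nat * nat) b := ws p.1 z b - ws p.2 z b.
have : cspan [set x | exists i m n j, x = monomial u s2 i m n j] a.
  by rewrite (Q2_dense rel hQ2).
suff H0 : cspan [set x | exists i m n j, x = monomial u s2 i m n j] `<=`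
    [set a | forall e : R[i], 0 < e -> filter_prod \oo \oo [set p | `|L p a| <
      e]].
  move=> /H0 Ha d d0; have [[B1 B2] [[N1 _ B1N] [N2 _ B2N]] HB] := Ha d d0.
  exists (maxn N1 N2) => m n; rewrite !geq_max => /andP[m1 m2] /andP[n1 n2].
  by apply: (HB (m, n)); split; [exact: B1N|exact: B2N].
apply: cspan_min.
  apply: (@vanishing_closed_subspace _ _ _ _ _ L 4) => // [p b|p c b b'].
    apply: le_trans (ler_normB _ _) _.
    apply: le_trans (lerD (wave_state_le hip he hrho _ _ nz) (wave_state_le hip
      he hrho _ _ nz)) _.
    by rewrite -mulrDl -natrD.
  by rewrite /L !(wave_state_lin hip hrho); ring.
move=> _ [i [m [n [j ->]]]] d d0.
have [N HN] := wave_state_monomial i m n j nz (divr_gt0 d0 (ltr0n _ 2)).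
exists ([set n | (N <= n)%N], [set n | (N <= n)%N]).
  by split; exists N.
move=> [p q] [/= Np Nq]; rewrite /L /=.
set l := if _ then _ else _ in HN.
rewrite -(subrKA l) (splitr d); apply: le_lt_trans (ler_normD _ _) _.
by apply: ltrD; [exact: HN|rewrite distrC; exact: HN].
Qed.

Section Fixed.
Variable z : R[i].
Hypothesis nz : `|z| = 1.

Let z0 : z != 0. Proof. by rewrite -normr_eq0 nz oner_eq0. Qed.

Lemma state_unique a l : tends_to (fun M => ws M z a) l -> state z a = l.
Proof. exact: tends_unique (state_tends a nz). Qed.

Lemma state_lin c a b : state z (c *: a + b) = c * state z a + state z b.
Proof.
apply: state_unique.
apply: tends_eq (tends_lin c (state_tends a nz) (state_tends b nz)) _ _ => // M.
by rewrite (wave_state_lin hip hrho).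
Qed.

Lemma stateD a b : state z (a + b) = state z a + state z b.
Proof. by rewrite -{1}(scale1r a) state_lin mul1r. Qed.

Lemma state0 : state z 0 = 0.
Proof. by apply: (addrI (state z 0)); rewrite -stateD !addr0. Qed.

Lemma stateZ c a : state z (c *: a) = c * state z a.
Proof. by rewrite -[c *: a]addr0 state_lin state0 addr0. Qed.

Lemma stateB a b : state z (a - b) = state z a - state z b.
Proof. by rewrite stateD -scaleN1r stateZ mulN1r. Qed.

Lemma state_le a : `|state z a| <= 2 * `|a|.
Proof.
apply: tends_le (state_tends a nz) _; first by rewrite mulr_ge0.
by move=> M; exact: (wave_state_le hip he hrho).
Qed.

Lemma state_star a : state z (star a) = (state z a)^*.
Proof.
apply: state_unique.
apply: tends_eq (tends_conj (state_tends a nz)) _ _ => // M.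
by rewrite (wave_state_star hip hrho).
Qed.

Lemma state_upow i a : state z (up i * a) = z ^ i * state z a.
Proof.
apply: state_unique.
apply: tends_eq (tends_lin 1 (wave_state_upow i a nz) (tends_lin (z ^ i)
  (state_tends a nz) (tends_cst 0))) _ _ => [M|]; ring.
Qed.

Lemma state1 : state z 1 = 1.
Proof.
apply: state_unique; apply: tends_eq (tends_cst 1) _ _ => // M.
by rewrite (wave_state1 hip he hrho).
Qed.

Lemma state_u i : state z (up i) = z ^ i.
Proof. by rewrite -[up i]mulr1 state_upow state1 mulr1. Qed.

Lemma state_monomial i m n j : state z (monomial u s2 i m n j) =
  if m == n then z ^ (i + j) * 2 ^- n else 0.
Proof. by apply: state_unique; exact: wave_state_monomial. Qed.

End Fixed.

End State.

(** * Parametrization of the circle *)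

Section Circle.
Variable R : realType.
Implicit Types (s t : R) (z : R[i]).

Definition expi t : R[i] := (cos t +i* sin t)%C.

Lemma expi0 : expi 0 = 1. Proof. by rewrite /expi cos0 sin0. Qed.

Lemma expiD s t : expi (s + t) = expi s * expi t.
Proof.
rewrite /expi cosD sinD; apply/eqP; rewrite eq_complex /=.
by rewrite eqxx /= addrC (mulrC (sin s)) addrC eqxx.
Qed.

Lemma norm_expi t : `|expi t| = 1.
Proof. by rewrite normc_def /= cos2Dsin2 sqrtr1. Qed.

Lemma expi_neq0 t : expi t != 0.
Proof. by rewrite -normr_eq0 norm_expi oner_eq0. Qed.

Lemma expiN t : expi (- t) = (expi t)^-1.
Proof.
by apply: (mulfI (expi_neq0 t)); rewrite -expiD subrr expi0 divff// expi_neq0.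
Qed.

Lemma expiMn t n : expi (t *+ n) = expi t ^+ n.
Proof.
by elim: n => [|n IH]; rewrite ?mulr0n ?expi0// mulrS exprS expiD IH.
Qed.

Lemma expiMz t (k : int) : expi (t *~ k) = expi t ^ k.
Proof.
by case: k => n; rewrite /intmul /exprz ?expiN expiMn.
Qed.

Lemma expi_2pi : expi (pi *+ 2) = 1.
Proof. by rewrite /expi cos2pi sin2pi. Qed.

Lemma expi_period t (k : int) : expi (t + (pi *+ 2) *~ k) = expi t.
Proof. by rewrite expiD expiMz expi_2pi exp1rz mulr1. Qed.

Lemma expi_eq1 t : expi t = 1 -> exists k : int, t = (pi *+ 2) *~ k.
Proof.
move=> t1; pose P : R := pi *+ 2; have P0 : 0 < P by rewrite mulrn_wgt0// pi_gt0.
pose k := Num.floor (t / P); pose r := t - P *~ k.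
have r0 : 0 <= r by rewrite subr_ge0 -mulrzl -ler_pdivlMr// ge_floor.
have rP : r < P.
  rewrite ltrBlDl -mulrzl -{2}[P]mul1r -mulrDl -ltr_pdivrMr//.
  by have := floorD1_gt (t / P); rewrite intrD.
have cr : cos r = 1.
  have /eqP : expi r = 1 by rewrite /r -mulrNz expi_period.
  by rewrite eq_complex => /andP[/eqP].
suff r00 : r = 0 by exists k; apply/eqP; rewrite -subr_eq0 -/P -/r r00.
have [rp|rp] := lerP r pi.
  apply: (@cos_inj R); rewrite ?cos0 ?in_itv//= ?r0 ?rp ?lexx ?pi_ge0//.
have : P - r = 0.
  apply: (@cos_inj R); rewrite ?cos0 ?in_itv/= ?lexx ?pi_ge0//.
    by rewrite subr_ge0 (ltW rP) /= lerBlDr /P mulr2n lerD2l ltW.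
  by rewrite addrC cosD2pi cosN cr.
by move/eqP; rewrite subr_eq0 => /eqP Pr; move: rP; rewrite Pr ltxx.
Qed.

Lemma expi_root_eq1 (K : nat) (m : int) : expi (pi *+ 2 / K.+1%:R) ^ m = 1 ->
  exists k, m = k * K.+1%:Z.
Proof.
rewrite -expiMz => /expi_eq1[k mk]; exists k.
have P0 : (pi : R) *+ 2 != 0 by rewrite mulrn_eq0 /= gt_eqF// pi_gt0.
have K0 : (K.+1%:R : R) != 0 by rewrite pnatr_eq0.
apply: (@intr_inj R); apply: (mulIf P0).
have -> : m%:~R * (pi *+ 2) = m%:~R * (pi *+ 2 / K.+1%:R) * K.+1%:R :> R.
  by rewrite -mulrA divfK.
by rewrite mulrzl mk -[_ *~ k]mulrzl mulrAC intrM.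
Qed.

Lemma expi_surj z : `|z| = 1 -> exists t, z = expi t.
Proof.
case: z => a b /eqP; rewrite normc_def eq_complex /= eqxx andbT => /eqP ab.
have ab1 : a ^+ 2 + b ^+ 2 = 1.
  by rewrite -[LHS]sqr_sqrtr ?addr_ge0 ?sqr_ge0// ab expr1n.
have a1 : -1 <= a <= 1.
  by rewrite -ler_norml -(@ler_pXn2r _ 2)// ?nnegrE// expr1n real_normK
    ?num_real// -ab1 lerDl sqr_ge0.
have sb : Num.sqrt (1 - a ^+ 2) = `|b| by rewrite -ab1 addrC addKr sqrtr_sqr.
have [b0|b0] := lerP 0 b.
  by exists (acos a); rewrite /expi acosK ?in_itv// sin_acos// sb ger0_norm.
exists (- acos a); rewrite /expi cosN sinN acosK ?in_itv// sin_acos// sb.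
by rewrite ltr0_norm// opprK.
Qed.

Lemma expi_continuous t (d : R[i]) : 0 < d ->
  \forall s \near t, `|expi s - expi t| < d.
Proof.
move=> d0; have dr : (complex.Re d)%:C%C = d by rewrite RRe_real// realE ltW.
have d2 : 0 < complex.Re d / 2 by rewrite divr_gt0// -ltcR dr.
have ct : \forall s \near t, `|cos t - cos s| < complex.Re d / 2.
  by have /cvgrPdist_lt/(_ _ d2) := @continuous_cos R t.
have st : \forall s \near t, `|sin t - sin s| < complex.Re d / 2.
  by have /cvgrPdist_lt/(_ _ d2) := @continuous_sin R t.
apply: filterS2 ct st => s hc hs.
rewrite [expi s - _]complexE /=.
apply: le_lt_trans (ler_normD _ _) _.
rewrite normrM complexiE normCi mul1r -dr.
have -> : (complex.Re d)%:C%C = (complex.Re d / 2)%:C%C + (complex.Re d / 2)%:C%C.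
  by rewrite -rmorphD /= -splitr.
have nC (x : R) : `|x%:C%C| = `|x|%:C%C.
  by rewrite normc_def /= expr0n addr0 sqrtr_sqr.
by rewrite distrC in hs; rewrite distrC in hc; rewrite !nC; apply: ltrD;
  rewrite ltcR.
Qed.

Lemma expiX_continuous t (k : int) (d : R[i]) : 0 < d ->
  \forall s \near t, `|expi s ^ k - expi t ^ k| < d.
Proof.
move=> d0; have kc : {for t, continuous (fun s : R => s *~ k)}.
  have -> : (fun s : R => s *~ k) = (fun s => k%:~R * s).
    by apply/funext => s; rewrite mulrzl.
  exact: mulrl_continuous.
have H : \forall s \near t, `|expi (s *~ k) - expi (t *~ k)| < d.
  exact: kc _ (expi_continuous (t *~ k) d0).
by apply: filterS H => s; rewrite !expiMz.
Qed.

End Circle.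

(** * The algebra C*(u) and its points *)

Section CircleAlgebra.
Variables (R : realType) (A : cstarAlgType R) (u : A).
Hypothesis uu : unitary u.
Local Notation up := (upow u).

Lemma circle_ind (D : set A) : closed_subspace D -> (forall i, D (up i)) ->
  cstar_gen [set u] `<=` D.
Proof.
move=> hD Dup x /cstar_gen_words; apply: cspan_min => //.
move=> y Hy; suff [i ->] : exists i, y = up i by exact: Dup.
elim: Hy => [|g {}y Gg _ [i ->]]; first by exists 0; rewrite upow0.
by case: Gg => [->|[_ -> <-]]; [exists (1 + i); rewrite upowS|exists (-1 + i);
  rewrite upowP].
Qed.

Lemma circle_functional_eq (f g : A -> R[i]) (C : R[i]) x : 0 < C ->
  (forall c a b, f (c *: a + b) = c * f a + f b) ->
  (forall c a b, g (c *: a + b) = c * g a + g b) ->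
  (forall a, `|f a| <= C * `|a|) -> (forall a, `|g a| <= C * `|a|) ->
  (forall i, f (up i) = g (up i)) -> cstar_gen [set u] x -> f x = g x.
Proof.
move=> C0 fl gl fC gC fg; move: x; apply: circle_ind => //.
have lip (h : A -> R[i]) : (forall c a b, h (c *: a + b) = c * h a + h b) ->
    (forall a, `|h a| <= C * `|a|) -> forall x y, `|h x - h y| <= C * `|x - y|.
  move=> hl hC x y; have -> : h x - h y = h (x - y); last exact: hC.
  by rewrite addrC -mulN1r -hl scaleN1r addrC.
have h0 (h : A -> R[i]) : (forall c a b, h (c *: a + b) = c * h a + h b) -> h 0
  = 0.
  by move=> hl; have := hl (-1) 0 0; rewrite scaleN1r addNr mulN1r addNr.
split; first exact: (@closed_equalizer _ A R[i]^o f g C C0 (lip f fl fC) (lip g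
  gl gC)).
by split=> [|c x y fx fy] /=; rewrite ?h0// fl gl fx fy.
Qed.

Lemma circle_upow i : cstar_gen [set u] (up i).
Proof.
have hD := @cstar_gen_subalgebra _ A [set u].
have Du : cstar_gen [set u] u by apply: cstar_gen_sub.
have D1 : cstar_gen [set u] 1.
  by case: (uu) => _ <-; exact: (subalgebraM hD (subalgebraS hD Du) Du).
elim/int_rect: i => [|n IH|n IH]; first by rewrite upow0.
  have -> : n.+1%:Z = 1 + n%:Z by lia.
  by rewrite upowS//; exact: (subalgebraM hD).
have -> : - n.+1%:Z = -1 + - n%:Z by lia.
by rewrite upowP//; apply: (subalgebraM hD) => //; exact: (subalgebraS hD).
Qed.

Lemma circle_u : cstar_gen [set u] u.
Proof. exact: cstar_gen_sub. Qed.

Lemma circle_us : cstar_gen [set u] (star u).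
Proof. by rewrite -upowN1; exact: circle_upow. Qed.

Lemma circle_commute x k : cstar_gen [set u] x -> x * up k = up k * x.
Proof.
apply: (circle_ind (D := [set x | x * up k = up k * x])) => [|i] /=; last first.
  by rewrite -!upowD// addrC.
split.
  apply: (@closed_equalizer _ A A _ _ 1) => // a b; rewrite -?mulrBl -?mulrBr
    mul1r;
  by apply: le_trans (normM_le _ _) _; rewrite (norm_unitary (upow_unitary uu
    k)) ?mulr1 ?mul1r.
split=> [|c a b ha hb] /=; first by rewrite mulr0 mul0r.
rewrite /= in ha hb.
by rewrite mulrDl mulrDr -scalerAl -scalerAr ha hb.
Qed.

End CircleAlgebra.

Section CircleStates.
Variables (R : realType) (A : cstarAlgType R) (u s2 : A).
Hypothesis hQ2 : is_Q2 u s2.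
Variables (H : completeNormedModType R[i]) (ip : H -> H -> R[i]) (e : int -> H).
Hypotheses (hip : is_inner_product ip) (he : orthonormal_basis ip e).
Variable rho : A -> {linear H -> H}.
Hypothesis hrho : canonical_representation u s2 ip e rho.
Local Notation up := (upow u).
Local Notation st := (state ip e rho).
Local Notation Cu := (cstar_gen [set u]).
Implicit Types (z : R[i]) (a b x : A).

Let rel : Q2_relations u s2. Proof. by case: hQ2. Qed.
Let uu : unitary u. Proof. by case: rel. Qed.

(** Both sides are bounded linear in x and agree on the powers of u. *)
Lemma stateMl z x a : `|z| = 1 -> Cu x -> st z (x * a) = st z x * st z a.
Proof.
move=> nz; have stl := state_lin hQ2 hip he hrho nz.
have stC := state_le hQ2 hip he hrho nz.
apply: (circle_functional_eq uu (C := 1 + 4 * `|a|) (f := fun x => st z (x * a))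
  (g := fun x => st z x * st z a)) => [||||b|i].
- by rewrite ltr_pwDl// mulr_ge0.
- by move=> c b d; rewrite mulrDl -scalerAl stl.
- by move=> c b d; rewrite stl; ring.
- move=> b; apply: le_trans (stC _) _.
  apply: le_trans (_ : 2 * (`|b| * `|a|) <= _).
    by rewrite ler_pM2l//; exact: normM_le.
  rewrite mulrA mulrAC; apply: ler_wpM2r => //.
  apply: le_trans (_ : 4 * `|a| <= _); last by rewrite lerDr.
  by rewrite ler_wpM2r// ler_nat.
- rewrite normrM; apply: le_trans (ler_pM _ _ (stC _) (stC _)) _ => //.
  rewrite mulrACA [`|b| * _]mulrC mulrA -natrM; apply: ler_wpM2r => //.
  by rewrite lerDr.
- by rewrite (state_upow hQ2 hip he hrho)// (state_u hQ2 hip he hrho).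
Qed.

Lemma stateMr z x a : `|z| = 1 -> Cu x -> st z (a * x) = st z a * st z x.
Proof.
move=> nz Cx; rewrite -[a * x]starK starM (state_star hQ2 hip he hrho)//
  stateMl//.
  by rewrite !(state_star hQ2 hip he hrho)// rmorphM /= !conjCK mulrC.
by apply: (subalgebraS (@cstar_gen_subalgebra _ _ _)).
Qed.

Lemma state_continuous a t (d : R[i]) : 0 < d ->
  \forall s \near t, `|st (expi s) a - st (expi t) a| < d.
Proof.
move: d; suff : cspan [set x | exists i m n j, x = monomial u s2 i m n j] `<=`
    [set a | forall d : R[i], 0 < d -> nbhs t [set s | `|st (expi s) a - st
      (expi t) a| < d]].
  by apply; rewrite (Q2_dense rel hQ2).
have stl s := state_lin hQ2 hip he hrho (norm_expi s).
have stC s := state_le hQ2 hip he hrho (norm_expi s).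
apply: cspan_min.
  apply: (@vanishing_closed_subspace _ _ _ _ _ (fun s a => st (expi s) a - st
    (expi t) a) 4) => //.
    move=> s b; apply: le_trans (ler_normB _ _) _.
    by apply: le_trans (lerD (stC s b) (stC t b)) _; rewrite -mulrDl -natrD.
  by move=> s c b b'; rewrite !stl opprD addrACA -mulrBr.
move=> _ [i [m [n [j ->]]]] d d0.
have stm s := state_monomial hQ2 hip he hrho (norm_expi s) i m n j.
have [mn|mn] := eqVneq m n; last first.
  apply: filterS (expi_continuous t d0) => s _ /=.
  by rewrite !stm (negbTE mn) subrr normr0.
apply: filterS (expiX_continuous t (i + j) d0) => s /= hs.
rewrite !stm mn eqxx -mulrBl normrM; apply: le_lt_trans hs.
rewrite ler_piMr// ger0_norm ?invr_ge0 ?exprn_ge0//.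
by rewrite invf_le1 ?exprn_gt0// exprn_ege1// ler1n.
Qed.

Lemma root_sum (K : nat) (w : R[i]) : w ^+ K = 1 -> w != 1 ->
  \sum_(0 <= k < K) w ^+ k = 0.
Proof.
move=> wK w1; apply: (mulfI (_ : w - 1 != 0)); first by rewrite subr_eq0.
by rewrite mulr0 big_mkord -subrX1 wK subrr.
Qed.

(** Averaging E_w(u^-l x) over roots of unity w of growing order recovers the
    matrix coefficient <x e_0, e_l>. *)
Lemma state_separates x : Cu x -> (forall t, st (expi t) x = 0) -> x = 0.
Proof.
move=> Cx x0.
have stl s := state_lin hQ2 hip he hrho (norm_expi s).
have stC s := state_le hQ2 hip he hrho (norm_expi s).
pose w K k : R := ((pi : R) *+ 2 / K.+1%:R) *+ k.
(* The difference between the average over the roots of unity of order K + 1 and the matrix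
   coefficient it should approximate. *)
pose L l K a := K.+1%:R^-1 * \sum_(0 <= k < K.+1) st (expi (w K k)) (up (- l) *
  a) -
  ip (rho a (e 0)) (e l).
have nL K l a : `|K.+1%:R^-1 * \sum_(0 <= k < K.+1) st (expi (w K k)) (up (- l)
  * a)| <= 2 * `|a|.
  rewrite normrM ger0_norm ?invr_ge0// ler_pdivrMl ?ltr0n//.
  apply: le_trans (ler_norm_sum _ _ _) _.
  apply: le_trans (_ : \sum_(0 <= k < K.+1) 2 * `|a| <= _).
    apply: ler_sum => k _; apply: le_trans (stC _ _) _; rewrite ler_pM2l//.
    apply: le_trans (normM_le _ _) _.
    by rewrite (norm_unitary (upow_unitary uu _)) mul1r.
  by rewrite sumr_const_nat subn0 [leRHS]mulr_natl.
have e1 k : `|e k| = 1 by exact: e_norm hip he k.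
have H0 l : forall d : R[i], 0 < d -> \forall K \near \oo, `|L l K x| < d.
  move: x Cx {x0}; apply: (circle_ind uu).
    apply: (@vanishing_closed_subspace _ _ _ _ _ (L l) 4) => // [K a|K c a b].
      apply: le_trans (ler_normB _ _) _.
      have -> : 4 * `|a| = 2 * `|a| + 2 * `|a| by rewrite -mulrDl -natrD.
      apply: lerD (nL _ _ _) _; apply: le_trans (cauchy_schwarz hip _ _) _.
      by rewrite e1 mulr1; apply: le_trans (rho_le hip hrho _ _) _; rewrite e1
        mulr1.
    rewrite /L (rho_linear hrho) (ipDl hip) (ipZl hip).
    rewrite (eq_bigr (fun k => c * st (expi (w K k)) (up (- l) * a) + st (expi
      (w K k)) (up (- l) * b))).
      by rewrite big_split /= -mulr_sumr; ring.
    by move=> k _; rewrite mulrDr -scalerAr stl.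
  (* On u^i the average is exact once K >= |i - l|: a nonzero i - l is then no multiple of K + 1, so
     the powers of W sum to 0. *)
  move=> i d d0; exists (absz (i - l)) => // K /= iK.
  rewrite /L (rho_upow hQ2 hrho) add0r (ipee he).
  pose W : R[i] := expi (pi *+ 2 / K.+1%:R) ^ (i - l).
  rewrite (eq_bigr (fun k => W ^+ k)) => [|k _]; last first.
    rewrite -upowD// (state_u hQ2 hip he hrho) ?norm_expi// expiMn exprnP
      exprz_exp.
    by rewrite (mulrC k%:Z) -exprz_exp (addrC (- l)) -exprnP.
  have WK : W ^+ K.+1 = 1.
    rewrite exprnP exprz_exp (mulrC _ K.+1%:Z) -exprz_exp -exprnP -expiMn -[_
      *+ K.+1]mulr_natr.
    by rewrite mulfVK ?pnatr_eq0// expi_2pi exp1rz.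
  have [il|il] := eqVneq i l.
    rewrite /W il subrr expr0z (eq_bigr (fun=> 1)) => [|k _]; last by rewrite
      expr1n.
    by rewrite sumr_const_nat subn0 mulVf ?pnatr_eq0// subrr normr0.
  suff W1 : W != 1 by rewrite root_sum// mulr0 subrr normr0.
  apply/eqP => /expi_root_eq1[k H1]; have : k != 0.
    by apply/eqP => k0; move: H1 il; rewrite k0 mul0r => /eqP; rewrite subr_eq0
      => ->.
  move=> k0; have H2 : (absz (i - l)) = (absz k * K.+1)%N by rewrite H1 abszM.
  have k1 : (0 < absz k)%N by rewrite absz_gt0.
  have : (K.+1 <= absz (i - l))%N by rewrite H2 leq_pmull.
  by rewrite leqNgt ltnS iK.
have rx0 : rho x (e 0) = 0.
  apply: (vector_eq0 hip he) => l.
  apply: (@small_eq0 _ R[i]^o) => d d0; have [N _ HN] := H0 l d d0.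
  have := HN N (leqnn N); rewrite /L /= big1 ?mulr0 ?sub0r ?normrN// => k _.
  by rewrite stateMl ?norm_expi// ?x0 ?mulr0//; exact: circle_upow.
apply: (rho_inj hip he hrho) => k; rewrite (rho0 hrho).
(* As x commutes with u, its vanishing at e_0 propagates to every e_k = u^k e_0. *)
have -> : e k = rho (up k) (e 0) by rewrite (rho_upow hQ2 hrho) add0r.
by rewrite -(rhoM hrho) circle_commute// (rhoM hrho) rx0 linear0.
Qed.

End CircleStates.

(** * Maps of the circle *)

Section CircleMaps.
Variable R : realType.
Implicit Types (s t : R) (z : R[i]).

(** Connectedness of the line: the indicator function g of a level set of f is continuous, and if it
    took both values 0 and 1 it would also take the value 1/2. *)
Lemma locally_constant (T : Type) (f : R -> T) :
  (forall t, \forall s \near t, f s = f t) -> forall s t, f s = f t.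
Proof.
move=> fl s t; apply: contrapT => fst.
pose g r : R := if `[< f r = f s >] then 1 else 0.
have gc : continuous g.
  move=> r; apply: cvg_near_cst; apply: filterS (fl r) => x fx.
  by rewrite /g fx.
have gs : g s = 1 by rewrite /g; case: asboolP.
have gt : g t = 0 by rewrite /g; case: asboolP => // /esym.
have [c _ gc2] : exists2 c, c \in `[Num.min s t, Num.max s t] & g c = 2^-1.
  apply: IVT.
  - by rewrite ge_min !le_max lexx.
  - exact: continuous_subspaceT.
  - have h0 : (0 : R) <= 2^-1 by rewrite invr_ge0.
    have h1 : (2^-1 : R) <= 1 by rewrite invf_le1 ?ler1n.
    by case: (leP s t) => _; rewrite gs gt ge_min le_max h0 h1 !orbT.
move: gc2; rewrite /g; case: asboolP => _ /eqP.
  by rewrite eq_sym invr_eq1 (eqr_nat R 2 1).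
by rewrite eq_sym invr_eq0 (eqr_nat R 2 0).
Qed.

(** A crude separation of the roots of unity of 2-power order. Squaring multiplies the distance to 1
    by |z + 1| <= 3, and in the end -1 is ruled out because it lies at distance 2 from 1. *)
Lemma root2_near1 M z : `|z| = 1 -> z ^+ (2 ^ M) = 1 ->
  `|z - 1| < 3 ^- M -> z = 1.
Proof.
elim: M z => [|M IH] z nz; first by rewrite expr1.
rewrite expnS exprM => zM z1.
have : z ^+ 2 = 1.
  apply: IH => //; first by rewrite normrX nz expr1n.
  rewrite subr_sqr_1 normrM; apply: le_lt_trans (_ : `|z - 1| * 3 < _).
    apply: ler_wpM2l => //; apply: le_trans (ler_normD _ _) _.
    by rewrite nz normr1 -[1 + 1]/(2%:R) ler_nat.
  by rewrite -ltr_pdivlMr// -invfM -exprSr.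
move/eqP; rewrite sqrf_eq1 => /orP[/eqP//|/eqP z2].
move: z1; rewrite z2 -opprD normrN -[1 + 1]/(2%:R) normr_nat => /lt_trans.
move/(_ 1); rewrite invf_lt1 ?exprn_gt0// exprn_egt1// ?ltr1n// => /(_ isT).
by rewrite (ltr_nat _ 2 1).
Qed.

Lemma root2_constant M (f : R -> R[i]) : (forall s, `|f s| = 1) ->
  (forall s, f s ^+ (2 ^ M) = 1) ->
  (forall t (d : R[i]), 0 < d -> \forall s \near t, `|f s - f t| < d) ->
  forall s t, f s = f t.
Proof.
move=> nf fM fc; apply: locally_constant => t.
have M0 : 0 < (3 ^- M : R[i]) by rewrite invr_gt0 exprn_gt0.
have ft0 : f t != 0 by rewrite -normr_eq0 nf oner_eq0.
apply: filterS (fc t _ M0) => s st.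
apply: (mulIf (_ : (f t)^-1 != 0)); first by rewrite invr_eq0.
rewrite divff//; apply: (@root2_near1 M).
- by rewrite normrM normfV !nf invr1 mulr1.
- by rewrite exprMn exprVn !fM invr1 mulr1.
- have -> : f s / f t - 1 = (f s - f t) / f t by rewrite mulrBl divff.
  by rewrite normrM normfV nf invr1 mulr1.
Qed.

Lemma expiX_near_inj t (a b : nat) :
  (\forall s \near t, expi s ^+ a = expi s ^+ b) -> a = b.
Proof.
wlog ab : a b / (a < b)%N => [hw H|].
  have [//||//] := ltngtP a b => lt; first exact: hw H.
  apply/esym/hw => //.
  by apply: filterS H => s ->.
move=> H; exfalso.
have /nbhs_ballP[d /= d0 Hd] := H.
have Hb s : `|t - s| < d -> expi (s *+ (b - a)) = 1.
  move=> std; have := Hd s std => /= Hs.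
  apply: (mulfI (_ : expi s ^+ a != 0)); first by rewrite expf_neq0// expi_neq0.
  by rewrite mulr1 expiMn -exprD subnKC ?(ltnW ab)// Hs.
have K0 : 0 < (b - a)%:R :> R by rewrite ltr0n subn_gt0.
have p0 : 0 < (pi : R) by exact: pi_gt0.
(* The first bound keeps t + y in the neighbourhood of t, the second keeps y (b - a) in ]0, pi],
   where expi does not take the value 1. *)
pose y := Num.min (d / 2) (pi / (b - a)%:R).
have y0 : 0 < y by rewrite /y lt_min !divr_gt0.
have : expi (y *+ (b - a)) = 1.
  have := Hb (t + y); rewrite opprD addNKr normrN gtr0_norm// mulrnDl expiD Hb
    ?subrr ?normr0//.
  rewrite mul1r; apply; apply: le_lt_trans (_ : d / 2 < _).
    by rewrite /y ge_min lexx.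
  by rewrite ltr_pdivrMr// ltr_pMr// ltr1n.
move/expi_eq1 => [k yk].
have yP : 0 < y *+ (b - a) < pi *+ 2.
  rewrite -mulr_natr mulr_gt0//=; apply: le_lt_trans (_ : pi < _); last first.
    by rewrite mulr2n ltrDl.
  by rewrite -ler_pdivlMr// /y ge_min lexx orbT.
have P0 : 0 < (pi : R) *+ 2 by rewrite mulrn_wgt0.
move: yP; rewrite yk -mulrzl pmulr_lgt0// gtr_pMl// ltr0z ltrz1; lia.
Qed.

(** * Continuous circle maps commuting with squaring *)

Section Doubling.
Variable h : R[i] -> R[i].
Hypothesis nh : forall z, `|z| = 1 -> `|h z| = 1.
Hypothesis hc : forall t (d : R[i]), 0 < d ->
  \forall s \near t, `|h (expi s) - h (expi t)| < d.
Hypothesis h2 : forall z, `|z| = 1 -> h (z ^+ 2) = h z ^+ 2.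

Let q s := h (expi s).
Let nq s : `|q s| = 1. Proof. exact/nh/norm_expi. Qed.
Let q2 s : q (s *+ 2) = q s ^+ 2. Proof. by rewrite /q expiMn h2// norm_expi. Qed.
Let q0 : q 0 = 1.
Proof.
have := q2 0; rewrite mul0rn expr2 => /esym; rewrite -{3}[q 0]mulr1; apply: mulfI.
by rewrite -normr_eq0 nq oner_eq0.
Qed.

Let ReIm s : complex.Re (q s) ^+ 2 + complex.Im (q s) ^+ 2 = 1.
Proof.
have := nq s; rewrite normc_def => /eqP; rewrite eq_complex /= eqxx andbT =>
  /eqP h1.
by rewrite -[LHS]sqr_sqrtr ?addr_ge0 ?sqr_ge0// h1 expr1n.
Qed.

Let Imq_continuous : continuous (fun s => complex.Im (q s)).
Proof.
move=> t; apply/cvgrPdist_lt => d d0.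
have d0' : 0 < d%:C%C by rewrite ltcR.
apply: filterS (hc t d0') => s hs; rewrite -ltcR; apply: le_lt_trans hs.
rewrite distrC -raddfB.
have := normc_ge_Re ((q s - q t) * 'i%C); rewrite ReiNIm normrN normrM.
by rewrite complexiE normCi mulr1.
Qed.

Let L0 s : R := asin (complex.Im (q s)).

(** Near 0 the path q stays within distance 1 of q(0) = 1, so its real part is positive and the
    arcsine of its imaginary part is a logarithm. *)
Let small : exists2 d : R, 0 < d & forall s, `|s| < d ->
  -1 < complex.Im (q s) < 1 /\ expi (L0 s) = q s.
Proof.
have /nbhs_ballP[d /= d0 Hd] := hc 0 (ltr01 : 0 < 1 :> R[i]).
exists d => // s sd.
have qs1 : `|q s - 1| < 1 by rewrite -{1}q0; apply: Hd; rewrite /ball /= sub0r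
  normrN.
have Re0 : 0 < complex.Re (q s).
  have := le_lt_trans (normc_ge_Re _) qs1; rewrite raddfB ltcR /=.
  by rewrite ltr_norml => /andP[]; rewrite ltrBrDl subrr.
have Im1 : -1 < complex.Im (q s) < 1.
  rewrite -ltr_norml -(@ltr_pXn2r _ 2)// ?nnegrE// expr1n real_normK ?num_real//.
  by rewrite -(ReIm s) ltrDr exprn_gt0.
split=> //; have Im1' : -1 <= complex.Im (q s) <= 1.
  by case/andP: Im1 => /ltW -> /ltW ->.
rewrite /expi /L0 cos_asin// asinK ?in_itv//= -(ReIm s) addrK sqrtr_sqr
  gtr0_norm//.
by case: (q s).
Qed.

(** L(s) = 2^n asin(Im q(s/2^n)) for large n. *)
Let lift : exists L : R -> R, [/\ continuous L, (forall s, expi (L s) = q s)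
  & (forall s, L (s *+ 2) = L s *+ 2)].
Proof.
have [d d0 Hd] := small.
have L0_pi s : `|s| < d -> `|L0 s| <= pi / 2.
  move=> sd; have [/andP[/ltW a /ltW b] _] := Hd s sd.
  by rewrite ler_norml asin_geNpi2 ?asin_lepi2 ?a ?b.
(* Both sides are logarithms of q(2s), so they differ by a multiple of 2 pi; their difference is at
   most pi/2 + pi in absolute value, hence 0. *)
have L02 s : `|s *+ 2| < d -> L0 (s *+ 2) = L0 s *+ 2.
  move=> sd; have sd' : `|s| < d.
    by apply: le_lt_trans sd; rewrite normrMn mulr2n lerDl.
  have [_ e1] := Hd _ sd; have [_ e2] := Hd _ sd'.
  have /expi_eq1[k kE] : expi (L0 (s *+ 2) - L0 s *+ 2) = 1.
    rewrite expiD expiN expiMn e1 e2 q2 divff// expf_neq0// -normr_eq0 nq.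
    exact: oner_neq0.
  suff k0 : k = 0 by move: kE; rewrite k0 => /eqP; rewrite subr_eq0 => /eqP.
  have p0 : 0 < (pi : R) by exact: pi_gt0.
  have : `|pi *+ 2 *~ k| < pi *+ 2 :> R.
    rewrite -kE; apply: le_lt_trans (ler_normB _ _) _.
    apply: le_lt_trans (lerD (L0_pi _ sd) (_ : _ <= pi)) _.
      by rewrite normrMn; have := L0_pi _ sd'; rewrite ler_pdivlMr// mulr_natr.
    by lra.
  have P0 : 0 < (pi : R) *+ 2 by rewrite mulrn_wgt0.
  rewrite -mulrzl normrM [`|pi *+ 2|](ger0_norm (ltW P0)) gtr_pMl//.
  rewrite ltr_norml => /andP[k1 k2].
  have {}k1 : ((-1)%:~R : R) < k%:~R by [].
  have {}k2 : k%:~R < (1%:~R : R) by [].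
  by move: k1 k2; rewrite !ltr_int; lia.
have n_ex s : exists n : nat, `|s / 2 ^+ n| < d.
  exists (Num.trunc (`|s| / d)).+1; rewrite normrM normfV normrX normr_nat.
  rewrite ltr_pdivrMr ?exprn_gt0// mulrC -ltr_pdivrMr//.
  apply: lt_trans (truncnS_gt _) _; rewrite -natrX ltr_nat; exact: ltn_expl.
have n_mono s n m : (n <= m)%N -> `|s / 2 ^+ n| < d -> `|s / 2 ^+ m| < d.
  move=> nm; apply: le_lt_trans; rewrite !normrM ler_wpM2l// !normfV !normrX
    normr_nat.
  by rewrite lef_pV2 ?posrE ?exprn_gt0// ler_eXn2l// ltr1n.
have L0n s n m : (n <= m)%N -> `|s / 2 ^+ n| < d ->
    L0 (s / 2 ^+ m) * 2 ^+ m = L0 (s / 2 ^+ n) * 2 ^+ n.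
  move=> nm sn; rewrite -(subnKC nm); elim: (m - n)%N => [|k IH]; first by
    rewrite addn0.
  rewrite -IH addnS; set y := s / 2 ^+ (n + k).+1.
  have y2 : s / 2 ^+ (n + k) = y *+ 2.
    by rewrite /y exprS -mulr_natr; field; rewrite expf_neq0.
  have yd : `|y *+ 2| < d by rewrite -y2; apply: n_mono sn; exact: leq_addr.
  by rewrite y2 L02// exprS mulrA mulr_natr.
have [N HN] := choice n_ex.
pose L s := L0 (s / 2 ^+ N s) * 2 ^+ N s.
have LE s n : `|s / 2 ^+ n| < d -> L s = L0 (s / 2 ^+ n) * 2 ^+ n.
  move=> sn; rewrite /L -(@L0n s (N s) (maxn (N s) n)) ?leq_maxl//.
  by rewrite (@L0n s n) ?leq_maxr.
exists L; split=> [t|s|s].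
(* [N] was obtained by choice and need not be continuous, but by [LE] the exponent [N t] computes L
   on a whole neighbourhood of t. *)
- have Lt := LE t (N t) (HN t).
  have divc : continuous (fun s : R => s / 2 ^+ N t).
    exact: mulrr_continuous.
  have near1 : \forall s \near t, `|s / 2 ^+ N t| < d.
    have /cvgrPdist_lt/(_ (d - `|t / 2 ^+ N t|)) := divc t.
    rewrite subr_gt0 => /(_ (HN t)); apply: filterS => s hs.
    rewrite distrC in hs; have := le_lt_trans (lerB_dist _ _) hs.
    by rewrite ltrBlDr subrK.
  rewrite /prop_for /continuous_at Lt.
  have cg : (fun s => L0 (s / 2 ^+ N t) * 2 ^+ N t) @ t --> L0 (t / 2 ^+ N t) *
    2 ^+ N t.
    apply: cvgMr_tmp; apply: (@continuous_comp _ _ _ (fun s => s / 2 ^+ N t)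
      L0); first exact: divc.
    apply: (@continuous_comp _ _ _ (fun s => complex.Im (q s)) asin); first
      exact: Imq_continuous.
    by apply: continuous_asin; have [] := Hd _ (HN t).
  apply: cvg_trans cg; apply: near_eq_cvg.
  by apply: filterS near1 => s /LE ->.
- have [_ e1] := Hd _ (HN s).
  have qX y n : q (y *+ 2 ^ n) = q y ^+ (2 ^ n).
    by elim: n => [|n IH]; rewrite ?mulr1n ?expr1// expnSr mulrnA q2 IH -exprM.
  have -> : L s = L0 (s / 2 ^+ N s) *+ 2 ^ N s by rewrite /L -[_ *+ (2 ^ N
    s)]mulr_natr natrX.
  rewrite expiMn e1 -qX; congr q.
  by rewrite -[_ *+ (2 ^ N s)]mulr_natr natrX mulfVK// expf_neq0.
- have sE : s *+ 2 / 2 ^+ (N s).+1 = s / 2 ^+ N s.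
    by rewrite exprS -[s *+ 2]mulr_natr; field; rewrite expf_neq0.
  rewrite (LE _ (N s).+1) sE; last exact: HN.
  by rewrite /L exprSr mulrA mulr_natr.
Qed.

(** The function L(s) - d s is periodic and bounded and it commutes with
    doubling, hence vanishes. *)
Lemma doubling_power : exists d : int, forall z, `|z| = 1 -> h z = z ^ d.
Proof.
have [L [Lc Le L2]] := lift.
pose P : R := pi *+ 2; have P0 : 0 < P by rewrite /P mulrn_wgt0// pi_gt0.
have D_int s : exists k : int, L (s + P) - L s = P *~ k.
  apply: expi_eq1; rewrite expiD expiN !Le /q -[s + P]/(s + P *~ 1) expi_period
    divff//.
  by rewrite -normr_eq0 nq oner_neq0.
clearbody P.
have D_const s t : L (s + P) - L s = L (t + P) - L t.
  move: s t; apply: locally_constant => t.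
  have Dc : (fun s => L (s + P) - L s) @ t --> L (t + P) - L t.
    apply: cvgB; last exact: Lc.
    apply: (@continuous_comp _ _ _ (fun s => s + P) L); last exact: Lc.
    by apply: cvgD; [exact: cvg_id|exact: cvg_cst].
  have /cvgrPdist_lt/(_ P P0) := Dc; apply: filterS => s.
  have [k ->] := D_int s; have [l ->] := D_int t.
  rewrite -mulrzBr -mulrzl normrM (ger0_norm (ltW P0)) gtr_pMl//.
  rewrite ltr_norml => /andP[k1 k2].
  have {}k1 : ((-1)%:~R : R) < (l - k)%:~R by [].
  have {}k2 : (l - k)%:~R < (1%:~R : R) by [].
  by congr (_ *~ _); move: k1 k2; rewrite !ltr_int; lia.
(* d is the winding number of h. *)
have [d dE] := D_int 0.
have LP s : L (s + P) = L s + P *~ d by rewrite -dE (D_const 0 s) [RHS]addrC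
  subrK.
pose p s := L s - s *~ d.
have pP s : p (s + P) = p s by rewrite /p LP mulrzDl opprD addrACA subrr addr0.
have p2 s : p (s *+ 2) = p s *+ 2.
  by rewrite /p L2 mulrnBl -[_ *+ 2 *~ d]mulrzl -[s *~ d]mulrzl mulrnAr.
have pPz s (k : int) : p (s + P *~ k) = p s.
  elim/int_rect: k => [|n IH|n IH]; first by rewrite mulr0z addr0.
    have -> : n.+1%:Z = n%:Z + 1 by lia.
    by rewrite mulrzDr addrA pP.
  rewrite -IH; have -> : - n%:Z = - n.+1%:Z + 1 by lia.
  by rewrite mulrzDr addrA pP.
have pc : continuous p.
  have dc : continuous (fun s : R => s *~ d).
    have -> : (fun s : R => s *~ d) = (fun s => d%:~R * s).
      by apply/funext => t; rewrite mulrzl.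
    exact: mulrl_continuous.
  by move=> s; apply: cvgB; [exact: Lc|exact: dc].
have [c _ cB] : exists2 c, c \in `[0, P] & forall t, t \in `[0, P] -> `|p t| <=
  `|p c|.
  apply: (@EVT_max _ (fun s => `|p s|)); first exact: ltW.
  by apply: continuous_subspaceT => s; apply: (@continuous_comp _ _ _ p (fun x
    => `|x|)); [exact: pc|exact: norm_continuous].
have pB s : `|p s| <= `|p c|.
  rewrite -(pPz s (- Num.floor (s / P))); apply: cB.
  have k1 : (Num.floor (s / P))%:~R * P <= s by rewrite -ler_pdivlMr// ge_floor.
  have k2 : s < (Num.floor (s / P))%:~R * P + P.
    rewrite -[X in _ + X]mul1r -mulrDl -ltr_pdivrMr//.
    by have := floorD1_gt (s / P); rewrite intrD.
  rewrite in_itv /= mulrNz -[P *~ _]mulrzl.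
  by apply/andP; split; lra.
have p0 s : p s = 0.
  have pX n t : p (t *+ 2 ^ n) = p t *+ 2 ^ n.
    by elim: n => [|n IH]; rewrite ?mulr1n// expnSr !mulrnA p2 IH.
  apply/eqP/negPn/negP => ps.
  have ps0 : 0 < `|p s| by rewrite normr_gt0.
  pose n := (Num.trunc (`|p c| / `|p s|)).+1.
  have := pB (s *+ 2 ^ n); rewrite pX normrMn -mulr_natl -ler_pdivlMr//.
  rewrite leNgt => /negP; apply; apply: lt_le_trans (truncnS_gt _) _.
  by rewrite ler_nat -/n ltnW// ltn_expl.
exists d => z /expi_surj[t ->].
have /eqP := p0 t; rewrite subr_eq0 => /eqP Lt.
by rewrite -[LHS]/(q t) -Le Lt expiMz.
Qed.

(** The power map z |-> z^d is constant for d = 0, and otherwise sends a primitive root of unity of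
    order |d| to 1; injectivity leaves |d| = 1. *)
Lemma doubling_injective :
  (forall z w, `|z| = 1 -> `|w| = 1 -> h z = h w -> z = w) ->
  (forall z, `|z| = 1 -> h z = z) \/ (forall z, `|z| = 1 -> h z = z^-1).
Proof.
move=> hI; have [d dE] := doubling_power.
have d0 : d != 0.
  apply/eqP => d0; have := hI 1 (-1) (normr1 _).
  rewrite normrN normr1 !dE ?normrN ?normr1// d0 !expr0z => /(_ erefl erefl)/eqP.
  by rewrite -subr_eq0 opprK (eqr_nat _ 2 0).
have [K dK] : exists K, absz d = K.+1 by exists (absz d).-1; lia.
have : expi (pi *+ 2 / K.+1%:R) = 1 :> R[i].
  apply: hI; [exact: norm_expi|exact: normr1|].
  rewrite (dE _ (norm_expi _)) (dE _ (normr1 _)) exp1rz.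
  have X1 : expi (pi *+ 2 / K.+1%:R) ^+ K.+1 = 1 :> R[i].
    by rewrite -expiMn -[_ *+ K.+1]mulr_natr mulfVK ?pnatr_eq0// expi_2pi.
  have [->|->] : d = K.+1%:Z \/ d = - K.+1%:Z by lia.
    exact: X1.
  by rewrite -invr_expz -exprnP X1 invr1.
rewrite -[X in X = _]expr1z => /expi_root_eq1[k kK].
have /esym/eqP := congr1 absz kK; rewrite abszM muln_eq1 => /andP[_ /eqP K1].
have [d1|d1] : d = 1 \/ d = -1 by lia.
  by left=> z nz; rewrite dE// d1 expr1z.
by right=> z nz; rewrite dE// d1 -invr_expz expr1z.
Qed.

End Doubling.
End CircleMaps.

(** * Rigidity of intertwiners and automorphisms *)

Lemma star_morphism_preimage (R : realType) (A B : cstarAlgType R) (f : A -> B)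
    (D : set B) : star_morphism f -> cstar_subalgebra D ->
  cstar_subalgebra (f @^-1` D).
Proof.
move=> fm [cD [D0 Dl] DM Ds]; have fC := star_morphism_bounded fm.
case: fm => fl f1 fM fs.
have f0 : f 0 = 0 by have := fl (-1) 0 0; rewrite !scaleN1r !addNr.
split=> [|||x Dx] /=.
- apply: (@closed_preimage _ A B f 2) => // x y.
  have -> : f x - f y = f (x - y); last exact: fC.
  by rewrite [x - y]addrC -[- y]scaleN1r fl scaleN1r addrC.
- split=> [|c x y Dx Dy] /=; first by rewrite f0.
  by rewrite fl; exact: Dl.
- by move=> x y Dx Dy /=; rewrite fM; exact: DM.
- by rewrite fs; exact: Ds.
Qed.

Lemma star_morphism_gen (R : realType) (A B : cstarAlgType R) (f : A -> B)
    (S : set A) (D : set B) : star_morphism f -> cstar_subalgebra D ->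
  (forall x, S x -> D (f x)) -> forall x, cstar_gen S x -> D (f x).
Proof.
by move=> fm hD SD; apply: cstar_gen_min => //; exact: star_morphism_preimage.
Qed.

Lemma star_morphism_upow (R : realType) (A B : cstarAlgType R) (f : A -> B) u i :
  star_morphism f -> f (upow u i) = upow (f u) i.
Proof.
move=> [_ f1 fM fs].
have fX x n : f (x ^+ n) = f x ^+ n.
  by elim: n => [|n IH]; rewrite ?expr0// !exprS fM IH.
by case: i => n; rewrite /upow fX ?fs.
Qed.

Section Automorphisms.
Variables (R : realType) (A : cstarAlgType R) (u s2 : A).
Hypothesis hQ2 : is_Q2 u s2.
Variables (H : completeNormedModType R[i]) (ip : H -> H -> R[i]) (e : int -> H).
Hypotheses (hip : is_inner_product ip) (he : orthonormal_basis ip e).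
Variable rho : A -> {linear H -> H}.
Hypothesis hrho : canonical_representation u s2 ip e rho.
Local Notation up := (upow u).
Local Notation st := (state ip e rho).
Local Notation Cu := (cstar_gen [set u]).
Implicit Types (z : R[i]) (a b x X : A).

Let rel : Q2_relations u s2. Proof. by case: hQ2. Qed.
Let uu : unitary u. Proof. by case: rel. Qed.
Let hCu : cstar_subalgebra Cu. Proof. exact: cstar_gen_subalgebra. Qed.

Lemma state_unitary z x : `|z| = 1 -> Cu x -> unitary x -> `|st z x| = 1.
Proof.
move=> nz Cx [x1 _]; apply/eqP; rewrite -(@eqrXn2 _ 2)// expr1n normCK.
by rewrite -(state_star hQ2 hip he hrho)// -(stateMl hQ2 hip he hrho)// x1
  (state1 hQ2 hip he hrho).
Qed.

Lemma state_upow_unitary z x i : `|z| = 1 -> Cu x -> unitary x ->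
  st z (upow x i) = st z x ^ i.
Proof.
move=> nz Cx ux; have x0 : st z x != 0.
  by rewrite -normr_eq0 state_unitary// oner_neq0.
have Cxs := subalgebraS hCu Cx.
elim/int_rect: i => [|n IH|n IH]; first by rewrite upow0 (state1 hQ2 hip he hrho).
  have -> : n.+1%:Z = 1 + n%:Z by lia.
  by rewrite upowS// (stateMl hQ2 hip he hrho)// IH expfzDr// expr1z.
have -> : - n.+1%:Z = -1 + - n%:Z by lia.
rewrite upowP// (stateMl hQ2 hip he hrho)// IH expfzDr// -[_ ^ (-1)]invr_expz
  expr1z.
by rewrite (state_star hQ2 hip he hrho)// invC_norm state_unitary// expr1n
  invr1 mul1r.
Qed.

(** Bounded linear functionals on C*(u) are compared on powers of u. Since f need not be invertible,
    this covers the canonical endomorphism as well as automorphisms. *)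
Lemma state_transport (f : A -> A) z x : star_morphism f -> Cu (f u) ->
  `|z| = 1 -> Cu x -> st z (f x) = st (st z (f u)) x.
Proof.
move=> fm Cfu nz; have fC := star_morphism_bounded fm.
have ufu : unitary (f u).
  by case: (fm) => _ f1 fM fs; case: uu => u1 u2; split; rewrite -fs -fM ?u1 ?u2.
have nw : `|st z (f u)| = 1 by exact: state_unitary.
apply: (circle_functional_eq uu (C := 4) (f := fun x => st z (f x))
  (g := fun x => st (st z (f u)) x)) => [||||a|i].
- by [].
- by case: (fm) => fl _ _ _ c a b; rewrite fl (state_lin hQ2 hip he hrho nz).
- by move=> c a b; rewrite (state_lin hQ2 hip he hrho nw).
- move=> a; apply: le_trans (state_le hQ2 hip he hrho nz _) _.
  by have := fC a; rewrite -(@ler_pM2l _ 2)// mulrA -natrM.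
- apply: le_trans (state_le hQ2 hip he hrho nw _) _.
  by rewrite ler_wpM2r// ler_nat.
- rewrite (star_morphism_upow _ _ fm) state_upow_unitary//.
  by rewrite (state_u hQ2 hip he hrho).
Qed.

Lemma state_separating x y : Cu x -> Cu y ->
  (forall z, `|z| = 1 -> st z x = st z y) -> x = y.
Proof.
move=> Cx Cy xy; apply/eqP; rewrite -subr_eq0; apply/eqP.
apply: (state_separates hQ2 hip he hrho) => [|t].
  by apply: (subalgebraD hCu) => //; exact: (subalgebraN hCu).
by rewrite (stateB hQ2 hip he hrho) ?norm_expi// xy ?subrr// norm_expi.
Qed.

(** The bound N does not depend on the point of the circle. *)
Lemma monomial_support t (x : A) (d : R[i]) : 0 < d ->
  exists N : nat, forall th, d <= `|st (expi th) (t * x)| ->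
    exists i m n j, [/\ (m <= N)%N, (n <= N)%N &
      st (expi th) (t * monomial u s2 i m n j) != 0].
Proof.
pose P := [set x : A | forall d : R[i], 0 < d -> exists N : nat,
  forall th, d <= `|st (expi th) (t * x)| ->
    exists i m n j, [/\ (m <= N)%N, (n <= N)%N &
      st (expi th) (t * monomial u s2 i m n j) != 0]].
suff : cspan [set x | exists i m n j, x = monomial u s2 i m n j] `<=` P.
  by rewrite (Q2_dense rel hQ2) => /(_ x I d).
have stl s := state_lin hQ2 hip he hrho (norm_expi s).
have stC s := state_le hQ2 hip he hrho (norm_expi s).
apply: cspan_min; last first.
  move=> _ [i [m [n [j ->]]]] {}d d0; exists (maxn m n) => th dth.
  exists i, m, n, j; split; rewrite ?leq_maxl ?leq_maxr//.
  by rewrite -normr_gt0; exact: lt_le_trans dth.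
split; first apply/closed_approxP.
  move=> a aP {}d d0; have d2 : 0 < d / 2 by rewrite divr_gt0.
  have C0 : 0 < 1 + 2 * `|t| by rewrite ltr_pwDl// mulr_ge0.
  have [b /(_ _ d2)[N HN] ab] := aP (d / 2 / (1 + 2 * `|t|)) (divr_gt0 d2 C0).
  exists N => th dth; apply: HN.
  have E : st (expi th) (t * a) = st (expi th) (t * (a - b)) + st (expi th) (t
    * b).
    by rewrite -(stateD hQ2 hip he hrho) ?norm_expi// -mulrDr subrK.
  have small : `|st (expi th) (t * (a - b))| <= d / 2.
    apply: le_trans (stC _ _) _; apply: le_trans (_ : 2 * (`|t| * `|a - b|) <= _).
      by rewrite ler_pM2l//; exact: normM_le.
    move: (ltW ab); rewrite ler_pdivlMr// mulrC => /(le_trans _); apply.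
    by rewrite mulrA ler_wpM2r// lerDr.
  move: dth; rewrite E => /le_trans/(_ (ler_normD _ _)).
  by rewrite {1}(splitr d) => dd; move: (lerB dd small); rewrite addrK addrAC
    subrr add0r.
split=> [{}d d0|c a b aP bP {}d d0].
  exists 0%N => th; rewrite mulr0 (state0 hQ2 hip he hrho) ?norm_expi// normr0.
  by move=> /(lt_le_trans d0); rewrite ltxx.
have d2 : 0 < d / 2 by rewrite divr_gt0.
have c0 : 0 < 1 + `|c| by rewrite ltr_pwDl.
have [N HN] := aP _ (divr_gt0 d2 c0); have [M HM] := bP _ d2.
exists (maxn N M) => th; rewrite mulrDr -scalerAr stl => dth.
(* One of the two summands has absolute value at least d / 2; in the second case the factor c is
   absorbed by the threshold d / 2 / (1 + |c|). *)
have [le|lt] := real_leP (ger0_real (ltW d2)) (normr_real (st (expi th) (t * b))).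
  have [i [m [n [j [mM nM Hm]]]]] := HM th le.
  by exists i, m, n, j; split; rewrite ?leq_max ?mM ?nM ?orbT.
have [//|i [m [n [j [mN nN Hm]]]]] := HN th.
  rewrite ler_pdivrMr//; apply: le_trans (_ : `|st (expi th) (t * a)| * `|c| <=
    _); last first.
    by rewrite ler_wpM2l// lerDr.
  move: dth => /le_trans/(_ (ler_normD _ _)); rewrite normrM mulrC {1}(splitr
    d) => dd.
  by move: (lerB dd (ltW lt)); rewrite addrK addrK.
by exists i, m, n, j; split; rewrite ?leq_max ?mN ?nN.
Qed.

(** In the monomial, s_2^*n turns u^(2^n) on its right into u on its left, s_2^m turns this u into
    u^(2^m), and t turns it into X^(2^m). Where the state of t times the monomial is nonzero, this
    gives E_z(X)^(2^m) = z^(2^n). *)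
Lemma intertwiner_monomial t X i m n j : t * u = X * t ->
  t * monomial u s2 i m n j * u ^+ (2 ^ n) =
  X ^+ (2 ^ m) * (t * monomial u s2 i m n j).
Proof.
move=> tX.
have tXk k : t * u ^+ k = X ^+ k * t.
  elim: k => [|k IH]; first by rewrite !expr0 mul1r mulr1.
  by rewrite exprSr mulrA IH -mulrA tX mulrA -exprSr.
have mu : monomial u s2 i m n j * up (2 ^+ n) = up (2 ^+ m) * monomial u s2 i m
  n j.
  have e1 : star s2 ^+ n * up (2 ^+ n) = up 1 * star s2 ^+ n.
    by rewrite (upow_s2sX rel) mulr1.
  have e2 : s2 ^+ m * up 1 = up (2 ^+ m) * s2 ^+ m by rewrite (s2X_upow rel)
    mulr1.
  rewrite /monomial -mulrA -upowD// addrC upowD// mulrA -(mulrA _ (star s2 ^+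
    n)) e1.
  rewrite mulrA -(mulrA _ (s2 ^+ m)) e2 !mulrA -!upowD//.
  by rewrite addrC.
have twoX k : (2 : int) ^+ k = (2 ^ k)%N by rewrite -natz natrX.
rewrite [RHS]mulrA -tXk -[u ^+ (2 ^ n)]/(up (2 ^ n)%N) -[u ^+ (2 ^ m)]/(up (2 ^
  m)%N).
by rewrite -!twoX -mulrA mu mulrA.
Qed.

End Automorphisms.

(** * Circle homeomorphisms conjugating squaring into a map with a power relation *)

Section CircleConjugacy.
Variable R : realType.
Implicit Types (s t : R) (z w : R[i]).

Definition unimodular_path (a : R -> R[i]) := (forall s, `|a s| = 1) /\
  forall t (d : R[i]), 0 < d -> \forall s \near t, `|a s - a t| < d.

Lemma unimodular_pathM a b : unimodular_path a -> unimodular_path b ->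
  unimodular_path (fun s => a s * b s).
Proof.
move=> [na ca] [nb cb]; split=> [s|t d d0]; first by rewrite normrM na nb mulr1.
have d2 : 0 < d / 2 by rewrite divr_gt0.
apply: filterS2 (ca t _ d2) (cb t _ d2) => s ha hb.
have -> : a s * b s - a t * b t = (a s - a t) * b s + a t * (b s - b t) by ring.
apply: le_lt_trans (ler_normD _ _) _.
by rewrite !normrM na nb mulr1 mul1r (splitr d) ltrD.
Qed.

Lemma unimodular_pathV a : unimodular_path a -> unimodular_path (fun s => (a
  s)^-1).
Proof.
move=> [na ca]; split=> [s|t d d0]; first by rewrite normfV na invr1.
have a0 s : a s != 0 by rewrite -normr_eq0 na oner_neq0.
apply: filterS (ca t _ d0) => s.
have -> : (a s)^-1 - (a t)^-1 = (a t - a s) / (a s * a t).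
  by field; rewrite !a0.
by rewrite normrM normfV normrM !na mulr1 invr1 mulr1 distrC.
Qed.

Lemma unimodular_pathX a n : unimodular_path a -> unimodular_path (fun s => a s
  ^+ n).
Proof.
move=> ua; elim: n => [|n IH].
  split=> [s|t d d0]; first by rewrite normr1.
  by apply: filterS filterT => s _; rewrite subrr normr0.
have -> : (fun s => a s ^+ n.+1) = (fun s => a s * a s ^+ n).
  by apply/funext => s; rewrite exprS.
exact: unimodular_pathM.
Qed.

Lemma unimodular_expi : unimodular_path (@expi R).
Proof. by split; [exact: norm_expi|exact: expi_continuous]. Qed.

Variables f g F : R[i] -> R[i].
Hypothesis nf : forall z, `|z| = 1 -> `|f z| = 1.
Hypothesis ng : forall z, `|z| = 1 -> `|g z| = 1.
Hypothesis gf : forall z, `|z| = 1 -> g (f z) = z.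
Hypothesis fg : forall z, `|z| = 1 -> f (g z) = z.
Hypothesis FE : forall z, `|z| = 1 -> F z = g (f z ^+ 2).
Hypothesis fc : forall t (d : R[i]), 0 < d ->
  \forall s \near t, `|f (expi s) - f (expi t)| < d.
Hypothesis Fc : forall t (d : R[i]), 0 < d ->
  \forall s \near t, `|F (expi s) - F (expi t)| < d.
Variables N k : nat.
Hypothesis hF : forall s, F (expi s) ^+ (2 ^ N) = expi s ^+ (2 ^ k).

Let n2 z : `|z| = 1 -> `|z ^+ 2| = 1. Proof. by move=> nz; rewrite normrX nz
  expr1n. Qed.
Let nF z : `|z| = 1 -> `|F z| = 1. Proof. by move=> nz; rewrite FE ?ng ?n2 ?nf.
  Qed.
Let neq01 z : `|z| = 1 -> z != 0. Proof. by move=> nz; rewrite -normr_eq0 nz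
  oner_neq0. Qed.

Let f_inj z w : `|z| = 1 -> `|w| = 1 -> f z = f w -> z = w.
Proof. by move=> nz nw /(congr1 g); rewrite !gf. Qed.

Let F_eq z w : `|z| = 1 -> `|w| = 1 -> F z = F w -> f z = f w \/ f z = - f w.
Proof.
move=> nz nw; rewrite !FE// => /(congr1 f); rewrite !fg ?n2 ?nf// => /eqP.
by rewrite eqf_sqr => /orP[] /eqP; [left|right].
Qed.

Let F_not_inj : ~ (forall z w, `|z| = 1 -> `|w| = 1 -> F z = F w -> z = w).
Proof.
have nN1 : `|-1 : R[i]| = 1 by rewrite normrN normr1.
move=> /(_ (g 1) (g (-1)) (ng (normr1 _)) (ng nN1)).
rewrite !FE ?ng ?normr1// !fg ?normr1// sqrrN => /(_ erefl)/(congr1 f).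
rewrite !fg ?normr1// => /eqP.
by rewrite -subr_eq0 opprK (eqr_nat _ 2 0).
Qed.

Let F_path : unimodular_path (fun s => F (expi s)).
Proof. by split=> // s; apply/nF/norm_expi. Qed.

(** F is two-to-one: otherwise it would be injective, or F 1 = F 'i = F (-1). *)
Lemma conjugacy_square : exists2 zeta : R[i], `|zeta| = 1 /\ zeta ^+ (2 ^ N) = 1 &
  forall z, `|z| = 1 -> F z = zeta * z ^+ 2.
Proof.
have [kN|Nk] := ltnP k N.
  exfalso; apply: F_not_inj => z w nz nw Fzw.
  (* For k < N this is a root of unity of order dividing 2^k, hence constant; then F(z) determines z
     and F would be injective. *)
  pose q s := F (expi s) ^+ (2 ^ (N - k)) * (expi s)^-1.
  have uq : unimodular_path q.
    by apply: unimodular_pathM; [exact: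
      unimodular_pathX|exact/unimodular_pathV/unimodular_expi].
  have qc : forall s t, q s = q t.
    apply: (@root2_constant _ k q uq.1 _ uq.2) => s.
    rewrite /q exprMn -exprM -expnD subnK ?(ltnW kN)// hF exprVn divff//.
    by rewrite expf_neq0// expi_neq0.
  have [s sz] := expi_surj nz; have [t tw] := expi_surj nw.
  apply: invr_inj; have := qc s t; rewrite /q -sz -tw Fzw => /mulfI; apply.
  by rewrite expf_neq0// neq01// nF.
pose e := (k - N)%N.
(* Now q takes values in the roots of unity of order dividing 2^N, so F is a constant zeta times the
   power 2^e, and it remains to exclude e = 0 and e >= 2. *)
pose q s := F (expi s) * (expi s ^+ (2 ^ e))^-1.
have uq : unimodular_path q.
  apply: unimodular_pathM F_path _; apply: unimodular_pathV.
  exact/unimodular_pathX/unimodular_expi.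
have qc : forall s t, q s = q t.
  apply: (@root2_constant _ N q uq.1 _ uq.2) => s.
  rewrite /q exprMn exprVn -exprM -expnD subnK// hF divff//.
  by rewrite expf_neq0// expi_neq0.
pose zeta := F 1; have nzeta : `|zeta| = 1 by apply: nF; exact: normr1.
have Fz z : `|z| = 1 -> F z = zeta * z ^+ (2 ^ e).
  move=> nz; have [s sz] := expi_surj nz.
  have := qc s 0; rewrite /q expi0 expr1n invr1 mulr1 -sz -/zeta => <-.
  by rewrite mulfVK// expf_neq0// neq01.
exists zeta => [|z nz].
  by split=> //; rewrite /zeta -(expi0 R) hF expi0 expr1n.
suff e1 : e = 1%N by rewrite Fz// e1.
case ee : e => [|[|e']] //; exfalso.
  apply: F_not_inj => z' w nz' nw; rewrite !Fz// ee !expr1.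
  exact/mulfI/neq01.
have ni : `|'i : R[i]| = 1 by exact: normCi.
have nN1 : `|-1 : R[i]| = 1 by rewrite normrN normr1.
have i4 : ('i : R[i]) ^+ (2 ^ e) = 1.
  by rewrite ee !expnS mulnA exprM (exprM _ 2 2) sqrCi sqrrN !expr1n.
have N14 : (-1 : R[i]) ^+ (2 ^ e) = 1.
  by rewrite ee expnS exprM sqrrN !expr1n.
have F1i : F 1 = F 'i by rewrite (Fz _ (normr1 _)) (Fz _ ni) i4 expr1n.
have F1N : F 1 = F (-1) by rewrite (Fz _ (normr1 _)) (Fz _ nN1) N14 expr1n.
have i1 : 1 <> 'i :> R[i].
  move/(congr1 (fun x => x ^+ 2)); rewrite sqrCi expr1n => /eqP.
  by rewrite -subr_eq0 opprK (eqr_nat _ 2 0).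
have iN1 : 'i <> -1 :> R[i].
  move/(congr1 (fun x => x ^+ 2)); rewrite sqrCi sqrrN expr1n => /eqP.
  by rewrite eq_sym -subr_eq0 opprK (eqr_nat _ 2 0).
have N11 : 1 <> -1 :> R[i].
  by move=> /eqP; rewrite -subr_eq0 opprK (eqr_nat _ 2 0).
have [/f_inj h|h1] := F_eq (normr1 _) ni F1i; first exact: (i1 (h (normr1 _) ni)).
have [/f_inj h|h2] := F_eq (normr1 _) nN1 F1N; first exact: (N11 (h (normr1 _)
  nN1)).
by apply: iN1; apply: f_inj => //; apply: oppr_inj; rewrite -h1 -h2.
Qed.

(** The definition of F gives f(F(w)) = f(w)^2. For w = zeta^-1 z one has F(w) = zeta^-1 z^2, so
    h(z) = f(zeta^-1 z) commutes with squaring. According as h is z or z^-1, f(z) is zeta z or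
    zeta^-1 z^-1. *)
Lemma conjugacy_rotation : exists2 xi : R[i],
  `|xi| = 1 /\ (exists n, xi ^+ (2 ^ n) = 1) &
  (forall z, `|z| = 1 -> f z = xi * z) \/ (forall z, `|z| = 1 -> f z = xi * z^-1).
Proof.
have [zeta [nzeta zN] Fz] := conjugacy_square.
have zeta0 := neq01 nzeta.
pose h z := f (zeta^-1 * z).
have nzz z : `|z| = 1 -> `|zeta^-1 * z| = 1.
  by move=> nz; rewrite normrM normfV nzeta nz invr1 mulr1.
have nh z : `|z| = 1 -> `|h z| = 1 by move=> nz; exact/nf/nzz.
have [r rE] : exists r, zeta^-1 = expi r.
  by apply: expi_surj; rewrite normfV nzeta invr1.
have hc t (d : R[i]) : 0 < d -> \forall s \near t, `|h (expi s) - h (expi t)| < d.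
  move=> d0; have rc : continuous (fun s => r + s).
    by move=> s; apply: cvgD; [exact: cvg_cst|exact: cvg_id].
  have hs : \forall s \near t, `|f (expi (r + s)) - f (expi (r + t))| < d.
    exact: rc _ (fc (r + t) d0).
  by apply: filterS hs => s; rewrite /h rE -!expiD.
have h2 z : `|z| = 1 -> h (z ^+ 2) = h z ^+ 2.
  move=> nz; have nw := nzz _ nz.
  have : f (F (zeta^-1 * z)) = h z ^+ 2 by rewrite FE// fg ?n2 ?nf.
  by rewrite Fz// => <-; congr f; field.
have hI z w : `|z| = 1 -> `|w| = 1 -> h z = h w -> z = w.
  move=> nz nw /(f_inj (nzz _ nz) (nzz _ nw)); apply: mulfI.
  by rewrite invr_eq0.
have fh z : f z = h (zeta * z) by rewrite /h mulrA mulVf// mul1r.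
have nzt z : `|z| = 1 -> `|zeta * z| = 1 by move=> nz; rewrite normrM nzeta nz
  mulr1.
have [H|H] := doubling_injective nh hc h2 hI.
  exists zeta; first by split=> //; exists N.
  by left=> z nz; rewrite fh H// nzt.
exists zeta^-1; first by rewrite normfV nzeta invr1; split=> //; exists N;
  rewrite exprVn zN invr1.
by right=> z nz; rewrite fh H ?nzt// invfM.
Qed.

End CircleConjugacy.

(** * Intertwiners of u and automorphisms preserving C*(u) *)

Section Rigidity.
Variables (R : realType) (A : cstarAlgType R) (u s2 : A).
Hypothesis hQ2 : is_Q2 u s2.
Variables (H : completeNormedModType R[i]) (ip : H -> H -> R[i]) (e : int -> H).
Hypotheses (hip : is_inner_product ip) (he : orthonormal_basis ip e).
Variable rho : A -> {linear H -> H}.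
Hypothesis hrho : canonical_representation u s2 ip e rho.
Local Notation up := (upow u).
Local Notation st := (state ip e rho).
Local Notation Cu := (cstar_gen [set u]).
Implicit Types (z : R[i]) (a b x X : A).

Let rel : Q2_relations u s2. Proof. by case: hQ2. Qed.
Let uu : unitary u. Proof. by case: rel. Qed.
Let hCu : cstar_subalgebra Cu. Proof. exact: cstar_gen_subalgebra. Qed.

Lemma circle_X x n : Cu x -> Cu (x ^+ n).
Proof.
move=> Cx; elim: n => [|n IH]; first by have := circle_upow uu 0; rewrite upow0.
by rewrite exprS; exact: (subalgebraM hCu).
Qed.

Lemma stateX z x n : `|z| = 1 -> Cu x -> st z (x ^+ n) = st z x ^+ n.
Proof.
move=> nz Cx; elim: n => [|n IH]; first by rewrite (state1 hQ2 hip he hrho).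
by rewrite !exprS (stateMl hQ2 hip he hrho)// IH.
Qed.

Lemma state_uE z : `|z| = 1 -> st z u = z.
Proof. by move=> nz; rewrite -[u in st z u]upow1 (state_u hQ2 hip he hrho)//
  expr1z. Qed.

Lemma intertwiner_power t X (c : R[i]) : c != 0 -> Cu X -> t * u = X * t ->
  (forall s, st (expi s) (t * star t) = c) ->
  exists N k, forall s, st (expi s) X ^+ (2 ^ N) = expi s ^+ (2 ^ k).
Proof.
move=> c0 CX tX tt; have nc0 : 0 < `|c| by rewrite normr_gt0.
have [N HN] := monomial_support hQ2 hip he hrho t (star t) nc0.
have loc (th : R) : exists k, \forall s \near th,
    st (expi s) X ^+ (2 ^ N) = expi s ^+ (2 ^ k).
  have [|i [m [n [j [mN nN a0]]]]] := HN th; first by rewrite tt.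
  (* Raising to the power 2^(N - m) makes the exponent of E_z(X) the same at all points; only the
     exponent of z is still local. *)
  set a := t * _ in a0; exists (n + (N - m))%N.
  have na0 : 0 < `|st (expi th) a| by rewrite normr_gt0.
  apply: filterS (state_continuous hQ2 hip he hrho a th na0) => s hs.
  have as0 : st (expi s) a != 0.
    by apply/eqP => as0; move: hs; rewrite as0 sub0r normrN ltxx.
  have ns := norm_expi s.
  have := congr1 (st (expi s)) (intertwiner_monomial hQ2 i m n j tX).
  rewrite -/a (stateMr hQ2 hip he hrho)//; last by apply: circle_X; exact:
    circle_u.
  rewrite (stateMl hQ2 hip he hrho)//; last exact: circle_X.
  rewrite !stateX//; last exact: circle_u.
  rewrite state_uE// mulrC => /(mulIf as0) E.
  by rewrite expnD exprM E -exprM -expnD subnKC.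
have [K HK] := choice loc.
have Kc : forall s t : R, K s = K t.
  apply: locally_constant => th.
  (* Near any s close to th the relations with exponents [K th] and [K s] hold together, and
     [expiX_near_inj] identifies the exponents. *)
  have := nbhs_interior (HK th); apply: filterS => s Hs.
  apply: (@expnI 2) => //; apply: (@expiX_near_inj R s).
  by apply: filterS2 Hs (HK s) => s' -> ->.
exists N, (K 0) => s; rewrite (Kc 0 s); exact: (nbhs_singleton (HK s)).
Qed.

(** With X = [star u] the power relation says that z^(2^k + 2^N) = 1 on the whole circle, which is
    impossible for a positive exponent. *)
Lemma u_not_conjugate (w : A) : unitary w -> w * u * star w <> star u.
Proof.
move=> [w1 w2] wu.
have tX : w * u = star u * w by rewrite -wu -mulrA w2 mulr1.
have [|||N [k HNk]] := @intertwiner_power w (star u) 1 _ _ tX.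
- exact: oner_neq0.
- exact: circle_us.
- by move=> s; rewrite w1 (state1 hQ2 hip he hrho) ?norm_expi.
have E s : expi s ^+ (2 ^ k + 2 ^ N) = expi s ^+ 0 :> R[i].
  rewrite exprD -HNk (state_star hQ2 hip he hrho) ?norm_expi// state_uE
    ?norm_expi//.
  by rewrite -exprMn mulrC -normCK norm_expi !expr1n.
have : (2 ^ k + 2 ^ N)%N = 0%N.
  apply: (@expiX_near_inj R 0); apply: filterS filterT => s _; exact: E.
by move/eqP; rewrite addn_eq0 expn_eq0.
Qed.

Section Automorphism.
Variable phi : cstar_aut A.
Hypothesis phiC : subgroup_set (AutPair Cu) phi.

Let fm : star_morphism phi. Proof. exact: aut_morph. Qed.
Let gm : star_morphism (aut_inv phi). Proof. exact: (aut_morph (aut_invg phi)).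
  Qed.

Let phi_Cu x : Cu x -> Cu (phi x).
Proof. by move=> Cx; have E : aut_fun phi @` Cu = Cu := phiC; rewrite -E;
  exists x. Qed.
Let psi_Cu x : Cu x -> Cu (aut_inv phi x).
Proof.
move=> Cx; have E : aut_fun phi @` Cu = Cu := phiC.
have : (aut_fun phi @` Cu) x by rewrite E.
by move=> [y Cy <-]; rewrite aut_funK.
Qed.

Let f z := st z (phi u).
Let g z := st z (aut_inv phi u).
Let Y := canonical_endo u s2.

Let nf z : `|z| = 1 -> `|f z| = 1.
Proof.
move=> nz; apply: (state_unitary hQ2 hip he hrho) => //.
  by apply: phi_Cu; exact: circle_u.
exact: aut_unitary.
Qed.
Let ng z : `|z| = 1 -> `|g z| = 1.
Proof.
move=> nz; apply: (state_unitary hQ2 hip he hrho) => //.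
  by apply: psi_Cu; exact: circle_u.
exact: (aut_unitary (aut_invg phi)).
Qed.

Let gf z : `|z| = 1 -> g (f z) = z.
Proof.
move=> nz; rewrite /g /f -(state_transport hQ2 hip he hrho fm)//.
- by rewrite aut_invK state_uE.
- by apply: phi_Cu; exact: circle_u.
- by apply: psi_Cu; exact: circle_u.
Qed.

Let fg z : `|z| = 1 -> f (g z) = z.
Proof.
move=> nz; rewrite /g /f -(state_transport hQ2 hip he hrho gm)//.
- by rewrite aut_funK state_uE.
- by apply: psi_Cu; exact: circle_u.
- by apply: phi_Cu; exact: circle_u.
Qed.

Let Ym : star_morphism Y. Proof. exact: canonical_endo_morphism. Qed.

Let Y_Cu x : Cu x -> Cu (Y x).
Proof.
apply: (star_morphism_gen Ym hCu) => _ ->.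
by rewrite /Y canonical_endo_u//; apply: (subalgebraM hCu); exact: circle_u.
Qed.

(** This element satisfies [phi s2 * u = X * phi s2], and its values under the states are those of
    F. *)
Let X := phi (Y (aut_inv phi u)).

Let CX : Cu X. Proof. by apply: phi_Cu; apply: Y_Cu; apply: psi_Cu; exact:
  circle_u. Qed.

Let stX z : `|z| = 1 -> st z X = g (f z ^+ 2).
Proof.
move=> nz; have CYg : Cu (Y (aut_inv phi u)) by apply: Y_Cu; apply: psi_Cu;
  exact: circle_u.
have nw := nf nz.
have CYu : Cu (Y u) by apply: Y_Cu; exact: circle_u.
have Cg : Cu (aut_inv phi u) by apply: psi_Cu; exact: circle_u.
have Cfu : Cu (phi u) by apply: phi_Cu; exact: circle_u.
have e1 : st z X = st (f z) (Y (aut_inv phi u)).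
  exact: (state_transport hQ2 hip he hrho fm Cfu nz CYg).
have e2 : st (f z) (Y (aut_inv phi u)) = st (st (f z) (Y u)) (aut_inv phi u).
  exact: (state_transport hQ2 hip he hrho Ym CYu nw Cg).
have e3 : st (f z) (Y u) = f z ^+ 2.
  rewrite /Y (canonical_endo_u rel) (stateMl hQ2 hip he hrho u nw (@circle_u _
    _ u)).
  by rewrite (state_uE nw).
exact: (etrans e1 (etrans e2 (congr1 g e3))).
Qed.

Let power : exists N k, forall s, st (expi s) X ^+ (2 ^ N) = expi s ^+ (2 ^ k).
Proof.
have [_ _ fM fs] := fm; have fD x y : phi (x + y) = phi x + phi y.
  by have [fl _ _ _] := fm; rewrite -{1}(scale1r x) fl scale1r.
have tX : phi s2 * u = X * phi s2.
  have := congr1 phi (canonical_endo_s2 rel (aut_inv phi u)).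
  by rewrite !fM aut_invK => /esym.
apply: (intertwiner_power _ CX tX (c := 2^-1)) => [|s].
  by rewrite invr_eq0 pnatr_eq0.
have ns := norm_expi s; have [_ _ _ sum] := rel.
have C1 := @circle_u _ _ u; have C2 := circle_us uu.
pose p := phi s2 * star (phi s2).
have Cf1 : Cu (phi u) by apply: phi_Cu.
have Cf2 : Cu (star (phi u)) by exact: (subalgebraS hCu).
(* The image under phi of the sum relation. By multiplicativity over C*(u) and |f| = 1, both
   summands have the same state, which is therefore 1/2. *)
have ps : p + phi u * (p * star (phi u)) = 1.
  have [_ f1 _ _] := fm; rewrite -f1 -sum fD !fM !fs /p.
  by rewrite !mulrA.
have : st (expi s) p + f (expi s) * (st (expi s) p * (f (expi s))^*) = 1.
  rewrite /f -(state_star hQ2 hip he hrho ns).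
  rewrite -(stateMr hQ2 hip he hrho p ns Cf2) -(stateMl hQ2 hip he hrho _ ns Cf1).
  by rewrite -(stateD hQ2 hip he hrho ns) ps (state1 hQ2 hip he hrho ns).
rewrite -/p; move: (st _ p) => y.
have nn : f (expi s) * (f (expi s))^* = 1 by rewrite -normCK nf// expr1n.
rewrite mulrCA nn mulr1 => yy.
apply: (mulIf (_ : 2 != 0 :> R[i])); first by rewrite pnatr_eq0.
by rewrite mulVf ?pnatr_eq0// mulr_natr mulr2n.
Qed.

Lemma aut_circle : exists xi : prufer R,
  phi u = (xi : R[i]) *: u \/ phi u = (xi : R[i]) *: star u.
Proof.
have [N [k hN]] := power.
have fc t (d : R[i]) : 0 < d -> \forall s \near t, `|f (expi s) - f (expi t)| < d.
  exact: (state_continuous hQ2 hip he hrho).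
have Xc t (d : R[i]) : 0 < d -> \forall s \near t, `|st (expi s) X - st (expi
  t) X| < d.
  exact: (state_continuous hQ2 hip he hrho).
have [xi hxi fE] := conjugacy_rotation nf ng gf fg stX fc Xc hN.
have Cfu : Cu (phi u) by apply: phi_Cu; exact: circle_u.
exists (Prufer hxi); case: fE => fE; [left|right]; rewrite /=.
  have Cx : Cu (xi *: u) by apply: (subalgebraZ hCu); exact: circle_u.
  apply: (state_separating hQ2 hip he hrho Cfu Cx) => z nz.
  rewrite (stateZ hQ2 hip he hrho nz) (state_uE nz); exact: fE.
have Cx : Cu (xi *: star u) by apply: (subalgebraZ hCu); exact: circle_us.
apply: (state_separating hQ2 hip he hrho Cfu Cx) => z nz.
rewrite (stateZ hQ2 hip he hrho nz) (state_star hQ2 hip he hrho nz).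
by rewrite (state_uE nz) (fE _ nz : st z (phi u) = _) invC_norm nz expr1n invr1
  mul1r.
Qed.
End Automorphism.
End Rigidity.

(** * Weyl groups *)

(** The explicit homomorphism runs from the model H to the quotient group G, where no
    representatives have to be chosen; its inverse comes from the axiom of choice. *)
Lemma morphism_isomorphic (G H : groupType) (m : H -> G) :
  (forall x y, m (x * y)%g = (m x * m y)%g) -> injective m ->
  (forall a, exists x, m x = a) -> isomorphic G H.
Proof.
move=> mM mI mS; have [n nK] := choice mS.
have nm : cancel m n by move=> x; apply: mI; rewrite nK.
have nM : {morph n : a b / (a * b)%g} by move=> a b; apply: mI; rewrite mM !nK.
pose nmix := isMultiplicative.Build G H n nM.
pose N : {multiplicative G -> H} := HB.pack n nmix.
by exists N; exists m.
Qed.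

(** The group law is addition mod 2, so [1%g] is the residue 0 and [1%R] is the non-trivial
    element. *)
Lemma Z2_cases (k : 'Z_2) : k = 1%g \/ (k != 1%g /\ k = 1%R).
Proof. by case: k => [[|[|k]] kP] //; [left|right; split=> //]; exact: val_inj.
  Qed.

Section WeylGroups.
Variables (R : realType) (A : cstarAlgType R) (u s2 : A).
Hypothesis hQ2 : is_Q2 u s2.
Variables (H : completeNormedModType R[i]) (ip : H -> H -> R[i]) (e : int -> H).
Hypotheses (hip : is_inner_product ip) (he : orthonormal_basis ip e).
Variable rho : A -> {linear H -> H}.
Hypothesis hrho : canonical_representation u s2 ip e rho.
Local Notation Cu := (cstar_gen [set u]).
Local Notation G := (subgroup_type (AutPair Cu)).

Let rel : Q2_relations u s2. Proof. by case: hQ2. Qed.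
Let uu : unitary u. Proof. by case: rel. Qed.
Let hCu : cstar_subalgebra Cu. Proof. exact: cstar_gen_subalgebra. Qed.

Lemma AutPairP (phi : cstar_aut A) : Cu (phi u) -> Cu (aut_inv phi u) ->
  subgroup_set (AutPair Cu) phi.
Proof.
move=> Cp Cq; rewrite /= /stab_set /=; apply/seteqP; split=> [_ [x Cx <-]|x Cx].
  by apply: (star_morphism_gen (aut_morph phi) hCu _ Cx) => _ ->.
exists (aut_inv phi x); last exact: aut_invK.
by apply: (star_morphism_gen (aut_morph (aut_invg phi)) hCu _ Cx) => _ ->.
Qed.

Lemma AutFixP (phi : cstar_aut A) : subgroup_set (AutFix Cu) phi <-> phi u = u.
Proof.
split=> [|pu]; first by apply; exact: circle_u.
have pm := aut_morph phi; have pC := star_morphism_bounded pm.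
apply: (circle_ind uu) => [|i]; last by rewrite (star_morphism_upow _ _ pm) pu.
have [pl _ _ _] := pm; have p0 : phi 0 = 0.
  by have := pl (-1) 0 0; rewrite !scaleN1r !addNr.
split.
  apply: (@closed_equalizer _ A A phi id 2) => // x y; last by rewrite
    ler_peMl// ler1n.
  have -> : phi x - phi y = phi (x - y); last exact: pC.
  by rewrite [x - y]addrC -[- y]scaleN1r pl scaleN1r addrC.
by split=> [|c x y px py] /=; rewrite ?p0// pl px py.
Qed.

Lemma flip_flop_exists : exists sigma : G, is_flip_flop u s2 (sgval sigma).
Proof.
have [u1 u2] := uu; have [_ univ] := hQ2.
have [f [[fm fu fs] _]] := univ A _ _ (Q2_relations_flip rel).
have [g [_ gU]] := univ A _ _ rel.
have [fl f1 fM fst] := fm.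
(* f o f fixes both generators, so it is the identity by the uniqueness in the universal
   property. *)
have fK : cancel f f.
  move=> x; rewrite -[LHS]/((f \o f) x) -[RHS]/(id x); congr (_ x).
  rewrite -(gU id); last by split.
  apply/esym/gU; split; last by rewrite /= fs fM fu fs mulrA u2 mul1r.
    by split=> [c y z||y z|y] /=; rewrite ?fl ?f1 ?fM ?fst.
  by rewrite /= fu fst fu starK.
pose s := CStarAut fm fK fK.
have Cs : subgroup_set (AutPair Cu) s by apply: AutPairP; rewrite /= fu; exact:
  circle_us.
exists (SubgroupType Cs); split=> //=.
by rewrite fM fu fs mulrA u2 mul1r.
Qed.

Lemma diagonal_aut_exists (xi : prufer R) : exists alpha : G,
  (exists (w : A) (hw : unitary w),
     (forall k : int, rho w (e k) = ((xi : R[i]) ^ k) *: e k) /\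
     sgval alpha = Ad hw) /\ sgval alpha u = (xi : R[i]) *: u.
Proof.
have [nxi [n xin]] := pruferP xi.
have xi0 := prufer_neq0 xi.
have [w hw] := diagonal_exists hQ2 hip he hrho nxi xin.
have uw := diagonal_unitary hip he hrho nxi hw.
have wu : Ad uw u = (xi : R[i]) *: u.
  rewrite /= (diagonal_commute hip he hrho xi0 hw) -scalerAl -mulrA.
  by case: uw => -> _; rewrite mulr1.
have wv : aut_inv (Ad uw) u = (xi : R[i])^-1 *: u.
  apply: (can_inj (aut_funK (Ad uw))); rewrite aut_invK.
  have [fl _ _ _] := aut_morph (Ad uw).
  have f0 : Ad uw 0 = 0 by rewrite /= mulr0 mul0r.
  by rewrite -[_ *: u]addr0 fl f0 addr0 wu scalerA mulVf// scale1r.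
have CA : subgroup_set (AutPair Cu) (Ad uw).
  by apply: AutPairP; rewrite ?wu ?wv; apply: (subalgebraZ hCu); exact: circle_u.
by exists (SubgroupType CA); split=> //; exists w, uw.
Qed.

(** An automorphism fixes C*(u) pointwise as soon as it fixes u, so the image of u is a complete
    invariant of the class. *)
Lemma weyl_class_eq (a b : G) :
  weyl_class a = weyl_class b <-> sgval a u = sgval b u.
Proof.
rewrite /weyl_class /subclass; split=> [/classP/AutFixP /= ab|ab].
  by have := congr1 (aut_fun (sgval a)) ab; rewrite aut_invK => ->.
by apply/classP/AutFixP; rewrite /= -ab aut_funK.
Qed.

Lemma weyl_classM (a b : G) : weyl_class (a * b)%g = (weyl_class a * weyl_class
  b)%g.
Proof. exact: classM. Qed.

Lemma weyl_class_surj (x : weyl Cu) : exists a : G, x = weyl_class a.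
Proof. by exists (repr x); rewrite /weyl_class /subclass class_repr. Qed.

(** Equality means that a^-1 b agrees with an automorphism fixing C*(u) up to an inner one.
    Normality of the inner automorphisms allows the inner factor nu to be placed between a^-1 and
    b. *)
Lemma outer_weyl_class_eq (a b : G) :
  outer_weyl_class a = outer_weyl_class b <->
  exists2 nu, inner_set nu & (aut_inv (sgval a) (nu (sgval b u)) = u).
Proof.
rewrite /outer_weyl_class /subclass; split=> [/classP/= [g gF gE]|[nu nuI nuE]].
  have {}gE : class (Inn A) g = class (Inn A) ((sgval a)^-1 * sgval b)%g.
    by rewrite gE /= classM classV.
  move/classP: gE => gI.
  pose nu := (sgval a * g * (sgval b)^-1)%g.
  exists nu; last first.
    rewrite /nu /= aut_funK aut_funK; exact/AutFixP.
  have -> : nu = (sgval b * ((sgval b)^-1 * sgval a * g) * (sgval b)^-1)%g.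
    by rewrite /nu !mulgA mulgV mul1g.
  apply: inner_setJ; have := inner_setV gI.
  by rewrite !invgM !invgK.
apply/classP; rewrite /= /sub_set /=.
exists ((sgval a)^-1 * (nu * sgval b))%g; first exact/AutFixP.
transitivity (class (Inn A) ((sgval a)^-1 * sgval b)%g); last by rewrite classM
  classV.
apply/classP.
rewrite !invgM invgK -!mulgA (mulgA (sgval a)) mulgV mul1g mulgA.
have := inner_setJ (sgval b)^-1 (inner_setV nuI); by rewrite invgK.
Qed.

Lemma outer_weyl_classM (a b : G) :
  outer_weyl_class (a * b)%g = (outer_weyl_class a * outer_weyl_class b)%g.
Proof.
rewrite /outer_weyl_class /subclass -[RHS]classM; congr class.
by apply: sgval_inj; rewrite /= classM.
Qed.

Lemma outer_weyl_class_surj (x : outer_weyl Cu) : exists a : G, x =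
  outer_weyl_class a.
Proof.
have [f fP fE] := sgvalP (repr x); exists (SubgroupType fP).
rewrite /outer_weyl_class /subclass -[LHS]class_repr; congr class.
by apply: sgval_inj; rewrite /= fE.
Qed.

End WeylGroups.

Section WeylIsomorphism.
Variables (R : realType) (A : cstarAlgType R) (u s2 : A).
Hypothesis hQ2 : is_Q2 u s2.
Variables (H : completeNormedModType R[i]) (ip : H -> H -> R[i]) (e : int -> H).
Hypotheses (hip : is_inner_product ip) (he : orthonormal_basis ip e).
Variable rho : A -> {linear H -> H}.
Hypothesis hrho : canonical_representation u s2 ip e rho.
Local Notation Cu := (cstar_gen [set u]).
Local Notation G := (subgroup_type (AutPair Cu)).
Variables (sigma : G) (AdU : prufer R -> G).
Hypothesis sigma_flip : is_flip_flop u s2 (sgval sigma).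
Hypothesis AdU_u : forall xi : prufer R, sgval (AdU xi) u = (xi : R[i]) *: u.
Hypothesis AdU_inner : forall xi : prufer R, inner_set (sgval (AdU xi)).

Let su : sgval sigma u = star u. Proof. by case: sigma_flip. Qed.

Let autZ (a : G) (c : R[i]) x : sgval a (c *: x) = c *: sgval a x.
Proof.
have [fl _ _ _] := aut_morph (sgval a).
have f0 : sgval a 0 = 0 by have := fl (-1) 0 0; rewrite !scaleN1r !addNr.
by rewrite -[c *: x]addr0 fl f0 addr0.
Qed.

Let autS (a : G) x : sgval a (star x) = star (sgval a x).
Proof. by case: (aut_morph (sgval a)). Qed.

Let uu : unitary u. Proof. by case: hQ2 => [[]]. Qed.

Let conj_prufer (x : prufer R) : (x : R[i])^* = (x : R[i])^-1.
Proof. by have [nx _] := pruferP x; rewrite invC_norm nx expr1n invr1 mul1r. Qed.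

Definition flip_power (k : 'Z_2) : G := if k == 1%g then 1%g else sigma.

Definition weyl_map (p : semidirect (inversion R)) : weyl Cu :=
  weyl_class (AdU (sd_fst p) * flip_power (sd_snd p))%g.

(** The inverse in the second case appears because Ad(U_xi) multiplies u^* by the conjugate of
    xi. *)
Definition weyl_value (p : semidirect (inversion R)) : A :=
  if sd_snd p == 1%g then (sd_fst p : R[i]) *: u
  else (sd_fst p : R[i])^-1 *: star u.

Lemma weyl_valueE (p : semidirect (inversion R)) :
  sgval (AdU (sd_fst p) * flip_power (sd_snd p))%g u = weyl_value p.
Proof.
rewrite /weyl_value /flip_power /=; case: ifP => _ /=; first exact: AdU_u.
by rewrite su autS AdU_u starZ conj_prufer.
Qed.

Lemma weyl_mapM p q : weyl_map (p * q)%g = (weyl_map p * weyl_map q)%g.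
Proof.
rewrite /weyl_map -weyl_classM; apply/(weyl_class_eq hQ2).
rewrite weyl_valueE.
have -> : sgval (AdU (sd_fst p) * flip_power (sd_snd p) *
    (AdU (sd_fst q) * flip_power (sd_snd q)))%g u =
    sgval (AdU (sd_fst p) * flip_power (sd_snd p))%g (weyl_value q).
  by rewrite -weyl_valueE.
move: (AdU (sd_fst p) * _)%g (weyl_valueE p) => a.
case: p q => [x k] [y l]; rewrite /weyl_value /= => aE.
have x0 := prufer_neq0 x; have y0 := prufer_neq0 y.
have aS : sgval a (star u) = star (sgval a u) by exact: autS.
rewrite /inversion_fun; move: aE; have [->|[k1 kE]] := Z2_cases k; have [->|[l1
  lE]] := Z2_cases l;
  rewrite ?eqxx ?mulg1 ?mul1g ?eqxx ?(negbTE k1) ?(negbTE l1) => aE; rewrite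
    autZ ?aS aE /=.
- by rewrite scalerA mulrC.
- by rewrite starZ scalerA conj_prufer invfM mulrC.
- by rewrite scalerA invfM invrK mulrC.
- by rewrite kE lE /= starZ starK scalerA fmorphV /= conj_prufer invrK mulrC.
Qed.

Lemma weyl_map_inj : injective weyl_map.
Proof.
move=> [x k] [y l] /(weyl_class_eq hQ2); rewrite !weyl_valueE /weyl_value /=.
(* The matrix coefficient from e_0 to e_1 is 1 for u and 0 for its adjoint. *)
have H0 (a b : R[i]) : a != 0 -> a *: u <> b *: star u.
  move=> a0 /(congr1 (fun c => ip (rho c (e 0)) (e 1))).
  rewrite !(rhoZ hrho) !(ipZl hip) (rho_u hrho) (rho_us hQ2 hrho) !(ipee he).
  by rewrite add0r sub0r eqxx /= mulr1 mulr0 => /eqP; apply/negP.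
have H1 (v : A) (a b : R[i]) : unitary v -> a *: v = b *: v -> a = b.
  move=> uv /(congr1 (fun c => ip (rho (star v * c) (e 0)) (e 0))).
  case: uv => _ v1; rewrite -!scalerAr v1 !(rhoZ hrho) !(ipZl hip) (rho1 hrho).
  by rewrite (ipee he) eqxx !mulr1.
have x0 := prufer_neq0 x; have y0 := prufer_neq0 y.
have [->|[k1 kE]] := Z2_cases k; have [->|[l1 lE]] := Z2_cases l;
  rewrite ?eqxx ?(negbTE k1) ?(negbTE l1).
- by move=> /(H1 _ _ _ uu)/prufer_val_inj ->.
- by move=> /(H0 _ _ x0).
- by move=> /esym/(H0 _ _ y0).
- move=> /(H1 _ _ _ (unitary_star uu))/invr_inj/prufer_val_inj ->.
  by rewrite kE lE.
Qed.

Lemma weyl_map_surj (w : weyl Cu) : exists p, weyl_map p = w.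
Proof.
have [a ->] := weyl_class_surj w.
have [xi axi] := aut_circle hQ2 hip he hrho (sgvalP a).
have [ax|ax] := axi.
  exists (Semidirect (inversion R) xi 1%g); apply/(weyl_class_eq hQ2).
  by rewrite weyl_valueE /weyl_value /= ax.
exists (Semidirect (inversion R) xi^-1%g 1%R); apply/(weyl_class_eq hQ2).
by rewrite weyl_valueE /weyl_value /= invrK ax.
Qed.

Lemma weyl_generated :
  gen ([set weyl_class sigma] `|` range (fun xi => weyl_class (AdU xi))) =
  [set: weyl Cu].
Proof.
apply/seteqP; split=> // w _ K SK; have [p <-] := weyl_map_surj w.
rewrite /weyl_map weyl_classM; apply: subgroupM.
  by apply: SK; right; exists (sd_fst p).
rewrite /flip_power; case: ifP => _; last by apply: SK; left.
exact: subgroup1.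
Qed.

Lemma outer_weyl_class_cases (w : outer_weyl Cu) :
  w = outer_weyl_class 1%g \/ w = outer_weyl_class sigma.
Proof.
have [a ->] := outer_weyl_class_surj w.
have [xi axi] := aut_circle hQ2 hip he hrho (sgvalP a).
have [ax|ax] := axi; [left|right]; apply/(outer_weyl_class_eq hQ2).
  exists (sgval (AdU xi)); first exact: AdU_inner.
  by rewrite /= AdU_u -ax aut_funK.
(* The inverse compensates for the conjugation of the phase on [star u]. *)
exists (sgval (AdU xi^-1%g)); first exact: AdU_inner.
by rewrite su autS AdU_u starZ conj_prufer /= invrK -ax aut_funK.
Qed.

(** Equality would provide a unitary w with w u w^* = sigma(u) = u^*. *)
Lemma outer_flip_neq1 : outer_weyl_class sigma <> outer_weyl_class 1%g.
Proof.
move=> /(outer_weyl_class_eq hQ2)[nu [w [uw ->]]] /(congr1 (sgval sigma : A ->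
  A)).
rewrite aut_invK su /=.
exact: (u_not_conjugate hQ2 hip he hrho uw).
Qed.

Lemma outer_flip_sqr : (outer_weyl_class sigma * outer_weyl_class sigma)%g =
  outer_weyl_class 1%g.
Proof.
rewrite -outer_weyl_classM; apply/(outer_weyl_class_eq hQ2).
exists 1%g; first exact: inner_set1.
have ssu : sgval sigma (sgval sigma u) = u by rewrite su autS su starK.
have E : aut_inv (sgval sigma) (aut_inv (sgval sigma) (sgval sigma (sgval sigma
  u))) = u.
  by rewrite !aut_funK.
by rewrite ssu in E.
Qed.

Lemma outer_weyl_isomorphic : isomorphic (outer_weyl Cu) 'Z_2.
Proof.
pose m (k : 'Z_2) : outer_weyl Cu := outer_weyl_class (flip_power k).
apply: (@morphism_isomorphic _ _ m) => [k l|k l|w].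
- rewrite /m /flip_power.
  have o1 : outer_weyl_class (1%g : G) = 1%g.
    apply: (mulgI (outer_weyl_class (1%g : G))).
    by rewrite -outer_weyl_classM !mulg1.
  have one (x : outer_weyl Cu) : (outer_weyl_class 1%g * x)%g = x by rewrite o1
    mul1g.
  have one' (x : outer_weyl Cu) : (x * outer_weyl_class 1%g)%g = x by rewrite
    o1 mulg1.
  have [->|[k1 kE]] := Z2_cases k; have [->|[l1 lE]] := Z2_cases l;
    rewrite ?mul1g ?mulg1 ?eqxx ?(negbTE k1) ?(negbTE l1) ?one ?one'//.
  by rewrite outer_flip_sqr kE lE.
- rewrite /m /flip_power.
  have [->|[k1 kE]] := Z2_cases k; have [->|[l1 lE]] := Z2_cases l;
    rewrite ?eqxx ?(negbTE k1) ?(negbTE l1)//.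
  + by move/esym/outer_flip_neq1.
  + by move/outer_flip_neq1.
  + by rewrite kE lE.
- have [->|->] := outer_weyl_class_cases w; first by exists 1%g; rewrite /m
  /flip_power eqxx.
  by exists 1%R.
Qed.

End WeylIsomorphism.

Unset Implicit Arguments.

Theorem corollary6p8 (R : realType) (A : cstarAlgType R) (u s2 : A)
    (hQ2 : is_Q2 u s2)
    (H : completeNormedModType R[i]) (ip : H -> H -> R[i]) (e : int -> H)
    (hip : is_inner_product ip) (he : orthonormal_basis ip e)
    (rho : A -> {linear H -> H})
    (hrho : canonical_representation u s2 ip e rho) :
  exists (sigma : subgroup_type (AutPair (cstar_gen [set u])))
         (AdU : prufer R -> subgroup_type (AutPair (cstar_gen [set u]))),
    [/\ is_flip_flop u s2 (sgval sigma),
        (forall xi : prufer R, exists (w : A) (hw : unitary w),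
           (forall k : int, rho w (e k) = ((xi : R[i]) ^ k) *: e k) /\
           sgval (AdU xi) = Ad hw),
        (gen ([set weyl_class sigma] `|` range (fun xi => weyl_class (AdU xi)))
           = [set: weyl (cstar_gen [set u])] /\
         isomorphic (weyl (cstar_gen [set u])) (semidirect (inversion R)))
      & ([set: outer_weyl (cstar_gen [set u])]
           = [set outer_weyl_class 1%g; outer_weyl_class sigma] /\
         isomorphic (outer_weyl (cstar_gen [set u])) 'Z_2)].
Proof.
have [sigma hs] := flip_flop_exists hQ2.
have [AdU hAdU] := choice (diagonal_aut_exists hQ2 hip he hrho).
have AdU_u (xi : prufer R) := (hAdU xi).2.
have AdU_inner (xi : prufer R) : inner_set (sgval (AdU xi)).
  by have [w [hw [_ ->]]] := (hAdU xi).1; exists w, hw.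
exists sigma, AdU; split.
- exact: hs.
- by move=> xi; exact: (hAdU xi).1.
- split; first exact: (weyl_generated hQ2 hip he hrho hs AdU_u).
  apply: (morphism_isomorphic (m := weyl_map sigma AdU)).
  + exact: (weyl_mapM hQ2 hs AdU_u).
  + exact: (weyl_map_inj hQ2 hip he hrho hs AdU_u).
  + exact: (weyl_map_surj hQ2 hip he hrho hs AdU_u).
- split; last exact: (outer_weyl_isomorphic hQ2 hip he hrho hs AdU_u AdU_inner).
  apply/seteqP; split=> // w _.
  by have [->|->] := outer_weyl_class_cases hQ2 hip he hrho hs AdU_u AdU_inner
    w; [left|right].
Qed.
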